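(* Let $2\le m\le n\le \ell$, let $T\in\mathbb R^{m\times n\times\ell}$ be a Gaussian tensor and let $L\in G(\ell,mn)$ be uniform (identified with its projectivization in $\mathbb P^{mn-1}$). If $\ell=(m-1)(n-1)+1$, then $$\Pr\{\mathrm{rank}(T)=\ell\}=\Pr\{\#(L\cap\Sigma_{m,n})\ge \ell\}.$$ If $(m-1)(n-1)+1<\ell\le mn$, then $$\Pr\{\mathrm{rank}(T)=\ell\}=\Pr\{L\cap\Sigma_{m,n}\neq\emptyset\}.$$
   Context: A Gaussian tensor has i.i.d. standard Gaussian entries; tensor rank is the minimal number of rank-one tensors $a\otimes b\otimes c$ summing to $T$. $\mathbb P^{mn-1}$ is the real projective space of $\mathbb R^{m\times n}$, and $\Sigma_{m,n}=\{M\in\mathbb P^{mn-1}:\mathrm{rank}(M)=1\}$ is the (real) Segre variety. $G(d,mn)$ is the Grassmannian of $d$-dimensional linear subspaces of $\mathbb R^{m\times n}$; the uniform distribution on it is the unique probability distribution invariant under the action of the orthogonal group $O(mn)$ (with $\mathbb R^{m\times n}$ carrying the inner product $\langle A,B\rangle=\mathrm{Trace}(A^TB)$). For $L\in G(\ell,mn)$, $L\cap\Sigma_{m,n}$ means the intersection of the projectivization of $L$ with $\Sigma_{m,n}$, and $\#$ denotes the number of (real) points. *)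

(* Defs.v *)
From HB Require Import structures.
From mathcomp Require Import all_boot all_order all_algebra.
From mathcomp Require Import all_classical all_reals all_analysis.
Set Implicit Arguments.
Unset Strict Implicit.
Unset Printing Implicit Defensive.
Import Order.TTheory GRing.Theory Num.Theory.
Local Open Scope classical_set_scope.
Local Open Scope ring_scope.

Definition tensor (R : realType) (m n l : nat) := 'I_m -> 'I_n -> 'I_l -> R.

Definition tensor_rank_le (R : realType) (m n l : nat) (T : tensor R m n l)
  (r : nat) : Prop :=
  exists (a : 'I_r -> 'I_m -> R) (b : 'I_r -> 'I_n -> R) (c : 'I_r -> 'I_l -> R),
    forall i j k, T i j k = \sum_(s < r) a s i * b s j * c s k.

Definition tensor_rank_eq (R : realType) (m n l : nat) (T : tensor R m n l)
  (r : nat) : Prop :=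
  tensor_rank_le T r /\ forall r', tensor_rank_le T r' -> (r <= r')%N.

(* Gaussian tensor on a probability space: the entries are measurable,
   each has the standard normal law, and they are mutually independent
   (product rule for every family of Borel sets, one per entry; taking
   B = setT for the unused entries gives every finite subfamily). *)
Definition gaussian_tensor (d : measure_display) (Omega : measurableType d)
  (R : realType) (P : probability Omega R) (m n l : nat)
  (T : Omega -> tensor R m n l) : Prop :=
  (forall i j k, measurable_fun setT (fun w => T w i j k)) /\
  (forall i j k (B : set R), measurable B ->
      P ((fun w => T w i j k) @^-1` B) = normal_prob 0 1 B) /\
  (forall B : 'I_m -> 'I_n -> 'I_l -> set R,
      (forall i j k, measurable (B i j k)) ->
      P (\bigcap_(x : 'I_m * 'I_n * 'I_l)
           ((fun w => T w x.1.1 x.1.2 x.2) @^-1` B x.1.1 x.1.2 x.2)) =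
      (\prod_(x : 'I_m * 'I_n * 'I_l)
           P ((fun w => T w x.1.1 x.1.2 x.2) @^-1` B x.1.1 x.1.2 x.2))%E).

(* The Grassmannian G(d, N) of d-dimensional subspaces of R^N, realized
   (as usual) by orthogonal projection matrices: a subspace L corresponds
   to the symmetric idempotent matrix of rank d whose row space is L. *)
Definition grass_point (R : realType) (N d : nat) (Pr : 'M[R]_N) : Prop :=
  Pr^T = Pr /\ Pr *m Pr = Pr /\ \rank Pr = d.

Definition orthogonal_mx (R : realType) (N : nat) (Q : 'M[R]_N) : Prop :=
  Q *m Q^T = 1%:M.

(* A random point L of G(d, N) (given by its projection matrix) that is
   uniformly distributed, i.e. its law is invariant under O(N):
   for Q orthogonal, the subspace L Q has projection Q^T Pr Q, and we ask
   that the laws of Pr and Q^T Pr Q agree on all Borel rectangles of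
   R^(N x N) (a pi-system generating the Borel sets, so the laws agree). *)
Definition uniform_grass (d0 : measure_display) (Omega : measurableType d0)
  (R : realType) (P : probability Omega R) (N d : nat)
  (L : Omega -> 'M[R]_N) : Prop :=
  (forall w, grass_point d (L w)) /\
  (forall a b, measurable_fun setT (fun w => L w a b)) /\
  (forall Q : 'M[R]_N, orthogonal_mx Q ->
    forall B : 'I_N -> 'I_N -> set R, (forall a b, measurable (B a b)) ->
      P (\bigcap_(x : 'I_N * 'I_N) ((fun w => L w x.1 x.2) @^-1` B x.1 x.2)) =
      P (\bigcap_(x : 'I_N * 'I_N)
           ((fun w => (Q^T *m L w *m Q) x.1 x.2) @^-1` B x.1 x.2))).

(* R^(m x n) is identified with R^(mn) via mxvec; this identification is an
   isometry for <A,B> = Trace(A^T B).  A matrix M lies in the subspace with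
   projection matrix Pr iff mxvec M is in the row space of Pr. *)
Definition in_subspace (R : realType) (m n : nat) (Pr : 'M[R]_(m * n))
  (M : 'M[R]_(m, n)) : bool := (mxvec M <= Pr)%MS.

(* A point of P(L) /\ Sigma_{m,n}: a line spanned by a rank-one M in L. *)
Definition rank_one_in (R : realType) (m n : nat) (Pr : 'M[R]_(m * n))
  (M : 'M[R]_(m, n)) : Prop := in_subspace Pr M /\ \rank M = 1%N.

(* #(L /\ Sigma_{m,n}) >= k : there are k distinct points, i.e. k rank-one
   matrices in L, pairwise non-proportional. *)
Definition segre_count_ge (R : realType) (m n : nat) (Pr : 'M[R]_(m * n))
  (k : nat) : Prop :=
  exists M : 'I_k -> 'M[R]_(m, n),
    (forall i, rank_one_in Pr (M i)) /\
    (forall i j, i != j -> forall c : R, M i <> c *: M j).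

Definition segre_meets (R : realType) (m n : nat) (Pr : 'M[R]_(m * n)) : Prop :=
  exists M : 'M[R]_(m, n), rank_one_in Pr M.

(* Main.v *)
(* Write [T] as the l x (mn) matrix whose rows are its slices. If its rows are independent, then
   [T] has rank l if and only if its row space is spanned by l rank-one matrices. Almost surely the
   entries of [T] are algebraically independent over the rationals, and then "general position" can
   be argued by counting parameters: k algebraically independent numbers do not lie in a field
   generated by fewer than k numbers.
   - If l = (m-1)(n-1)+1, a linear relation between distinct rank-one points of the row space would
     let [T] be described by too few parameters; so l distinct points span it.
   - If l > (m-1)(n-1)+1, the row space meets the Segre variety transversally at any common point,
     by the same count. The implicit function theorem (a Banach fixed point) then gives solutions
     near that point with prescribed free coordinates, and l of them with generic free coordinates
     are independent by the previous argument.
   It remains to see that the row space of [T] has the uniform law. Gaussian families are invariant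
   under Givens rotations, which act transitively on the Grassmannian. Two laws for which the mass of
   a ball depends only on its radius agree on closed sets, and the sets of subspaces in question are
   countable unions of compact sets. *)

Require Import Defs.
From HB Require Import structures.
From mathcomp Require Import all_boot all_order all_algebra.
From mathcomp Require Import all_classical all_reals all_analysis.
From mathcomp Require Import measurable_realfun zify ring lra.
Import Order.TTheory GRing.Theory Num.Theory.
Import numFieldNormedType.Exports.
Set Implicit Arguments.
Unset Strict Implicit.
Unset Printing Implicit Defensive.
Local Open Scope classical_set_scope.
Local Open Scope ring_scope.

(** * Algebraic independence and parameter counting *)

Section alg_independence.
Variable R : realType.
Implicit Types (I : finType) (s : seq R).

(** Algebraic independence packs all genericity conditions into a single event. Its complement is
    null because a relation has countably many roots in one more variable and normal laws have no
    atoms. On the event every argument is deterministic: a degenerate configuration need not be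
    described by equations, it is refuted as soon as too few numbers generate the entries of the
    tensor. The counts rest on an exact balance. With e = l - ((m-1)(n-1)+1), the expected dimension
    of the intersection, m n + e = l + (m-1) + (n-1). A rank-one point, scaled to have an entry 1 in
    each factor, has (m-1) + (n-1) coordinates; with its l coordinates in the rows it recovers one
    row of m n entries, and e of its own coordinates can be prescribed independently of the tensor.
    A degenerate configuration saves parameters and upsets the balance. The events of the theorem
    are existential, so their measurability has to be proved too; this is a second reason for
    working with countable unions of closed sets. *)

Definition monomial I (x : I -> R) (al : I -> nat) : R := \prod_i x i ^+ al i.

Definition alg_indep I (x : I -> R) : Prop :=
  forall D (c : {ffun {ffun I -> 'I_D.+1} -> rat}),
    \sum_al ratr (c al) * monomial x (fun i => al i) = 0 -> c = 0.

(** The field generated over the rationals by [s]. Being an intersection of subfields, it lets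
    membership be settled by closure properties alone. *)
Definition Qgen s : {pred R} := fun x =>
  `[< forall S : {pred R}, divring_closed S -> {subset s <= S} -> x \in S >].

Lemma Qgen_divring_closed s : divring_closed (Qgen s).
Proof.
split.
- by rewrite unfold_in; apply/asboolP => S [].
- move=> x y; rewrite !unfold_in => /asboolP xS /asboolP yS.
  apply/asboolP => S dS sS; case: (dS) => _ + _; apply; first exact: xS.
  exact: yS.
- move=> x y; rewrite !unfold_in => /asboolP xS /asboolP yS.
  apply/asboolP => S dS sS; case: (dS) => _ _; apply; first exact: xS.
  exact: yS.
Qed.

HB.instance Definition _ s :=
  GRing.isDivringClosed.Build R (Qgen s) (Qgen_divring_closed s).

Lemma mem_Qgen s x : x \in s -> x \in Qgen s.
Proof. by move=> xs; rewrite unfold_in; apply/asboolP => S _; apply. Qed.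

Lemma Qgen_min s (S : {pred R}) :
  divring_closed S -> {subset s <= S} -> {subset Qgen s <= S}.
Proof. by move=> dS sS x; rewrite unfold_in => /asboolP; apply. Qed.

Section pspan.
Variables (p : nat) (y : 'I_p -> R).

(** Values at [y] of rational polynomials of degree at most [D] in each variable; bounding each
    degree separately makes the monomials easy to count. *)
Definition pspan D (v : R) : Prop :=
  exists c : {ffun {ffun 'I_p -> 'I_D.+1} -> rat},
    v = \sum_al ratr (c al) * monomial y (fun i => al i).

Lemma pspan_monomial D (al : 'I_p -> nat) :
  (forall i, (al i <= D)%N) -> pspan D (monomial y al).
Proof.
move=> alD; pose b : {ffun 'I_p -> 'I_D.+1} := [ffun i => inord (al i)].
exists [ffun a => (a == b)%:R]; rewrite (bigD1 b)//= ffunE eqxx rmorph1 mul1r.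
rewrite big1 ?addr0 => [|a /negbTE ab]; last by rewrite ffunE ab rmorph0 mul0r.
by apply: eq_bigr => i _; rewrite ffunE inordK// ltnS.
Qed.

Lemma pspan0 D : pspan D 0.
Proof. by exists 0; rewrite big1// => a _; rewrite ffunE rmorph0 mul0r. Qed.

Lemma pspanD D u v : pspan D u -> pspan D v -> pspan D (u + v).
Proof.
move=> [c ->] [d ->]; exists (c + d); rewrite -big_split.
by apply: eq_bigr => a _; rewrite ffunE rmorphD mulrDl.
Qed.

Lemma pspanZ D (q : rat) v : pspan D v -> pspan D (ratr q * v).
Proof.
move=> [c ->]; exists [ffun a => q * c a]; rewrite mulr_sumr.
by apply: eq_bigr => a _; rewrite ffunE rmorphM mulrA.
Qed.

Lemma pspan_sum D (J : Type) (r : seq J) (P : pred J) (F : J -> R) :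
  (forall j, P j -> pspan D (F j)) -> pspan D (\sum_(j <- r | P j) F j).
Proof.
move=> PF; elim/big_ind : _ => //; first exact: pspan0.
by move=> u v; exact: pspanD.
Qed.

Lemma pspanM D E u v : pspan D u -> pspan E v -> pspan (D + E) (u * v).
Proof.
move=> [c ->] [d ->]; rewrite mulr_suml; apply: pspan_sum => a _.
rewrite mulr_sumr; apply: pspan_sum => b _.
rewrite mulrACA -rmorphM; apply: pspanZ.
rewrite /monomial -big_split /=.
under eq_bigr do rewrite -exprD.
by apply: pspan_monomial => i; rewrite leq_add// -ltnS.
Qed.

Lemma pspan_leq D E v : (D <= E)%N -> pspan D v -> pspan E v.
Proof.
move=> DE [c ->]; apply: pspan_sum => a _; apply: pspanZ.
by apply: pspan_monomial => i; rewrite (leq_trans _ DE)// -ltnS.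
Qed.

Lemma pspan1 D : pspan D 1.
Proof.
suff -> : 1 = monomial y (fun=> 0%N) by apply: pspan_monomial.
by rewrite /monomial big1.
Qed.

Lemma pspan_var i : pspan 1 (y i).
Proof.
suff -> : y i = monomial y (fun j => (j == i) : nat).
  by apply: pspan_monomial => j; case: (j == i).
rewrite /monomial (bigD1 i)//= eqxx expr1 big1 ?mulr1// => j /negbTE ->.
by rewrite expr0.
Qed.

Lemma pspan_prod (J : finType) (P : pred J) (F : J -> R) D :
  (forall j, P j -> pspan D (F j)) ->
  pspan (#|P| * D) (\prod_(j | P j) F j).
Proof.
move=> PF; rewrite -sum_nat_const.
rewrite [X in pspan X _](eq_bigl P)//.
apply: (big_ind2 (fun n v => pspan n v)) => //.
- exact: pspan1.
- by move=> *; exact: pspanM.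
Qed.

Lemma pspanX D v n : pspan D v -> pspan (n * D) (v ^+ n).
Proof.
move=> Dv; elim: n => [|n IH]; first exact: pspan1.
by rewrite exprS mulSn; apply: pspanM.
Qed.

Definition pfrac (v : R) : Prop :=
  exists D f g, [/\ pspan D f, pspan D g, g != 0 & v = f / g].

Lemma pfrac_divring_closed : divring_closed [pred v | `[< pfrac v >]].
Proof.
split.
- apply/asboolP; exists 0%N, 1, 1; split; rewrite ?divr1 ?oner_eq0//;
  exact: pspan1.
- move=> _ _ /asboolP[D [f [g [Df Dg g0 ->]]]] /asboolP[E [h [k [Eh Ek k0 ->]]]].
  apply/asboolP; exists (D + E)%N, (f * k - g * h), (g * k); split.
  + apply: pspanD; first exact: pspanM.
    have -> : - (g * h) = ratr (-1) * (g * h) by rewrite rmorphN1 mulN1r.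
    by apply: pspanZ; exact: pspanM.
  + exact: pspanM.
  + by rewrite mulf_neq0.
  + by field; rewrite g0 k0.
- move=> _ _ /asboolP[D [f [g [Df Dg g0 ->]]]] /asboolP[E [h [k [Eh Ek k0 ->]]]].
  apply/asboolP; have [h0|h0] := eqVneq h 0.
    exists 0%N, 0, 1; split; rewrite ?oner_eq0//;
      [exact: pspan0|exact: pspan1|by rewrite h0 !(mul0r,invr0,mulr0)].
  exists (D + E)%N, (f * k), (g * h); split; try exact: pspanM.
    by rewrite mulf_neq0.
  by field; rewrite g0 k0 h0.
Qed.

Lemma pfrac_var i : pfrac (y i).
Proof.
exists 1%N, (y i), 1; split; rewrite ?oner_eq0 ?divr1//;
  [exact: pspan_var|exact: pspan1].
Qed.

(** Reduction to a common denominator; [E], the sum of the degree bounds, makes them uniform. *)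
Lemma pfrac_family I (x : I -> R) : (forall i, pfrac (x i)) ->
  exists D f g, [/\ forall i, pspan D (f i), pspan D g, g != 0 &
    forall i, x i = f i / g].
Proof.
move=> /choice[D /choice[f /choice[g H]]].
pose E := (\sum_i D i)%N.
have DE i : (D i <= E)%N by rewrite /E (bigD1 i)//= leq_addr.
have fE i : pspan E (f i) by case: (H i) => /(pspan_leq (DE i)).
have gE i : pspan E (g i) by case: (H i) => _ /(pspan_leq (DE i)).
have g0 i : g i != 0 by case: (H i).
exists (#|I| * E + E)%N, (fun i => f i * \prod_(j | j != i) g j), (\prod_j g j).
split.
- move=> i; rewrite addnC; apply: pspanM => //.
  apply: (@pspan_leq (#|[pred j | j != i]| * E)); last exact: pspan_prod.
  by rewrite leq_mul2r max_card orbT.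
- by apply: (@pspan_leq (#|I| * E)); rewrite ?leq_addr//; exact: pspan_prod.
- by apply/prodf_neq0.
- move=> i; have [_ _ _ ->] := H i; rewrite [\prod_j g j](bigD1 i)//=.
  have P0 : \prod_(j | j != i) g j != 0 by apply/prodf_neq0.
  by field; rewrite P0 g0.
Qed.

End pspan.

(* If #|I| > p, there are more monomials of partial degrees <= M in [x] than
   monomials in [y] of the corresponding degree, so the former are linearly
   dependent over the rationals. *)
Lemma alg_indep_pspan I (x : I -> R) p (y : 'I_p -> R) :
  alg_indep x -> (forall i, pfrac y (x i)) -> (#|I| <= p)%N.
Proof.
move=> xI /pfrac_family[D [f [g [fD gD g0 xE]]]].
rewrite leqNgt; apply/negP => pq.
(* With this [M], (E + 1)^p <= ((q D + 1)(M + 1))^p = M (M + 1)^p < (M + 1)^(p + 1), so there are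
   more monomials in [x] as soon as p < q. *)
pose q := #|I|; pose M := ((q * D).+1 ^ p)%N.
pose E := (q * (M * D))%N.
have cardlt : (#|{ffun 'I_p -> 'I_E.+1}| < #|{ffun I -> 'I_M.+1}|)%N.
  rewrite !card_ffun !card_ord.
  apply: (@leq_trans (M.+1 ^ p.+1)%N); last by apply: leq_pexp2l.
  rewrite expnS; apply: (@leq_ltn_trans (M * M.+1 ^ p)%N); last first.
    by rewrite ltn_mul2r expn_gt0/= ltnSn.
  rewrite -expnMn; case: (posnP p) => [->|p0]; first by rewrite !expn0.
  by rewrite leq_exp2r// /E; lia.
have term (al : {ffun I -> 'I_M.+1}) :
    pspan y E (monomial x (fun i => al i) * g ^+ (q * M)).
  have -> : monomial x (fun i => al i) * g ^+ (q * M) =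
            \prod_i (f i ^+ al i * g ^+ (M - al i)).
    rewrite mulnC exprM /q -(prodr_const I) /monomial -big_split /=.
    apply: eq_bigr => i _; rewrite xE.
    have -> : g ^+ M = g ^+ al i * g ^+ (M - al i).
      by rewrite -exprD subnKC// -ltnS.
    by rewrite mulrA -exprMn divfK.
  apply: pspan_prod => i _.
  have -> : (M * D = al i * D + (M - al i) * D)%N.
    by rewrite -mulnDl subnKC// -ltnS.
  by apply: pspanM; exact: pspanX.
have /choice[c cE] := term.
(* Each row of [A] expands a cleared monomial in [x] in the monomials in [y]; a nonzero vector of
   the left kernel is a rational relation between the [x i]. *)
pose A : 'M[rat]_(#|{ffun I -> 'I_M.+1}|, #|{ffun 'I_p -> 'I_E.+1}|) :=
  \matrix_(a, b) c (enum_val a) (enum_val b).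
have : kermx A != 0.
  rewrite -mxrank_eq0 mxrank_ker subn_eq0 -ltnNge.
  exact: leq_ltn_trans (rank_leq_col A) cardlt.
move=> /rowV0Pn[v vA v0]; move: vA => /sub_kermxP vA.
pose d : {ffun {ffun I -> 'I_M.+1} -> rat} := [ffun a => v 0 (enum_rank a)].
suff : d = 0.
  move=> dE; move/eqP: v0; apply; apply/rowP => j; rewrite mxE.
  by move/ffunP/(_ (enum_val j)): dE; rewrite !ffunE enum_valK.
apply: xI; apply/eqP; rewrite -(mulIr_eq0 _ (mulIf (expf_neq0 (q * M) g0))).
apply/eqP; rewrite mulr_suml.
under eq_bigr => a _ do rewrite -mulrA cE mulr_sumr.
rewrite exchange_big /= big1// => b _.
under eq_bigr => a _ do rewrite mulrA -rmorphM.
rewrite -mulr_suml -rmorph_sum /=.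
suff -> : \sum_a d a * c a b = 0 by rewrite rmorph0 mul0r.
transitivity ((v *m A) 0 (enum_rank b)); last by rewrite vA mxE.
rewrite mxE (reindex_onto (@enum_val _ _) (@enum_rank _)) /=; last first.
  by move=> a _; rewrite enum_rankK.
apply: eq_big => [a|a _]; first by rewrite enum_valK eqxx.
by rewrite ffunE enum_valK mxE enum_rankK.
Qed.

(** Fractions in the elements of [s] form a subfield containing [s]. This bound on the transcendence
    degree is behind every later count. *)
Lemma alg_indep_Qgen I (x : I -> R) s :
  alg_indep x -> (forall i, x i \in Qgen s) -> (#|I| <= size s)%N.
Proof.
move=> xI xs; apply: (@alg_indep_pspan I x (size s) (tnth (in_tuple s))) => // i.
have : x i \in [pred v | `[< pfrac (tnth (in_tuple s)) v >]].
  apply: (Qgen_min _ _ (xs i)) => [|z /seq_tnthP[j ->]].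
    exact: pfrac_divring_closed.
  by apply/asboolP; exact: pfrac_var.
by move=> /asboolP.
Qed.

End alg_independence.

(** * Extending an algebraically independent family *)

Section alg_independence_extension.
Variable R : realType.
Implicit Types (I J : finType).

Lemma alg_indep_bij I J (x : I -> R) (h : J -> I) :
  bijective h -> alg_indep x -> alg_indep (fun j => x (h j)).
Proof.
move=> [g hK gK] xI D c c0.
pose lift (b : {ffun J -> 'I_D.+1}) : {ffun I -> 'I_D.+1} :=
  [ffun i => b (g i)].
pose down (a : {ffun I -> 'I_D.+1}) : {ffun J -> 'I_D.+1} :=
  [ffun j => a (h j)].
have liftK : cancel lift down by move=> b; apply/ffunP => j; rewrite !ffunE hK.
have downK : cancel down lift by move=> a; apply/ffunP => i; rewrite !ffunE gK.
suff : [ffun a => c (down a)] = 0.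
  by move/ffunP => d0; apply/ffunP => b; have := d0 (lift b); rewrite !ffunE liftK.
apply: xI; rewrite -{2}c0 (reindex lift); last first.
  by exists down => ? _.
apply: eq_bigr => b _; rewrite ffunE liftK; congr (_ * _).
rewrite /monomial (reindex h); last by exists g => ? _.
by apply: eq_bigr => j _; rewrite ffunE hK.
Qed.

Lemma countable_roots (p : {poly R}) : p != 0 -> countable [set t | root p t].
Proof.
have [n] := ubnP (size p); elim: n p => // n IH p ltpn p0.
have [[t pt]|nort] := pselect (exists t, root p t); last first.
  rewrite (_ : mkset _ = set0); first exact: countable0.
  by apply/seteqP; split => // t pt; apply: nort; exists t.
have /factor_theorem[q pE] := pt.
have q0 : q != 0 by apply: contraNneq p0 => q0; rewrite pE q0 mul0r.
have sq : (size q < n)%N.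
  move: ltpn; rewrite pE size_Mmonic ?monicXsubC// size_XsubC addn2 /=.
  by rewrite ltnS.
apply: (@sub_countable _ _ _ ([set t] `|` [set u | root q u])).
  apply: subset_card_le => u /=; rewrite pE rootM root_XsubC => /orP[|/eqP->].
    by right.
  by left.
rewrite -bigcup2E; apply: bigcup_countable => // -[|[|i]] _ /=.
- exact: countable1.
- exact: IH.
- exact: countable0.
Qed.

Definition oext I (x : I -> R) (t : R) : option I -> R :=
  fun o => if o is Some i then x i else t.

Section polynomial_in_last_variable.
Variables (I : finType) (x : I -> R) (D : nat).
Variable c : {ffun {ffun option I -> 'I_D.+1} -> rat}.

Let comb (j : 'I_D.+1) (b : {ffun I -> 'I_D.+1}) : {ffun option I -> 'I_D.+1} :=
  [ffun o => if o is Some i then b i else j].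

Let restr (a : {ffun option I -> 'I_D.+1}) : {ffun I -> 'I_D.+1} :=
  [ffun i => a (Some i)].

Let combK j : cancel (comb j) restr.
Proof. by move=> b; apply/ffunP => i; rewrite !ffunE. Qed.

Let restrK (a : {ffun option I -> 'I_D.+1}) : comb (a None) (restr a) = a.
Proof. by apply/ffunP => -[i|]; rewrite !ffunE. Qed.

Let P : {poly R} :=
  \sum_(a : {ffun option I -> 'I_D.+1})
    (ratr (c a) * monomial x (fun i => a (Some i))) *: 'X^(a None).

Let monomial_oext t (a : {ffun option I -> 'I_D.+1}) :
  monomial (oext x t) (fun o => a o) =
  monomial x (fun i => a (Some i)) * t ^+ a None.
Proof.
rewrite /monomial (bigD1 None)//= mulrC; congr (_ * _).
rewrite (reindex_omap Some id) => [|[]//].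
by apply: eq_bigl => i; rewrite /= eqxx.
Qed.

(** For fixed [x] the relation is a polynomial in the last variable. Its coefficients are rational
    polynomials in [x]; if they all vanished, the independence of [x] would give c = 0. *)
Lemma countable_oext_relation : alg_indep x -> c != 0 ->
  countable [set t | \sum_a ratr (c a) * monomial (oext x t) (fun i => a i) = 0].
Proof.
move=> xI c0.
suff P0 : P != 0.
  have := countable_roots P0; congr (countable _); apply/seteqP.
  have E t : P.[t] =
      \sum_a ratr (c a) * monomial (oext x t) (fun i => a i).
    rewrite horner_sum; apply: eq_bigr => a _.
    by rewrite hornerZ hornerXn monomial_oext mulrA.
  by split => t; rewrite /= rootE E => /eqP.
apply: contra_neq c0 => P0; apply/ffunP => a0; rewrite [RHS]ffunE.
suff : [ffun b => c (comb (a0 None) b)] = 0.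
  by move/ffunP/(_ (restr a0)); rewrite !ffunE restrK.
apply: xI; transitivity P`_(a0 None); last by rewrite P0 coef0.
rewrite coef_sum [RHS](bigID (fun a : {ffun option I -> 'I_D.+1} => a None == a0 None))/=.
rewrite [X in _ = _ + X]big1 ?addr0; last first.
  by move=> a /negbTE na; rewrite coefZ coefXn eq_sym (inj_eq val_inj) na mulr0.
rewrite [RHS](reindex_onto (comb (a0 None)) restr) /=; last first.
  by move=> a /eqP <-; rewrite restrK.
apply: eq_big => b; first by rewrite combK eqxx ffunE eqxx.
move=> _; rewrite !ffunE coefZ coefXn eqxx mulr1; congr (_ * _).
by apply: eq_bigr => i _; rewrite ffunE.
Qed.

End polynomial_in_last_variable.

(** There are countably many rational relations. Countability serves twice: the set does not exhaust
    an interval, and normal laws do not charge it. *)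
Lemma countable_not_alg_indep I (x : I -> R) : alg_indep x ->
  countable [set t | ~ alg_indep (oext x t)].
Proof.
move=> xI.
apply: (@sub_countable _ _ _ (\bigcup_(Dc in [set: {D & {ffun {ffun option I -> 'I_D.+1} -> rat}}])
  if projT2 Dc == 0 then set0 else
     [set t | \sum_a ratr (projT2 Dc a) * monomial (oext x t) (fun i => a i) = 0])).
  apply: subset_card_le => t /= /existsNP[D /existsNP[c /not_implyP[cE c0]]].
  by exists (existT _ D c) => //=; case: eqP.
apply: bigcup_countable => [|[D c] _ /=]; first exact: countableP.
case: eqP => [_|/eqP c0].
  exact: countable0.
exact: countable_oext_relation.
Qed.

Lemma alg_indep_extend1 I (x : I -> R) (t0 e : R) : 0 < e -> alg_indep x ->
  exists2 t, `|t - t0| < e & alg_indep (oext x t).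
Proof.
move=> e0 /countable_not_alg_indep cx.
have : ~ (`]t0 - e, t0 + e[%classic `<=` [set t | ~ alg_indep (oext x t)]).
  move=> /subset_card_le/sub_countable/(_ cx)/countable_lebesgue_measure0.
  rewrite lebesgue_measure_itv /= lte_fin.
  rewrite ifT; last by lra.
  by rewrite -EFinD => /eqP; rewrite eqe; apply/negP; lra.
move=> /existsNP[t /not_implyP[tI /contrapT tx]]; exists t => //.
by move: tI; rewrite /= in_itv/= => /andP[? ?]; rewrite ltr_distlC; lra.
Qed.

Definition sum_fun I J (x : I -> R) (t : J -> R) : I + J -> R :=
  fun s => match s with inl i => x i | inr j => t j end.

(** Supplies the free coordinates of the local solutions: close to prescribed values, and
    independent of each other and of the tensor. *)
Lemma alg_indep_extend I s (x : I -> R) (t0 : 'I_s -> R) (e : R) : 0 < e ->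
  alg_indep x ->
  exists2 t : 'I_s -> R, (forall j, `|t j - t0 j| < e) & alg_indep (sum_fun x t).
Proof.
move=> e0 xI; elim: s t0 => [|s IH] t0.
  exists (fun=> 0) => [[]//|].
  have nI0 : 'I_0 -> False by case.
  have bh : bijective (fun q : I + 'I_0 => match q with
      inl i => i | inr j => False_rect I (nI0 j) end).
    by exists inl => [[//|j]|//]; case: (nI0 j).
  by have := alg_indep_bij bh xI; congr alg_indep; apply/funext => -[//|[]].
have [t te tI] := IH (fun j => t0 (lift ord0 j)).
have [u ue uI] := alg_indep_extend1 (t0 ord0) e0 tI.
exists (fun j => if unlift ord0 j is Some k then t k else u).
  by move=> j; case: unliftP => [k ->|->].
pose h (q : I + 'I_s.+1) : option (I + 'I_s) := match q with
  inl i => Some (inl i) | inr j => omap inr (unlift ord0 j) end.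
have bh : bijective h.
  exists (fun o => match o with Some (inl i) => inl i
    | Some (inr k) => inr (lift ord0 k) | None => inr ord0 end).
    by move=> [//|j] /=; case: unliftP => [k ->|->].
  by move=> [[//|k]|] /=; rewrite ?liftK ?unlift_none.
have := alg_indep_bij bh uI; congr alg_indep; apply/funext => -[//|j] /=.
by case: unliftP.
Qed.

End alg_independence_extension.

Local Close Scope classical_set_scope.

(** * Parameter counts for a generic matrix *)

Section generic_tensor.
Variable R : realType.

(** By Cramer's rule, solving a linear system stays inside the field. *)
Lemma mxOver_invmx (s : seq R) k (A : 'M[R]_k) :
  A \is a mxOver (Qgen s) -> invmx A \is a mxOver (Qgen s).
Proof.
have det_Qgen j (B : 'M[R]_j) : B \is a mxOver (Qgen s) -> \det B \in Qgen s.
  move=> /mxOverP BS; rewrite rpred_sum// => p _; rewrite rpredM//.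
    by rewrite rpredX// rpredN rpred1.
  by rewrite rpred_prod.
move=> AS; rewrite /invmx; case: ifP => // _.
apply/mxOverP => i j; rewrite !mxE rpredM//.
  by rewrite rpredV det_Qgen.
rewrite rpredM//; first by rewrite rpredX// rpredN rpred1.
apply: det_Qgen; apply/mxOverP => a b; rewrite !mxE.
exact: (mxOverP AS).
Qed.

Lemma row_free_family (K : finType) N (v : K -> 'rV[R]_N) (B : {set K}) :
  (forall mu : K -> R, \sum_(i in B) mu i *: v i = 0 ->
     forall i, i \in B -> mu i = 0) ->
  row_free (\matrix_(k < #|B|) v (enum_val k)).
Proof.
move=> vfree; apply: inj_row_free => w wv.
pose mu i := \sum_(j < #|B| | enum_val j == i) w 0 j.
have muE j : mu (enum_val j) = w 0 j.
  rewrite /mu (bigD1 j)//= big1 ?addr0// => j' /andP[/eqP/enum_val_inj->].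
  by rewrite eqxx.
apply/rowP => j; rewrite mxE -muE; apply: vfree; last exact: enum_valP.
rewrite big_enum_val -[RHS]wv mulmx_sum_row; apply: eq_bigr => i _.
by rewrite muE rowK.
Qed.

(** A column of the pseudo-inverse is a vector of a dual basis; pairing a relation with it isolates
    one term. *)
Lemma dual_vector (K : finType) N (v : K -> 'rV[R]_N) (B : {set K}) :
  (forall mu : K -> R, \sum_(i in B) mu i *: v i = 0 ->
     forall i, i \in B -> mu i = 0) ->
  forall j, j \in B ->
  exists d : 'cV[R]_N, forall i, i \in B -> v i *m d = (i == j)%:R%:M.
Proof.
move=> /row_free_family vfree j jB.
exists (col (enum_rank_in jB j) (pinvmx (\matrix_(k < #|B|) v (enum_val k)))).
move=> i iB; rewrite -[v i]/((fun=> v i) (enum_rank_in jB i)).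
have -> : v i = row (enum_rank_in jB i) (\matrix_(k < #|B|) v (enum_val k)).
  by rewrite rowK enum_rankK_in.
apply/matrixP => x y; rewrite !ord1 [RHS]mxE /=.
rewrite mxE; transitivity ((\matrix_(k < #|B|) v (enum_val k) *m
    pinvmx (\matrix_(k < #|B|) v (enum_val k)))
    (enum_rank_in jB i) (enum_rank_in jB j)).
  by rewrite [RHS]mxE; apply: eq_bigr => k _; rewrite !mxE.
by rewrite mulmxVp// mxE (can_in_eq (enum_rankK_in jB)).
Qed.

Section count.
Variables (l N : nat) (J : finType) (T : 'M[R]_(l, N)) (z : J -> R).
Hypothesis Tz : alg_indep (sum_fun (fun p : 'I_l * 'I_N => T p.1 p.2) z).

(** The [z j] outside [B] are added to the generators, so they occur on both sides of the count and
    cancel. *)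
Lemma generic_count s (B : {set J}) (A : {set 'I_l * 'I_N}) :
  (forall r j, T r j \in Qgen (s ++ [seq T p.1 p.2 | p in A])) ->
  (forall j, j \in B -> z j \in Qgen (s ++ [seq T p.1 p.2 | p in A])) ->
  (l * N + #|B| <= size s + #|A|)%N.
Proof.
move=> TS zS.
pose s' := (s ++ [seq T p.1 p.2 | p in A]) ++ [seq z j | j in ~: B].
have sub : {subset Qgen (s ++ [seq T p.1 p.2 | p in A]) <= Qgen s'}.
  apply: Qgen_min; first exact: Qgen_divring_closed.
  by move=> x xs; apply: mem_Qgen; rewrite mem_cat xs.
have := @alg_indep_Qgen _ _ _ s' Tz.
rewrite card_sum card_prod !card_ord !size_cat !size_image.
have := cardsC B.
suff H : forall i, sum_fun (fun p : 'I_l * 'I_N => T p.1 p.2) z i \in Qgen s'.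
  by move=> <- /(_ H); rewrite addnA leq_add2r.
move=> [[r j]|j] /=; first exact: sub.
have [jB|jB] := boolP (j \in B); first exact/sub/zS.
by apply: mem_Qgen; rewrite mem_cat fintype.image_f ?orbT// inE.
Qed.

(** A dependent row would be given by [l.-1] coefficients in place of its [N] entries. *)
Lemma generic_row_free : (l <= N)%N -> row_free T.
Proof.
move=> lN; apply/negPn/negP => /row_freePn[r0].
case/submxP => D DE.
pose s := [seq D 0 j | j : 'I_l.-1].
pose A := [set p : 'I_l * 'I_N | p.1 != r0].
suff H : forall r j, T r j \in Qgen (s ++ [seq T p.1 p.2 | p in A]).
  have := @generic_count s finset.set0 A H.
  rewrite cards0 addn0 size_image card_ord.
  have -> : #|A| = (l.-1 * N)%N.
    rewrite (_ : A = finset.setX [set~ r0] [set: _]); last first.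
      by apply/finset.setP => -[a b]; rewrite !inE andbT.
    by rewrite finset.cardsX cardsC1 cardsT !card_ord.
  have l0 : (0 < l)%N by apply: leq_ltn_trans (ltn_ord r0).
  have lE : (l * N = N + l.-1 * N)%N by rewrite -mulSn prednK.
  rewrite lE leq_add2r leqNgt prednK// lN => H0.
  by have /H0 : forall j, j \in finset.set0 -> z j \in Qgen (s ++ [seq T p.1 p.2 | p in A])
    by move=> j; rewrite finset.inE.
have H1 r j : r != r0 -> T r j \in Qgen (s ++ [seq T p.1 p.2 | p in A]).
  move=> rr0; apply: mem_Qgen; rewrite mem_cat; apply/orP; right.
  by apply/fintype.imageP; exists (r, j) => //; rewrite inE.
move=> r j; have [->|] := eqVneq r r0; last exact: H1.
have -> : T r0 j = \sum_k D 0 k * T (lift r0 k) j.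
  transitivity (row r0 T 0 j); first by rewrite mxE.
  by rewrite DE mxE; apply: eq_bigr => k _; rewrite !mxE.
rewrite rpred_sum// => k _; rewrite rpredM//; last first.
  by apply: H1; rewrite eq_sym neq_lift.
by apply: mem_Qgen; rewrite mem_cat fintype.image_f.
Qed.

(* [k] independent vectors of the row space let one solve for [k] rows of [T],
   at the cost of the [k * l] coordinates of these vectors in the rows of [T]. *)
Lemma generic_count_span (K : finType) (q : K -> 'rV[R]_N) (B : {set K})
    (Z : {set J}) s :
  (forall i, i \in B -> (q i <= T)%MS) ->
  (forall mu : K -> R, \sum_(i in B) mu i *: q i = 0 ->
     forall i, i \in B -> mu i = 0) ->
  (forall i, i \in B -> q i \is a mxOver (Qgen s)) ->
  (forall j, j \in Z -> z j \in Qgen s) ->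
  (#|B| * N + #|Z| <= #|B| * l + size s)%N.
Proof.
move=> qT qfree qS zS; set k := #|B|.
pose Q := \matrix_(i < k) q (enum_val i).
have Qfree : row_free Q by exact: row_free_family.
have : (Q <= T)%MS.
  by apply/row_subP => i; rewrite rowK; apply: qT; exact: enum_valP.
case/submxP => C QE.
have Crank : \rank C = k.
  apply/eqP; rewrite eqn_leq rank_leq_row -{1}(eqP Qfree) QE.
  exact: mxrankM_maxl.
(* [C] has rank [k], so [k] of its columns, chosen by [h], form an invertible block [D]; the rows of
   [T] with these indices are the ones solved for. *)
have CTfull : row_full C^T by rewrite /row_full mxrank_tr Crank.
have Dunit : rowsub (fullrankfun CTfull) C^T \in unitmx.
  by rewrite -row_free_unit fullrowsub_free.
have hinj : injective (fullrankfun CTfull) by exact: fullrankfun_inj.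
move: (fullrankfun CTfull : 'I_k -> 'I_l) hinj Dunit => h hinj Dunit {CTfull}.
pose H := [set h i | i : 'I_k].
have cardH : #|H| = k by rewrite card_imset// card_ord.
pose D := colsub h C.
have {}Dunit : D \in unitmx.
  rewrite -unitmx_tr; move: Dunit; congr (_ \in unitmx).
  by apply/matrixP => i j; rewrite !mxE.
(* [T0] keeps the rows of [T] that serve as generators, so that [QD] is a linear system with matrix
   [D] for the other rows. *)
pose T0 : 'M[R]_(l, N) := \matrix_(r, j) if r \in H then 0 else T r j.
have QD : Q = C *m T0 + D *m rowsub h T.
  rewrite QE; apply/matrixP => i j; rewrite !mxE [LHS](bigID (mem H))/= addrC.
  congr (_ + _).
    rewrite [RHS](bigID (mem H))/= [X in _ = X + _]big1 ?add0r.
      by apply: eq_bigr => r /negbTE rH; rewrite mxE rH.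
    by move=> r rH; rewrite mxE rH mulr0.
  rewrite big_imset/=; last by move=> ? ? _ _; exact: hinj.
  by apply: eq_bigr => r _; rewrite !mxE.
pose s' := s ++ [seq C p.1 p.2 | p : 'I_k * 'I_l].
pose A := [set p : 'I_l * 'I_N | p.1 \notin H].
pose S := Qgen (s' ++ [seq T p.1 p.2 | p in A]).
have sub : {subset Qgen s <= S}.
  apply: Qgen_min; first exact: Qgen_divring_closed.
  by move=> x xs; apply: mem_Qgen; rewrite !mem_cat xs.
have CS i r : C i r \in S.
  apply: mem_Qgen; rewrite !mem_cat; apply/orP; left; apply/orP; right.
  by apply/fintype.imageP; exists (i, r).
have TH r j : r \notin H -> T r j \in S.
  move=> rH; apply: mem_Qgen; rewrite mem_cat; apply/orP; right.
  by apply/fintype.imageP; exists (r, j) => //; rewrite inE.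
have T0S : T0 \is a mxOver S.
  apply/mxOverP => r j; rewrite mxE; case: ifPn => [_|]; first exact: rpred0.
  exact: TH.
have QS : Q \is a mxOver S.
  apply/mxOverP => i j; rewrite mxE; apply/sub.
  by apply: (mxOverP (qS _ _)); exact: enum_valP.
have hS : rowsub h T \is a mxOver S.
  have -> : rowsub h T = invmx D *m (Q - C *m T0).
    by rewrite QD addrC addKr mulKmx.
  rewrite mxOverM//.
    by apply: mxOver_invmx; apply/mxOverP => i j; rewrite mxE.
  by rewrite rpredB// mxOverM//; apply/mxOverP.
have kl : (k <= l)%N by rewrite -cardH -[l in (_ <= l)%N]card_ord max_card.
have cardA : #|A| = ((l - k) * N)%N.
  rewrite (_ : A = finset.setX (~: H) [set: _]); last first.
    by apply/finset.setP => -[a b]; rewrite !inE andbT.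
  by rewrite finset.cardsX [#|~: H|]cardsCs finset.setCK cardsT !card_ord cardH.
have TS r j : T r j \in S.
  have [|/TH//] := boolP (r \in H).
  by move=> /imsetP[i _ ->]; have := mxOverP hS i j; rewrite mxE.
have := @generic_count s' Z A TS (fun j jZ => sub _ (zS j jZ)).
rewrite cardA size_cat size_image card_prod !card_ord.
have -> : (l * N = k * N + (l - k) * N)%N by rewrite -mulnDl subnKC.
by lia.
Qed.

End count.
End generic_tensor.

(** [N] stands for m n. The equation N + e = l + m.-1 + n.-1 makes the count exact for [k] points
    without special position. Here one vector of length [m] costs u = k - 2 coefficients instead of
    m.-1, which is less because k <= m. *)
Lemma count_arith_a k u m n l e N :
  (N + e + 2 = l + m + n -> 0 < m -> 0 < n -> k = u.+2 -> k <= m ->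
  k * N + k * e <= k * l + (u.+1 * m.-1 + (u + k * n.-1)) -> False)%N.
Proof.
case: m n => // m [//|n] dims _ _ kE km H.
have := congr1 (muln k) dims; move: H km; rewrite /= kE; clear.
by rewrite !mulnDr; lia.
Qed.

(** Two points whose second factors are proportional: n.-1 > 0 parameters are saved. *)
Lemma count_arith_b m n l e N :
  (N + e + 2 = l + m + n -> 0 < m -> 1 < n ->
  2 * N + 2 * e <= 2 * l + (2 * m.-1 + 1 * n.-1) -> False)%N.
Proof. by case: m n => // m [//|n] dims _ n2; lia. Qed.

(** The left side exceeds the right one by exactly l - k. It is here that the number k + 1 of points
    is bounded by [l]. *)
Lemma count_arith_c k m n l e :
  (m * n + e + 2 = l + m + n -> 0 < m -> 0 < n -> k < l -> m <= k ->
  k * (m * n) + k.+1 * e <= k * l + (k.+1 * m.-1 + ((k.+1 - m) * n).-1) -> False)%N.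
Proof.
case: m n => // m [//|n] dims _ _ kl mk.
have [j kE] : exists j, k = (m.+1 + j)%N by exists (k - m.+1)%N; lia.
have -> : (k.+1 - m.+1 = j.+1)%N by lia.
have := congr1 (muln k) dims; rewrite kE in kl *; move: dims kl; clear.
rewrite !mulnDr; lia.
Qed.

(** * Linear independence of rank-one points *)

Section rank_one_points.
Variable R : realType.

(** A kernel vector yields a row [w] with w w^T = 0, a vanishing sum of real squares. *)
Lemma gram_unitmx k N (A : 'M[R]_(k, N)) : row_free A -> A *m A^T \in unitmx.
Proof.
move=> Afree; rewrite -row_free_unit; apply: inj_row_free => v vAA.
suff : v *m A = 0 by rewrite -(mul0mx _ A) => /(row_free_inj Afree).
have : (v *m A) *m (v *m A)^T = 0 by rewrite trmx_mul mulmxA -(mulmxA v) vAA mul0mx.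
move: (v *m A) => w /matrixP/(_ 0 0); rewrite !mxE.
under eq_bigr do rewrite mxE -expr2.
move=> /psumr_eq0P H; apply/rowP => j; rewrite mxE; apply/eqP.
by rewrite -sqrf_eq0 H// => i _; rewrite sqr_ge0.
Qed.

Lemma card_subset_ex (K : finType) (A : {set K}) k : (k <= #|A|)%N ->
  exists2 B : {set K}, B \subset A & #|B| = k.
Proof.
move=> kA; exists [set x in take k (enum A)].
  by apply/fintype.subsetP => x; rewrite inE => /mem_take; rewrite mem_enum.
rewrite cardsE; move/card_uniqP: (take_uniq k (enum_uniq (mem A))) => ->.
by rewrite size_take_min -cardE; apply/minn_idPl.
Qed.

Lemma card_off_graph (K : finType) k (f : K -> 'I_k) (B : {set K}) :
  #|[set p : K * 'I_k | (p.1 \in B) && (p.2 != f p.1)]| = (#|B| * k.-1)%N.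
Proof.
rewrite -sum1_card.
rewrite (eq_bigl (fun p : K * 'I_k => (p.1 \in B) && (p.2 != f p.1))); last first.
  by move=> p; rewrite inE.
rewrite -(pair_big_dep (mem B) (fun i j => j != f i) (fun _ _ => 1%N)) /=.
rewrite -sum_nat_const; apply: eq_bigr => i _.
by rewrite sum1_card cardC1 card_ord.
Qed.

Variables (l m n e : nat) (K : finType) (T : 'M[R]_(l, m * n)).
Variables (a : K -> 'rV[R]_m) (b : K -> 'rV[R]_n) (f : K -> 'I_m) (g : K -> 'I_n).
Hypotheses (af : forall i, a i 0 (f i) = 1) (bg : forall i, b i 0 (g i) = 1).
Let q i : 'rV[R]_(m * n) := mxvec ((a i)^T *m b i).
Hypothesis qT : forall i, (q i <= T)%MS.
Variable coord : 'I_e -> 'I_m + 'I_n.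
(** The coordinates prescribed independently of [T]: [e] for each point, at the same positions for
    all points. *)
Definition free_coords (p : K * 'I_e) : R :=
  match coord p.2 with inl j => a p.1 0 j | inr j => b p.1 0 j end.
Hypothesis Tz : alg_indep (sum_fun (fun p : 'I_l * 'I_(m * n) => T p.1 p.2) free_coords).
Hypotheses (m2 : (2 <= m)%N) (n2 : (2 <= n)%N).
Hypothesis dims : (m * n + e + 2 = l + m + n)%N.
Hypothesis Kl : (#|K| <= l)%N.
Hypothesis qdist : forall i j, i != j -> forall t : R, q i <> t *: q j.

Let acoords (B : {set K}) :=
  [seq a p.1 0 p.2 | p in [set p : K * 'I_m | (p.1 \in B) && (p.2 != f p.1)]].
Let bcoords (B : {set K}) :=
  [seq b p.1 0 p.2 | p in [set p : K * 'I_n | (p.1 \in B) && (p.2 != g p.1)]].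

Let size_acoords B : size (acoords B) = (#|B| * m.-1)%N.
Proof. by rewrite size_image card_off_graph. Qed.
Let size_bcoords B : size (bcoords B) = (#|B| * n.-1)%N.
Proof. by rewrite size_image card_off_graph. Qed.

Let acoords_Qgen B s i : {subset acoords B <= s} -> i \in B ->
  a i \is a mxOver (Qgen s).
Proof.
move=> Bs iB; apply/mxOverP => o j; rewrite ord1.
have [->|jf] := eqVneq j (f i); first by rewrite af rpred1.
apply/mem_Qgen/Bs/fintype.imageP; exists (i, j) => //.
by rewrite inE /= iB jf.
Qed.

Let bcoords_Qgen B s i : {subset bcoords B <= s} -> i \in B ->
  b i \is a mxOver (Qgen s).
Proof.
move=> Bs iB; apply/mxOverP => o j; rewrite ord1.
have [->|jf] := eqVneq j (g i); first by rewrite bg rpred1.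
apply/mem_Qgen/Bs/fintype.imageP; exists (i, j) => //.
by rewrite inE /= iB jf.
Qed.

Let free_on (B : {set K}) := forall mu : K -> R,
  \sum_(i in B) mu i *: q i = 0 -> forall i, i \in B -> mu i = 0.

Let relation_mx (A : {set K}) (la : K -> R) :
  \sum_(i in A) la i *: q i = 0 -> \sum_(i in A) la i *: ((a i)^T *m b i) = 0.
Proof.
move=> rel; apply: (can_inj mxvecK); rewrite linear0 linear_sum /= -[RHS]rel.
by apply: eq_bigr => i _; rewrite linearZ.
Qed.

(** Only the points of [B] are independent, yet the free coordinates of all points of [C] count: the
    redundant point of a relation also brings [e] prescribed numbers. *)
Let count_normalized (B C : {set K}) s : free_on B ->
  B \subset C ->
  (forall i, i \in C -> a i \is a mxOver (Qgen s)) ->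
  (forall i, i \in C -> b i \is a mxOver (Qgen s)) ->
  (#|B| * (m * n) + #|C| * e <= #|B| * l + size s)%N.
Proof.
move=> Bfree /fintype.subsetP BC aS bS.
have := @generic_count_span R l (m * n) _ T free_coords Tz K q B
  (finset.setX C [set: 'I_e]) s.
rewrite finset.cardsX cardsT card_ord; apply => //.
- move=> i /BC iC; apply/mxOverP => o p; rewrite ord1.
  case/mxvec_indexP: p => j k; rewrite mxvecE mxE big_ord1 mxE.
  by rewrite rpredM// (mxOverP (aS i iC), mxOverP (bS i iC)).
- move=> [i j]; rewrite inE /free_coords /= => /andP[iC _].
  by case: (coord j) => k; rewrite (mxOverP (aS i iC), mxOverP (bS i iC)).
Qed.

(* A dependency among at most [m] of the vectors [a i] has too few parameters. *)
Let a_free (B : {set K}) (mu : K -> R) : free_on B -> (#|B| <= m)%N ->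
  \sum_(i in B) mu i *: a i = 0 -> forall i, i \in B -> mu i = 0.
Proof.
move=> Bfree Bm mu0 i0 i0B; apply/eqP/negPn/negP => mui0.
rewrite (big_setD1 i0)//= in mu0.
have [i1 i1B mui1] : exists2 i1, i1 \in B :\ i0 & mu i1 != 0.
  case: (pickP (fun i => (i \in B :\ i0) && (mu i != 0))) => [i /andP[]|H].
    by exists i.
  move: mu0; rewrite big1 ?addr0 => [/rowP/(_ (f i0))|i iB].
    by rewrite !mxE af mulr1 => /eqP; rewrite (negbTE mui0).
  by have := H i; rewrite iB /= => /negbT/negPn/eqP->; rewrite scale0r.
(* Dividing by [mu i1] removes one coefficient, and the entry 1 of [a i0] at [f i0] recovers this
   vector from its direction. Hence #|B| - 2 coefficients describe it. *)
pose s := acoords (B :\ i0) ++ [seq mu i / mu i1 | i in B :\ i0 :\ i1] ++ bcoords B.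
have aS i : i \in B -> a i \is a mxOver (Qgen s).
  have aS' j : j \in B :\ i0 -> a j \is a mxOver (Qgen s).
    by apply: acoords_Qgen => x xs; rewrite mem_cat xs.
  move=> iB; have [->|ii0] := eqVneq i i0; last by apply: aS'; rewrite in_setD1 ii0.
  pose w := \sum_(j in B :\ i0) (mu j / mu i1) *: a j.
  have wE : w = - (mu i0 / mu i1) *: a i0.
    rewrite /w; under eq_bigr do rewrite mulrC -scalerA.
    rewrite -scaler_sumr; move/eqP: mu0; rewrite addrC addr_eq0 => /eqP->.
    by rewrite scalerN scalerA scaleNr mulrC.
  have wS : w \is a mxOver (Qgen s).
    rewrite /w rpred_sum// => j jB; rewrite mxOverZ ?aS'//.
    have [->|ji1] := eqVneq j i1; first by rewrite divff ?rpred1.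
    apply: mem_Qgen; rewrite !mem_cat; apply/orP; right; apply/orP; left.
    by apply: fintype.image_f; rewrite in_setD1 ji1.
  have -> : a i0 = (w 0 (f i0))^-1 *: w.
    rewrite wE mxE af mulr1 scalerA mulVf ?scale1r//.
    by rewrite oppr_eq0 mulf_neq0// invr_eq0.
  by rewrite mxOverZ// rpredV (mxOverP wS).
have bS i : i \in B -> b i \is a mxOver (Qgen s).
  by apply: bcoords_Qgen => x xs; rewrite !mem_cat xs !orbT.
have := count_normalized Bfree (fintype.subxx _) aS bS.
rewrite !size_cat size_acoords size_bcoords size_image.
move: (cardsD1 i0 B) (cardsD1 i1 (B :\ i0)); rewrite i0B i1B !add1n => Bu uE.
rewrite uE in Bu *.
exact: (count_arith_a dims (ltnW m2) (ltnW n2) Bu Bm).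
Qed.

(** The entry 1 at [g i] determines the factor, so [b i] would cost no parameter beyond those of
    [b j]. *)
Let b_nonprop i j t : i != j -> free_on [set i; j] -> b i <> t *: b j.
Proof.
move=> ij ijfree bij.
pose s := acoords [set i; j] ++ bcoords [set j].
have bjS : b j \is a mxOver (Qgen s).
  by apply: (@bcoords_Qgen [set j]); rewrite ?set11// => x xs; rewrite mem_cat xs orbT.
have bE : b i = (b j 0 (g i))^-1 *: b j.
  have t1 : 1 = t * b j 0 (g i) by rewrite -(bg i) {1}bij mxE.
  have bj0 : b j 0 (g i) != 0.
    by apply: contra_eq_neq t1 => ->; rewrite mulr0 oner_eq0.
  by rewrite {1}bij; congr (_ *: _); apply: (mulIf bj0); rewrite -t1 mulVf.
have := @count_normalized [set i; j] [set i; j] s ijfree (fintype.subxx _).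
rewrite size_cat size_acoords size_bcoords cards2 cards1 ij => H.
have this : (2 * (m * n) + 2 * e <= 2 * l + (2 * m.-1 + 1 * n.-1))%N.
  apply: H => k.
    by apply: acoords_Qgen => x xs; rewrite mem_cat xs.
  rewrite in_set2 => /orP[]/eqP-> //.
  by rewrite bE mxOverZ// rpredV (mxOverP bjS).
exact: (count_arith_b dims (ltnW m2) n2 this).
Qed.

(* Once the [a i] contain a basis of [R^m], the relation determines the
   corresponding [b i] linearly from all the other ones. *)
Let no_long_relation (A B0 : {set K}) (la : K -> R) :
  B0 \subset A -> #|B0| = m -> (m < #|A|)%N ->
  (forall mu : K -> R, \sum_(i in B0) mu i *: a i = 0 ->
     forall i, i \in B0 -> mu i = 0) ->
  (forall i, i \in A -> la i != 0) ->
  (forall i, i \in A -> free_on (A :\ i)) ->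
  \sum_(i in A) la i *: q i = 0 -> False.
Proof.
move=> B0A cardB0 mA aB0 la0 Afree rel.
have [i2] : exists i2, i2 \in A :\: B0.
  apply/set0Pn; rewrite -card_gt0 cardsD (finset.setIidPr B0A) cardB0 subn_gt0//.
rewrite finset.in_setD => /andP[i2B0 i2A].
(* The vectors [be i] absorb the coefficients of the relation. As [be i2] is [b i2], its entry at
   [g i2] is known to be 1, which saves one parameter. *)
pose be i := (la i / la i2) *: b i.
have relE : \sum_(i in A) (a i)^T *m be i = 0.
  transitivity ((la i2)^-1 *: \sum_(i in A) la i *: ((a i)^T *m b i)).
    rewrite scaler_sumr; apply: eq_bigr => i _.
    by rewrite /be -scalemxAr scalerA mulrC.
  by rewrite (relation_mx rel) scaler0.
pose s := acoords A ++ [seq be p.1 0 p.2 |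
  p in (finset.setX (A :\: B0) [set: 'I_n]) :\ (i2, g i2)].
have aS i : i \in A -> a i \is a mxOver (Qgen s).
  by apply: acoords_Qgen => x xs; rewrite mem_cat xs.
have beS i : i \in A :\: B0 -> be i \is a mxOver (Qgen s).
  move=> iAB; apply/mxOverP => o j; rewrite ord1.
  have [[-> ->]|ij] := eqVneq (i, j) (i2, g i2).
    by rewrite mxE bg mulr1 divff ?rpred1// la0.
  apply: mem_Qgen; rewrite mem_cat; apply/orP; right.
  apply/fintype.imageP; exists (i, j) => //.
  by rewrite in_setD1 ij finset.in_setX iAB inE.
pose A0 := \matrix_(k < #|B0|) a (enum_val k).
pose B := \matrix_(k < #|B0|) be (enum_val k).
have A0free : row_free A0 by exact: row_free_family.
have A0S : A0 \is a mxOver (Qgen s).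
  apply/mxOverP => k j; rewrite mxE; apply: (mxOverP (aS _ _)).
  by apply: (fintype.subsetP B0A); exact: enum_valP.
have A0TS : A0^T \is a mxOver (Qgen s).
  by apply/mxOverP => k j; rewrite mxE (mxOverP A0S).
have BE : A0^T *m B = - \sum_(i in A :\: B0) (a i)^T *m be i.
  apply/eqP; rewrite -addr_eq0 -[X in _ == X]relE.
  rewrite [X in _ == X](big_setID B0)/= (finset.setIidPr B0A).
  apply/eqP; congr (_ + _); rewrite big_enum_val.
  apply/matrixP => j k; rewrite mxE summxE; apply: eq_bigr => i _.
  by rewrite !mxE big_ord1 !mxE.
have A0BS : A0^T *m B \is a mxOver (Qgen s).
  rewrite BE rpredN rpred_sum// => i iAB.
  apply: mxOverM (beS _ iAB); apply/mxOverP => k j; rewrite mxE.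
  by apply: (mxOverP (aS _ _)); move: iAB; rewrite finset.in_setD => /andP[].
have BS : B \is a mxOver (Qgen s).
  (* [A0] is square only through [cardB0]; inverting its Gram matrix avoids a cast. *)
  have -> : B = invmx (A0 *m A0^T) *m (A0 *m (A0^T *m B)).
    by rewrite !mulmxA -(mulmxA _ A0) mulVmx ?mul1mx// gram_unitmx.
  by apply: mxOverM; [apply/mxOver_invmx/mxOverM|exact: mxOverM].
have bS i : i \in A -> b i \is a mxOver (Qgen s).
  move=> iA; have beiS : be i \is a mxOver (Qgen s).
    have [iB0|iB0] := boolP (i \in B0); last by apply: beS; rewrite finset.in_setD iB0.
    have -> : be i = row (enum_rank_in iB0 i) B by rewrite rowK enum_rankK_in.
    by apply/mxOverP => o j; rewrite mxE (mxOverP BS).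
  have -> : b i = (be i 0 (g i))^-1 *: be i.
    rewrite !mxE bg mulr1 scalerA mulVf ?scale1r//.
    by rewrite mulf_neq0 ?invr_eq0 ?la0.
  by rewrite mxOverZ// rpredV (mxOverP beiS).
have := count_normalized (Afree _ i2A) (subsetDl _ _) aS bS.
rewrite size_cat size_acoords size_image.
move: (cardsD1 i2 A) (cardsD1 (i2, g i2) (finset.setX (A :\: B0) [set: 'I_n])).
rewrite i2A finset.in_setX finset.in_setD i2B0 i2A inE finset.cardsX cardsT card_ord.
rewrite [#|A :\: B0|]cardsD.
rewrite (finset.setIidPr B0A) cardB0 !add1n => AE XE.
have Al : (#|A| <= l)%N by apply: leq_trans Kl; exact: max_card.
rewrite -[#|_ :\ (i2, g i2)|]/(_.+1.-1) -XE; rewrite AE in mA Al *.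
exact: (count_arith_c dims (ltnW m2) (ltnW n2) Al mA).
Qed.

(** In a relation of minimal support [A], every proper subfamily is free. A support larger than [m]
    is excluded by [no_long_relation]; in a smaller one the [a i] other than [a i1] are independent,
    which forces every [b j] to be a multiple of [b i1]. *)
Lemma rank_one_points_free (mu : K -> R) :
  \sum_i mu i *: mxvec ((a i)^T *m b i) = 0 -> forall i, mu i = 0.
Proof.
move=> mu0 i; apply/eqP/negPn/negP => mui.
pose supp (la : K -> R) : {set K} := [set i | la i != 0].
pose P k := `[< exists la : K -> R, [/\ \sum_i la i *: q i = 0,
  (0 < #|supp la|)%N & #|supp la| = k] >].
have exP : exists k, P k.
  exists #|supp mu|; apply/asboolP; exists mu; split => //.
  by apply/card_gt0P; exists i; rewrite inE.
case: (ex_minnP exP) => k /asboolP[la [rel A0 cardA]] mink.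
set A := supp la in A0 cardA.
have relA : \sum_(i in A) la i *: q i = 0.
  rewrite -[RHS]rel [RHS](bigID (mem A))/= [X in _ = _ + X]big1 ?addr0// => j.
  by rewrite inE negbK => /eqP->; rewrite scale0r.
have laA j : j \in A -> la j != 0 by rewrite inE.
have free_sub (B : {set K}) : B \proper A -> free_on B.
  move=> BA nu nu0 j jB; apply/eqP/negPn/negP => nuj.
  pose nu' j := if j \in B then nu j else 0.
  have suppB : supp nu' \subset B.
    by apply/fintype.subsetP => x; rewrite inE /nu'; case: ifP => // _; rewrite eqxx.
  have : P #|supp nu'|.
    apply/asboolP; exists nu'; split => //.
      rewrite -[RHS]nu0 [RHS]big_mkcond /=; apply: eq_bigr => x _.
      by rewrite /nu'; case: ifP => // _; rewrite scale0r.
    by apply/card_gt0P; exists j; rewrite inE /nu' jB.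
  move=> /mink; rewrite leqNgt -cardA; apply/negP/negPn.
  exact: leq_ltn_trans (subset_leq_card suppB) (proper_card BA).
have q0 j : q j != 0.
  apply/eqP => /rowP/(_ (mxvec_index (f j) (g j))).
  by rewrite mxvecE !mxE big_ord1 !mxE af bg mul1r => /eqP; rewrite oner_eq0.
have [i1 i1A] : exists i1, i1 \in A by apply/card_gt0P.
have propA j : j \in A -> A :\ j \proper A by move=> jA; exact: properD1.
have [mA|Am] := ltnP m #|A|.
  have [B0 B0A cardB0] := card_subset_ex (ltnW mA).
  apply: (@no_long_relation A B0 la) => //.
    move=> nu; apply: a_free; last by rewrite cardB0.
    by apply: free_sub; rewrite properEcard B0A cardB0.
  by move=> j /propA/free_sub.
have cA := cardsD1 i1 A; rewrite i1A in cA.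
pose B := A :\ i1.
have aB (nu : K -> R) : \sum_(i in B) nu i *: a i = 0 -> forall i, i \in B -> nu i = 0.
  apply: a_free; first exact/free_sub/propA.
  by move: cA Am; rewrite -/B; clear; lia.
have relmx := relation_mx relA.
(* Pairing the relation with the vector dual to [a j] kills every term except those of [j] and
   [i1]. *)
have b_prop j : j \in B -> exists t : R, b j = t *: b i1.
  move=> jB; have [d dE] := dual_vector aB jB.
  have jA : j \in A by move: jB; rewrite in_setD1 => /andP[].
  have : d^T *m (\sum_(i in A) la i *: ((a i)^T *m b i)) = 0 by rewrite relmx mulmx0.
  rewrite mulmx_sumr (big_setD1 i1)//= -/B (big_setD1 j)//= [X in _ + (_ + X)]big1 ?addr0.
    rewrite -!scalemxAr !mulmxA -!trmx_mul (dE _ jB) eqxx tr_scalar_mx mul1mx.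
    move=> /eqP; rewrite addrC addr_eq0 => /eqP laE.
    exists (- (la i1 * (a i1 *m d) 0 0) / la j).
    apply: (scalerI (laA _ jA)); rewrite laE scalerA mulrCA divff ?mulr1 ?laA//.
    by rewrite [X in (X)^T]mx11_scalar tr_scalar_mx mul_scalar_mx scalerA scaleNr.
  move=> x; rewrite in_setD1 => /andP[xj xB].
  by rewrite -scalemxAr mulmxA -trmx_mul (dE _ xB) (negbTE xj) raddf0 trmx0 mul0mx scaler0.
have [j jB] : exists j, j \in B.
  apply/set0Pn/negP => /eqP B00; move: relA.
  rewrite (big_setD1 i1)//= -/B B00 finset.big_set0 addr0 => /eqP.
  by rewrite scaler_eq0 (negbTE (laA _ i1A)) (negbTE (q0 _)).
have [jA ji1] : j \in A /\ j != i1 by move: jB; rewrite in_setD1 => /andP[].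
have cB := cardsD1 j B; rewrite jB in cB.
(* If the support is a pair, its two points are proportional, against [qdist]; otherwise [b j] and
   [b j'] are proportional on a free pair. *)
have [Bj|[j' j'B]] : B :\ j = finset.set0 \/ exists j', j' \in B :\ j.
  by case: (set_0Vmem (B :\ j)) => [->|[j' ?]]; [left|right; exists j'].
  move: relA; rewrite (big_setD1 i1)//= -/B (big_setD1 j)//= Bj finset.big_set0 addr0.
  rewrite addrC => /eqP; rewrite addr_eq0 => /eqP rel2.
  apply: (qdist ji1 (t := - la i1 / la j)).
  apply: (scalerI (laA _ jA)); rewrite rel2 scalerA mulrCA divff ?mulr1 ?laA//.
  by rewrite scaleNr.
move: (j'B); rewrite in_setD1 => /andP[j'j j'B1].
have [t tE] := b_prop _ jB; have [t' t'E] := b_prop _ j'B1.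
have t'0 : t' != 0.
  apply/eqP => t'0; have := bg j'; rewrite t'E t'0 scale0r mxE => /eqP.
  by rewrite eq_sym oner_eq0.
apply: (@b_nonprop j j' (t / t')); first by rewrite eq_sym.
  apply: free_sub; apply: (fintype.sub_proper_trans _ (propA _ i1A)).
  by apply/fintype.subsetP => x; rewrite in_set2 => /orP[]/eqP->.
by rewrite t'E scalerA divfK// tE.
Qed.

End rank_one_points.

Local Open Scope classical_set_scope.

(** * Local solutions at a transversal point *)

Section quadratic_fixed_point.
Variable R : realType.

Lemma contraction_fixed_point c (Phi : 'rV[R]_c -> 'rV[R]_c) (r : R) : 0 < r ->
  (forall w, `|w| <= r -> `|Phi w| <= r) ->
  (forall w w', `|w| <= r -> `|w'| <= r -> `|Phi w - Phi w'| <= 2^-1 * `|w - w'|) ->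
  exists w, w = Phi w.
Proof.
move=> r0 PhiB PhiL.
pose U : set 'rV[R]_c := [set w | `|w| <= r].
have PhiU : set_fun U U Phi by move=> w; exact: PhiB.
pose mPhi := isFun.Build _ _ U U Phi PhiU.
pose F : {fun U >-> U} := HB.pack Phi mPhi.
have ctr : is_contraction F.
  have h0 : 0 <= (2^-1 : R) by rewrite invr_ge0.
  exists (NngNum h0); split; first by rewrite /=; lra.
  by move=> -[w w'] [/= wU w'U]; exact: PhiL.
have clU : closed U.
  apply: (@closed_comp _ _ (fun w : 'rV[R]_c => `|w|) [set x | x <= r]).
    by move=> w _; exact: norm_continuous.
  exact: closed_le.
have U0 : U !=set0 by exists 0; rewrite /U/= normr0 ltW.
pose V : completeNormedModType R :=
  HB.pack_for (completeNormedModType R) 'rV[R]_c (Complete.on 'rV[R]_c).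
have [w _ wE] := @banach_fixed_point R V U F ctr clU U0.
by exists w.
Qed.

Lemma mx_norm_le p q (A : 'M[R]_(p, q)) (x : R) : 0 <= x ->
  (forall i j, `|A i j| <= x) -> `|A| <= x.
Proof.
move=> x0 H; rewrite [leLHS]/Num.norm /= mx_normrE.
by apply/bigmax_leP; split => // -[i j] _; exact: H.
Qed.

Lemma mx_norm_entry p q (A : 'M[R]_(p, q)) i j : `|A i j| <= `|A|.
Proof.
rewrite [leRHS]/Num.norm /= mx_normrE.
by apply/bigmax_geP; right; exists (i, j).
Qed.

Lemma mulmx_norm_bound p q (A : 'M[R]_(p, q)) :
  exists2 C : R, 0 <= C & forall x : 'rV_p, `|x *m A| <= C * `|x|.
Proof.
exists (p%:R * `|A|); first by rewrite mulr_ge0.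
move=> x; apply: mx_norm_le; first by rewrite !mulr_ge0.
move=> i j; rewrite mxE (le_trans (ler_norm_sum _ _ _))//.
rewrite -mulrA -[p in p%:R]card_ord mulr_natl -sumr_const.
apply: ler_sum => k _; rewrite normrM mulrC.
by rewrite ler_pM// mx_norm_entry.
Qed.

(** An implicit function theorem for an equation already solved for its linear part: on a ball of
    radius r the Lipschitz constant of [quad] is of order r, so a small ball is mapped into itself
    and contracted. *)
Lemma quadratic_fixed_point p c (A : 'M[R]_(p, c)) (E : 'M[R]_(c, p))
    (quad : 'rV[R]_p -> 'rV[R]_c) (C : R) : 0 <= C -> quad 0 = 0 ->
  (forall z z', `|quad z - quad z'| <= C * (`|z| + `|z'|) * `|z - z'|) ->
  exists2 d, 0 < d & forall t : 'rV[R]_p, `|t| <= d ->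
    exists w : 'rV[R]_c, w = t *m A + quad (t + w *m E).
Proof.
move=> C0 quad0 quadL.
have [CA CA0 AB] := mulmx_norm_bound A.
have [CE CE0 EB] := mulmx_norm_bound E.
(* K r = 1/4 bounds the contraction factor 2 C (1 + CE) CE r by 1/2 and the quadratic part C ((1 +
   CE) r)^2 by r/4; the choice of [d] bounds the linear part by r/2. *)
pose K := C * (1 + CE) ^+ 2 + 1; pose r := (4 * K)^-1.
have K1 : 1 <= K by rewrite /K lerDr mulr_ge0// sqr_ge0.
have r0 : 0 < r by rewrite invr_gt0; lra.
have rK : K * r = 4^-1 by rewrite /r; field; lra.
pose d := Num.min r (r / (2 * (CA + 1))).
have d0 : 0 < d by rewrite /d lt_min r0 divr_gt0//; lra.
have dr : d <= r by rewrite /d ge_min lexx.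
have CAd : CA * d <= r / 2.
  have : d <= r / (2 * (CA + 1)) by rewrite /d ge_min lexx orbT.
  move=> /(ler_wpM2l CA0)/le_trans; apply.
  rewrite mulrA ler_pdivrMr; last by lra.
  by rewrite mulrC; nra.
exists d => // t td.
pose Phi w := t *m A + quad (t + w *m E).
have zB w : `|w| <= r -> `|t + w *m E| <= (1 + CE) * r.
  move=> wr; rewrite (le_trans (ler_normD _ _))// mulrDl mul1r.
  rewrite lerD ?(le_trans td)// (le_trans (EB w))//.
  exact: ler_wpM2l.
apply: (@contraction_fixed_point c Phi r) => //.
  move=> w wr; rewrite (le_trans (ler_normD _ _))//.
  have H1 : `|t *m A| <= r / 2.
    by rewrite (le_trans (AB t))// (le_trans _ CAd)// ler_wpM2l.
  have := quadL (t + w *m E) 0; rewrite quad0 !subr0 normr0 addr0 => H2.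
  have H3 : C * `|t + w *m E| * `|t + w *m E| <= r / 4.
    apply: (@le_trans _ _ (C * ((1 + CE) * r) * ((1 + CE) * r))).
      have zw := zB _ wr; rewrite -mulrA -[leRHS]mulrA.
      by apply: ler_wpM2l => //; apply: ler_pM.
    have -> : C * ((1 + CE) * r) * ((1 + CE) * r) = (K - 1) * r * r.
      by rewrite /K; ring.
    by nra.
  by rewrite (le_trans (lerD H1 (le_trans H2 H3)))//; lra.
move=> w w' wr w'r; rewrite /Phi opprD addrACA subrr add0r.
apply: (le_trans (quadL _ _)).
have -> : t + w *m E - (t + w' *m E) = (w - w') *m E.
  by rewrite opprD addrACA subrr add0r mulmxBl.
apply: (@le_trans _ _ (C * ((1 + CE) * r + (1 + CE) * r) * (CE * `|w - w'|))).
  apply: ler_pM => //; first by rewrite mulr_ge0// addr_ge0.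
  by rewrite ler_wpM2l// lerD// zB.
rewrite mulrA ler_wpM2r//.
have : C * ((1 + CE) * r + (1 + CE) * r) * CE <= 2 * (K * r).
  have -> : C * ((1 + CE) * r + (1 + CE) * r) * CE = 2 * (r * (C * ((1 + CE) * CE))).
    by ring.
  rewrite ler_pM2l// [K * r]mulrC ler_pM2l//.
  have : C * ((1 + CE) * CE) <= C * (1 + CE) ^+ 2.
    by rewrite expr2; apply: ler_wpM2l => //; apply: ler_wpM2l; lra.
  by rewrite /K; lra.
by rewrite rK; lra.
Qed.

End quadratic_fixed_point.

Local Close Scope classical_set_scope.

(** * Rank-one points in a generic row space *)

Section generic_intersection.
Variable R : realType.

Lemma alg_indep_inj (I : finType) (x : I -> R) : alg_indep x -> injective x.
Proof.
move=> xI i j xij; apply/eqP/negPn/negP => ij.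
have := @alg_indep_Qgen R I x [seq x k | k in predC1 i] xI.
rewrite size_image cardC1 => /(_ _) H.
have : (#|I| <= #|I|.-1)%N.
  apply: H => k; have [->|ki] := eqVneq k i.
    by rewrite xij; apply/mem_Qgen/fintype.image_f; rewrite inE eq_sym.
  by apply/mem_Qgen/fintype.image_f; rewrite inE.
by have : (0 < #|I|)%N by [apply/card_gt0P; exists i|]; case: #|I| => // k _; rewrite ltnn.
Qed.

Lemma alg_indep_sum0 (I J : finType) (x : I -> R) (t : J -> R) :
  (J -> False) -> alg_indep x -> alg_indep (sum_fun x t).
Proof.
move=> J0 xI.
have bh : bijective (fun q : I + J => match q with
    inl i => i | inr j => False_rect I (J0 j) end).
  by exists inl => [[//|j]|//]; case: (J0 j).
have := alg_indep_bij bh xI; congr alg_indep; apply/funext => -[//|j].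
by case: (J0 j).
Qed.

Lemma rank1_normal_form m n (M : 'M[R]_(m, n)) : \rank M = 1%N ->
  exists t a b f g, [/\ t != 0, (a : 'rV_m) 0 f = 1, (b : 'rV_n) 0 g = 1 &
    M = t *: (a^T *m b)].
Proof.
move=> M1; have := mulmx_base M; have : M != 0 by rewrite -mxrank_eq0 M1.
move: (col_base M) (row_base M); rewrite M1 => u v M0 uv.
have [f uf] : exists f, u f 0 != 0.
  apply/existsP; apply: contraNT M0 => /existsPn H; rewrite -uv.
  rewrite (_ : u = 0) ?mul0mx//; apply/matrixP => i j.
  by rewrite ord1 mxE; apply/eqP/negPn/H.
have [g vg] : exists g, v 0 g != 0.
  apply/existsP; apply: contraNT M0 => /existsPn H; rewrite -uv.
  rewrite (_ : v = 0) ?mulmx0//; apply/matrixP => i j.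
  by rewrite ord1 mxE; apply/eqP/negPn/H.
exists (u f 0 * v 0 g), ((u f 0)^-1 *: u^T), ((v 0 g)^-1 *: v), f, g; split.
- by rewrite mulf_neq0.
- by rewrite !mxE mulVf.
- by rewrite mxE mulVf.
- rewrite [(_ *: u^T)^T]linearZ /= trmxK -scalemxAl -scalemxAr !scalerA -{1}uv.
  rewrite -[LHS]scale1r; congr (_ *: _).
  by field; rewrite uf vg.
Qed.

(** The case e = 0, where the intersection is expected to be finite: the family [free_coords] is
    empty and the points are arbitrary. *)
Lemma generic_rank_ones_free l m n (T : 'M[R]_(l, m * n))
    (M : 'I_l -> 'M[R]_(m, n)) :
  (2 <= m)%N -> (2 <= n)%N -> (l = (m - 1) * (n - 1) + 1)%N ->
  alg_indep (fun p : 'I_l * 'I_(m * n) => T p.1 p.2) ->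
  (forall i, (mxvec (M i) <= T)%MS) -> (forall i, \rank (M i) = 1%N) ->
  (forall i j, i != j -> forall c : R, M i <> c *: M j) ->
  row_free (\matrix_i mxvec (M i)).
Proof.
move=> m2 n2 lE TI MT M1 Mdist.
have /choice[t /choice[a /choice[b /choice[f /choice[g H]]]]] :
  forall i, exists t a b f g, [/\ t != 0, (a : 'rV_m) 0 f = 1,
    (b : 'rV_n) 0 g = 1 & M i = t *: (a^T *m b)].
  by move=> i; exact: rank1_normal_form.
have t0 i : t i != 0 by case: (H i).
have ME i : mxvec (M i) = t i *: mxvec ((a i)^T *m b i).
  by case: (H i) => _ _ _ ->; rewrite linearZ.
have qE i : mxvec ((a i)^T *m b i) = (t i)^-1 *: mxvec (M i).
  by rewrite ME scalerA mulVf// scale1r.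
have m0 : (0 < m)%N by exact: ltnW.
have nI0 : 'I_l * 'I_0 -> False by move=> [_ []].
have dims : (m * n + 0 + 2 = l + m + n)%N.
  by rewrite lE; case: (m) (n) m2 n2 => [|[|?]] // [|[|?]] //; lia.
have qfree := @rank_one_points_free R l m n 0 _ T a b f g.
apply: inj_row_free => v; rewrite mulmx_sum_row => v0.
apply/rowP => i; rewrite mxE; apply: (mulIf (t0 i)); rewrite mul0r.
apply: (qfree _ _ _ (fun=> inl (Ordinal m0)) _ m2 n2 dims _ _ (fun i => v 0 i * t i)).
- by move=> j; case: (H j).
- by move=> j; case: (H j).
- by move=> j; rewrite qE scalemx_sub.
- exact: alg_indep_sum0.
- by rewrite card_ord.
- move=> j k jk c; rewrite !qE => Mjk; apply: (Mdist j k jk (t j * c / t k)).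
  apply: (can_inj mxvecK); rewrite linearZ /=.
  by rewrite -[LHS]scale1r -(divff (t0 j)) -[LHS]scalerA Mjk !scalerA.
- rewrite -[RHS]v0; apply: eq_bigr => j _.
  by rewrite rowK ME scalerA.
Qed.

(* At a rank-one point of [L], a normal vector [A] of [L] orthogonal to the
   tangent space of the Segre variety would make the pair ([L], point) depend
   on too few parameters. *)
Lemma generic_transversal l m n (T : 'M[R]_(l, m * n)) (a : 'rV[R]_m) (b : 'rV[R]_n)
    f g (A : 'M[R]_(m, n)) :
  alg_indep (fun p : 'I_l * 'I_(m * n) => T p.1 p.2) ->
  a 0 f = 1 -> b 0 g = 1 -> (mxvec (a^T *m b) <= T)%MS ->
  T *m (mxvec A)^T = 0 -> A *m b^T = 0 -> a *m A = 0 -> A = 0.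
Proof.
move=> TI af bg /submxP[y yE] TA Ab aA; apply/eqP/negPn/negP => A0.
have AgE i : A i g = - \sum_(k | k != g) A i k * b 0 k.
  move/matrixP/(_ i 0): Ab; rewrite !mxE (bigD1 g)//= mxE bg mulr1 => /eqP.
  rewrite addr_eq0 => /eqP->; congr (- _); apply: eq_bigr => k _.
  by rewrite mxE.
have AfE k : A f k = - \sum_(i | i != f) a 0 i * A i k.
  move/matrixP/(_ 0 k): aA; rewrite !mxE (bigD1 f)//= af mul1r => /eqP.
  by rewrite addr_eq0 => /eqP.
(* Row [f] and column [g] of [A] follow from the other entries, so some entry outside them is
   nonzero. Dividing by it saves the parameter that yields the contradiction. *)
have [j1 [k1 [j1f k1g Ajk]]] : exists j1 k1, [/\ j1 != f, k1 != g & A j1 k1 != 0].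
  apply/not_existsP => H.
  have Z j k : j != f -> k != g -> A j k = 0.
    move=> jf kg; apply/eqP/negPn/negP => Ajk; apply: (H j).
    by exists k.
  have Zg j : j != f -> A j g = 0.
    by move=> jf; rewrite AgE big1 ?oppr0// => k kg; rewrite Z ?mul0r.
  move/eqP: A0; apply; apply/matrixP => j k; rewrite mxE.
  have Zj j' : j' != f -> A j' k = 0.
    by move=> jf; have [->|] := eqVneq k g; [exact: Zg|exact: Z].
  have [->|] := eqVneq j f; last exact: Zj.
  by rewrite AfE big1 ?oppr0// => i /Zj->; rewrite mulr0.
have [i0 yi0] : exists i0, y 0 i0 != 0.
  apply/existsP; apply: contraT => /existsPn H; move: yE.
  rewrite (_ : y = 0) ?mul0mx; last first.
    by apply/rowP => i; rewrite mxE; apply/eqP/negPn/H.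
  move/rowP/(_ (mxvec_index f g)); rewrite mxvecE !mxE big_ord1 mxE af bg mul1r.
  by move/eqP; rewrite oner_eq0.
pose nu := mxvec A; pose j0 := mxvec_index j1 k1.
have nuj0 : nu 0 j0 != 0 by rewrite /nu mxvecE.
(* The generators number (m - 1) + (n - 1) for the point, (m - 1)(n - 1) - 1 for the ratios of
   entries of [A], l for [y], and (l - 1)(m n - 1) entries of [T]: l m n - 1 in all. *)
pose As := [seq A p.1 p.2 / A j1 k1 |
  p in (finset.setX [set~ f] [set~ g]) :\ (j1, k1)].
pose s := [seq a 0 i | i in [set~ f]] ++ [seq b 0 k | k in [set~ g]] ++ As
  ++ [seq y 0 i | i : 'I_l].
pose S0 := finset.setX [set~ i0] [set~ j0].
pose S := Qgen (s ++ [seq T p.1 p.2 | p in S0]).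
have sub : {subset Qgen s <= S}.
  apply: Qgen_min; first exact: Qgen_divring_closed.
  by move=> x xs; apply: mem_Qgen; rewrite mem_cat xs.
have aS i : a 0 i \in Qgen s.
  have [->|i_f] := eqVneq i f; first by rewrite af rpred1.
  by apply: mem_Qgen; rewrite mem_cat fintype.image_f// !inE.
have bS i : b 0 i \in Qgen s.
  have [->|i_f] := eqVneq i g; first by rewrite bg rpred1.
  by apply: mem_Qgen; rewrite !mem_cat; apply/orP; right; rewrite fintype.image_f// !inE.
have yS i : y 0 i \in Qgen s.
  by apply: mem_Qgen; rewrite !mem_cat fintype.image_f ?orbT.
have AS j k : A j k / A j1 k1 \in Qgen s.
  have block j' k' : j' != f -> k' != g -> A j' k' / A j1 k1 \in Qgen s.
    move=> jf kg; have [[-> ->]|jk] := eqVneq (j', k') (j1, k1).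
      by rewrite divff ?rpred1.
    apply: mem_Qgen; rewrite !mem_cat; apply/orP; right; apply/orP; right.
    apply/orP; left; apply/fintype.imageP; exists (j', k') => //.
    by rewrite in_setD1 jk finset.in_setX !inE jf.
  have colg j' : j' != f -> A j' g / A j1 k1 \in Qgen s.
    move=> jf; rewrite AgE mulNr rpredN mulr_suml rpred_sum// => k' kg.
    by rewrite mulrAC rpredM ?block.
  have Zj j' : j' != f -> A j' k / A j1 k1 \in Qgen s.
    by move=> jf; have [->|] := eqVneq k g; [exact: colg|exact: block].
  have [->|] := eqVneq j f; last exact: Zj.
  rewrite AfE mulNr rpredN mulr_suml rpred_sum// => i /Zj iS.
  by rewrite -mulrA rpredM.
have nuS p : nu 0 p / nu 0 j0 \in Qgen s.
  by case/mxvec_indexP: p => j k; rewrite /nu !mxvecE.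
(* Orthogonality to [nu] gives the entries in column [j0]; row [i0] then follows from the
   coordinates [y] of the point. *)
have T1 i p : i != i0 -> T i p \in S.
  have off p' : i != i0 -> p' != j0 -> T i p' \in S.
    move=> ii0 pj0; apply: mem_Qgen; rewrite mem_cat; apply/orP; right.
    by apply/fintype.imageP; exists (i, p') => //; rewrite finset.in_setX !inE ii0.
  move=> ii0; have [->|] := eqVneq p j0; last exact: off.
  have -> : T i j0 = - \sum_(p | p != j0) T i p * (nu 0 p / nu 0 j0).
    move/matrixP/(_ i 0): TA; rewrite !mxE (bigD1 j0)//= mxE => /eqP.
    rewrite addr_eq0 => /eqP H; apply: (mulIf nuj0); rewrite H mulNr; congr (- _).
    by rewrite mulr_suml; apply: eq_bigr => p' _; rewrite mxE -mulrA divfK.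
  by rewrite rpredN rpred_sum// => p' pj0; rewrite rpredM ?off// sub.
have TS i p : T i p \in S.
  have [->|] := eqVneq i i0; last exact: T1.
  have -> : T i0 p = (mxvec (a^T *m b) 0 p - \sum_(i | i != i0) y 0 i * T i p) / y 0 i0.
    apply: (mulIf yi0); rewrite divfK// yE !mxE (bigD1 i0)//= addrK mulrC//.
  rewrite rpredM//; last by rewrite rpredV sub.
  rewrite rpredB//; last first.
    by rewrite rpred_sum// => i' ii0; apply: rpredM; [exact: sub|exact: T1].
  case/mxvec_indexP: p => j k; rewrite mxvecE !mxE big_ord1 mxE.
  by rewrite rpredM// sub.
have nI0 : 'I_0 -> False by case.
have TI0 := alg_indep_sum0 (t := fun=> 0) nI0 TI.
have := @generic_count R l (m * n) _ T _ TI0 s finset.set0 S0 TS.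
move=> /(_ ltac:(by move=> j; rewrite finset.inE)).
rewrite !size_cat !size_image !cardsC1 !card_ord cards0 addn0 /S0 finset.cardsX !cardsC1 !card_ord.
have := cardsD1 (j1, k1) (finset.setX [set~ f] [set~ g]).
rewrite finset.in_setX !inE j1f k1g finset.cardsX !cardsC1 !card_ord add1n.
move: (#|_ :\ (j1, k1)|) => u.
have l0 : (0 < l)%N by apply: leq_ltn_trans (ltn_ord i0).
have m1 : (0 < m)%N by apply: leq_ltn_trans (ltn_ord f).
have n1 : (0 < n)%N by apply: leq_ltn_trans (ltn_ord g).
move: l0 m1 n1; clear; case: l m n => // l [//|m] [//|n] _ _ _.
have -> : ((m.+1 * n.+1).-1 = n + m * n.+1)%N by rewrite mulSn.
by rewrite !succnK; nia.
Qed.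

End generic_intersection.

Lemma sum_mxvec_index (V : nmodType) m n (F : 'I_(m * n) -> V) :
  \sum_p F p = \sum_i \sum_j F (mxvec_index i j).
Proof.
rewrite pair_bigA (reindex (fun p : 'I_m * 'I_n => mxvec_index p.1 p.2)) //=.
case: (curry_mxvec_bij m n) => h h1 h2.
exists h => [[i j] _|p _]; first exact: (h1 (i, j)).
by have := h2 p isT; case: (h p).
Qed.

(** * Parametrizing the intersection near a transversal point *)

Section local_solutions.
Variables (R : realType) (l m n e : nat) (T : 'M[R]_(l, m * n)).
Variables (a0 : 'rV[R]_m) (b0 : 'rV[R]_n) (f : 'I_m) (g : 'I_n).
Hypotheses (a0f : a0 0 f = 1) (b0g : b0 0 g = 1).
Hypothesis p0T : (mxvec (a0^T *m b0) <= T)%MS.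
Hypothesis Tfree : row_free T.
Hypothesis dims : (m * n + e + 2 = l + m + n)%N.
Hypothesis transversal : forall A : 'M[R]_(m, n),
  T *m (mxvec A)^T = 0 -> A *m b0^T = 0 -> a0 *m A = 0 -> A = 0.

(** The columns of [C] are equations of the row space, [D] is the differential of (a, b) -> a^T b at
    (a0, b0), and [J] is the Jacobian of the equations. [spec] marks the two coordinates fixed by
    normalization, whose rows [J'] erases. *)
Let C := cokermx T.
Let D : 'M[R]_(m + n, m * n) := col_mx
  (\matrix_i mxvec ((delta_mx 0 i)^T *m b0)) (\matrix_j mxvec (a0^T *m delta_mx 0 j)).
Let J := D *m C.
Let spec (i : 'I_(m + n)) := (i == lshift n f) || (i == rshift m g).
Let J' := \matrix_i (if spec i then 0 else row i J).

Let mulD (z : 'rV_(m + n)) :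
  z *m D = mxvec ((lsubmx z)^T *m b0) + mxvec (a0^T *m rsubmx z).
Proof.
rewrite -[z in LHS]hsubmxK mul_row_col; congr (_ + _).
  apply/rowP => p; rewrite mxE; case/mxvec_indexP: p => i j.
  rewrite mxvecE [RHS]mxE big_ord1 (bigD1 i)//= big1 ?addr0 => [|k ki].
    by rewrite !mxE mxvecE !mxE big_ord1 !mxE eqxx mul1r.
  by rewrite !mxE mxvecE !mxE big_ord1 !mxE /= [i == k]eq_sym (negbTE ki) mul0r mulr0.
apply/rowP => p; rewrite mxE; case/mxvec_indexP: p => i j.
rewrite mxvecE [RHS]mxE big_ord1 (bigD1 j)//= big1 ?addr0 => [|k kj].
  by rewrite !mxE mxvecE !mxE big_ord1 !mxE eqxx mulr1 mulrC.
by rewrite !mxE mxvecE !mxE big_ord1 !mxE /= [j == k]eq_sym (negbTE kj) !mulr0.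
Qed.

(** A vector in the image of [C^T] killed by [D] is a normal vector of the row space orthogonal to
    the tangent space, hence zero by [transversal]. *)
Let rankJ : \rank J = \rank C.
Proof.
rewrite -mxrank_tr -[RHS]mxrank_tr /J trmx_mul -(mxrank_mul_ker C^T D^T).
apply/eqP; rewrite -[X in X == _]addn0 eqn_add2l eq_sym mxrank_eq0.
apply/rowV0P => v; rewrite sub_capmx => /andP[/submxP[u vE] /sub_kermxP vD].
pose A : 'M[R]_(m, n) := vec_mx v.
have Dv : D *m v^T = 0 by rewrite -[D]trmxK -trmx_mul vD trmx0.
have Dz (z : 'rV[R]_(m + n)) : z *m D *m v^T = 0 by rewrite -mulmxA Dv mulmx0.
suff A0 : A = 0 by rewrite -(vec_mxK v) -/A A0 linear0.
apply: transversal.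
- rewrite /A vec_mxK vE trmx_mul trmxK mulmxA.
  by rewrite (_ : T *m C = 0) ?mul0mx// /C mulmx_coker.
- apply/matrixP => i o; rewrite ord1 [RHS]mxE.
  have := Dz (row_mx (delta_mx 0 i) 0).
  rewrite mulD row_mxKl row_mxKr mulmx0 linear0 addr0 => /matrixP/(_ 0 0).
  rewrite [RHS]mxE => <-; rewrite mxE [RHS]mxE sum_mxvec_index exchange_big /=.
  apply: eq_bigr => j _; rewrite (bigD1 i)//= big1 ?addr0 => [|k ki].
    by rewrite mxvecE !mxE big_ord1 !mxE !eqxx mul1r mulrC.
  by rewrite mxvecE !mxE big_ord1 !mxE (negbTE ki) !mul0r.
- apply/matrixP => o j; rewrite ord1 [RHS]mxE.
  have := Dz (row_mx 0 (delta_mx 0 j)).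
  rewrite mulD row_mxKl row_mxKr trmx0 mul0mx linear0 add0r => /matrixP/(_ 0 0).
  rewrite [RHS]mxE => <-; rewrite mxE [RHS]mxE sum_mxvec_index.
  apply: eq_bigr => i _; rewrite (bigD1 j)//= big1 ?addr0 => [|k kj].
    by rewrite mxvecE !mxE big_ord1 !mxE !eqxx mulr1.
  by rewrite mxvecE !mxE big_ord1 !mxE (negbTE kj) mulr0 mul0r.
Qed.

Let p0C : mxvec (a0^T *m b0) *m C = 0.
Proof. by apply/eqP; rewrite -submxE. Qed.

(** Scaling [a0] or [b0] stays in the row space, so (a0, 0) and (0, b0) lie in the left kernel of
    [J]; their entries 1 at [f] and [g] express the two erased rows by the others. *)
Let JJ' : (J <= J')%MS.
Proof.
have rowJ' i : ~~ spec i -> (row i J <= J')%MS.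
  by move=> /negbTE si; have := row_sub i J'; rewrite rowK si.
apply/row_subP => i; have [/orP[]/eqP->|/rowJ'//] := boolP (spec i).
- have : row_mx a0 0 *m J = 0.
    by rewrite /J mulmxA mulD row_mxKl row_mxKr mulmx0 linear0 addr0 p0C.
  rewrite mulmx_sum_row (bigD1 (lshift n f))//= row_mxEl a0f scale1r.
  move=> /eqP; rewrite addr_eq0 => /eqP->; rewrite (eqmx_opp (\sum_(_ | _) _)).
  apply: summx_sub => k kf; have [j kE|j kE] := split_ordP k.
    apply/scalemx_sub/rowJ'; rewrite /spec negb_or kf kE.
    by rewrite eq_lrshift.
  by rewrite kE row_mxEr mxE scale0r sub0mx.
- have : row_mx 0 b0 *m J = 0.
    by rewrite /J mulmxA mulD row_mxKl row_mxKr trmx0 mul0mx linear0 add0r p0C.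
  rewrite mulmx_sum_row (bigD1 (rshift m g))//= row_mxEr b0g scale1r.
  move=> /eqP; rewrite addr_eq0 => /eqP->; rewrite (eqmx_opp (\sum_(_ | _) _)).
  apply: summx_sub => k kg; have [j kE|j kE] := split_ordP k.
    by rewrite kE row_mxEl mxE scale0r sub0mx.
  apply/scalemx_sub/rowJ'; rewrite /spec negb_or kg kE andbT.
  by rewrite eq_rlshift.
Qed.

(** The [c] coordinates selected by [sg] are solved for; [E] embeds them among all m + n
    coordinates. *)
Let c := \rank J'.
Let sg : 'I_c -> 'I_(m + n) := maxrankfun J'.
Let Js := rowsub sg J'.
Let E : 'M[R]_(c, m + n) := rowsub sg 1%:M.

Let Js_free : row_free Js.
Proof. exact: maxrowsub_free. Qed.

Let sg_spec i : ~~ spec (sg i).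
Proof.
apply/negP => si; have : row i Js = 0.
  by apply/rowP => j; rewrite !mxE si mxE.
move=> Ji; have : delta_mx 0 i *m Js = 0 :> 'rV_(m * n) by rewrite -rowE.
rewrite -(mul0mx _ Js) => /(row_free_inj Js_free)/matrixP/(_ 0 i).
by rewrite !mxE !eqxx => /eqP; rewrite oner_eq0.
Qed.

Let EJ : E *m J = Js.
Proof.
rewrite /E -rowsubE; apply/matrixP => i j.
by rewrite !mxE (negbTE (sg_spec i)) !mxE.
Qed.

Let CJs : (C <= Js)%MS.
Proof.
have JC : (J <= C)%MS by exact: submxMl.
have := JJ'; rewrite -(eq_maxrowsub J') => /(submx_trans _); apply.
by have := geq_leqif (mxrank_leqif_sup JC); rewrite rankJ leqnn => <-.
Qed.

Let cE : (c + l = m * n)%N.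
Proof.
have J'J : (J' <= J)%MS.
  apply/row_subP => i; rewrite rowK; case: ifP => _; first exact: sub0mx.
  exact: row_sub.
have -> : c = \rank C.
  by rewrite -rankJ; apply/eqP; rewrite eqn_leq !mxrankS.
rewrite mxrank_coker (eqP Tfree) subnK//.
by have := rank_leq_col T; rewrite (eqP Tfree).
Qed.

(** The free coordinates, neither solved for nor normalized. There are m + n - c - 2 = e of them, as
    c = m n - l. *)
Let X : {set 'I_(m + n)} := ~: ([set sg i | i : 'I_c] :|: [set lshift n f; rshift m g]).

Let cardX : #|X| = e.
Proof.
have := cardsC ([set sg i | i : 'I_c] :|: [set lshift n f; rshift m g]).
rewrite cardsU card_imset; last exact: maxrankfun_inj.
rewrite cards2 eq_lrshift /= !card_ord -/X.
rewrite (_ : _ :&: _ = finset.set0) ?cards0 ?subn0; last first.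
  apply/finset.setP => k; rewrite !inE; apply/negbTE/negP => /andP[/imsetP[i _ ->]].
  by have := sg_spec i; rewrite /spec => /negbTE->.
move=> H; apply: (@addnI (c + 2)); rewrite H.
by move: dims cE; clear; move: c => c'; lia.
Qed.

Let enX (j : 'I_e) : 'I_(m + n) := enum_val (cast_ord (esym cardX) j).

Let enX_inj : injective enX.
Proof. by move=> i j /enum_val_inj/cast_ord_inj. Qed.

Let enXP j : enX j \in X.
Proof. exact: enum_valP. Qed.

(** The map (a, b) -> a^T b is bilinear, so its second-order term is the whole remainder;
    [C *m pinvmx Js] reads it in the basis [Js]. *)
Let quad (z : 'rV[R]_(m + n)) : 'rV[R]_c :=
  - (mxvec ((lsubmx z)^T *m rsubmx z) *m (C *m pinvmx Js)).

Let quadL : exists2 K : R, 0 <= K &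
  forall z z', `|quad z - quad z'| <= K * (`|z| + `|z'|) * `|z - z'|.
Proof.
have [K K0 KB] := mulmx_norm_bound (C *m pinvmx Js).
exists K => // z z'.
rewrite /quad opprK addrC -mulmxBl (le_trans (KB _))// -mulrA ler_wpM2l//.
apply: mx_norm_le; first by rewrite mulr_ge0// addr_ge0.
move=> o p; rewrite ord1; case/mxvec_indexP: p => i j.
rewrite !mxE !mxvecE !mxE !big_ord1 !mxE.
set x' := z' 0 _; set y' := z' 0 _; set x := z 0 _; set y := z 0 _.
have -> : x' * y' - x * y = - ((x - x') * y' + x * (y - y')) by ring.
rewrite normrN (le_trans (ler_normD _ _))// !normrM mulrDl addrC lerD//.
  rewrite ler_pM// ?mx_norm_entry//.
  by have := mx_norm_entry (z - z') 0 (rshift m j); rewrite !mxE.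
rewrite mulrC ler_pM// ?mx_norm_entry//.
by have := mx_norm_entry (z - z') 0 (lshift n i); rewrite !mxE.
Qed.

Lemma local_solutions : exists2 d : R, 0 < d & exists coord : 'I_e -> 'I_m + 'I_n,
  forall tau : 'I_e -> R, (forall j, `|tau j| < d) ->
  exists (a : 'rV[R]_m) (b : 'rV[R]_n), [/\ a 0 f = 1, b 0 g = 1, (mxvec (a^T *m b) <= T)%MS &
    forall j, match coord j with inl i => a 0 i | inr k => b 0 k end =
      match coord j with inl i => a0 0 i | inr k => b0 0 k end + tau j].
Proof.
have [K K0 KL] := quadL.
have quad0 : quad 0 = 0 by rewrite /quad [rsubmx 0]linear0 mulmx0 linear0 mul0mx oppr0.
(* Multiplied by [Js], the fixed point equation says that the point displaced by z = t + w E
   satisfies all equations of the row space; this uses that the rows of [Js] span those of [C]. *)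
have [d d0 H] := quadratic_fixed_point (- (J *m pinvmx Js)) E K0 quad0 KL.
exists d => //; exists (fun j => fintype.split (enX j)) => tau taud.
pose t : 'rV[R]_(m + n) := \row_i \sum_(j | enX j == i) tau j.
have tX j : t 0 (enX j) = tau j.
  rewrite mxE (bigD1 j)//= big1 ?addr0// => k /andP[/eqP/enX_inj->].
  by rewrite eqxx.
have tN i : i \notin X -> t 0 i = 0.
  by move=> iX; rewrite mxE big1// => j /eqP ij; move: iX; rewrite -ij enXP.
have td : `|t| <= d.
  apply: mx_norm_le; first exact: ltW.
  move=> o i; rewrite ord1; have [iX|/tN->] := boolP (i \in X); last first.
    by rewrite normr0 ltW.
  have -> : i = enX (cast_ord cardX (enum_rank_in iX i)).
    by rewrite /enX cast_ordK enum_rankK_in.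
  by rewrite tX ltW.
have [w wE] := H t td.
pose z := t + w *m E.
have zF : z *m J + mxvec ((lsubmx z)^T *m rsubmx z) *m C = 0.
  have -> : z *m J = t *m J + w *m Js by rewrite mulmxDl -mulmxA EJ.
  have -> : w *m Js = - (t *m J + mxvec ((lsubmx z)^T *m rsubmx z) *m C).
    rewrite {1}wE -/z /quad mulmxN -opprD mulNmx (mulmxA t J) (mulmxA _ C) -mulmxDl mulmxKpV//.
    apply: (submx_trans _ CJs); rewrite /J mulmxA -mulmxDl; exact: submxMl.
  by rewrite opprD addrA subrr add0r addNr.
have wE0 i : (forall k, sg k != i) -> (w *m E) 0 i = 0.
  by move=> si; rewrite mxE big1// => k _; rewrite !mxE (negbTE (si k)) mulr0.
have zspec i : spec i -> z 0 i = 0.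
  move=> si; rewrite mxE wE0 ?addr0 ?tN//.
    by rewrite !inE negbK; apply/orP; right.
  by move=> k; apply: contraTneq si => <-.
have zX j : z 0 (enX j) = tau j.
  rewrite mxE tX wE0 ?addr0// => k; apply: contraTneq (enXP j) => <-.
  rewrite inE negbK; apply/finset.setUP; left.
  by apply/imsetP; exists k.
exists (a0 + lsubmx z), (b0 + rsubmx z); split.
- by rewrite mxE [X in _ + X]mxE zspec ?addr0// /spec eqxx.
- by rewrite mxE [X in _ + X]mxE zspec ?addr0// /spec eqxx orbT.
- have expand (u : 'rV[R]_(m + n)) : mxvec ((a0 + lsubmx u)^T *m (b0 + rsubmx u)) =
      mxvec (a0^T *m b0) + (u *m D + mxvec ((lsubmx u)^T *m rsubmx u)).
    rewrite mulD [(a0 + _)^T]linearD /= mulmxDl !mulmxDr !linearD /= -!addrA.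
    by congr (_ + _); rewrite addrCA.
  by rewrite expand submxE mulmxDl p0C add0r mulmxDl -mulmxA zF.
- move=> j; rewrite -(zX j); case: (split_ordP (enX j)) => k ->.
    by rewrite mxE [X in _ + X]mxE.
  by rewrite mxE [X in _ + X]mxE.
Qed.

End local_solutions.

(** * Tensor rank as a condition on the row space *)

Section generic_tensor_rank.
Variable R : realType.

Lemma rank_one_outer m n (a : 'rV[R]_m) (b : 'rV[R]_n) :
  a^T *m b != 0 -> \rank (a^T *m b) = 1%N.
Proof.
move=> ab0; apply/eqP; rewrite eqn_leq lt0n mxrank_eq0 ab0 andbT.
exact: leq_trans (mxrankM_maxr _ _) (rank_leq_row b).
Qed.

Lemma generic_meet_span l m n (T : 'M[R]_(l, m * n)) (M0 : 'M[R]_(m, n)) :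
  (2 <= m)%N -> (2 <= n)%N -> ((m - 1) * (n - 1) + 1 < l <= m * n)%N ->
  alg_indep (fun p : 'I_l * 'I_(m * n) => T p.1 p.2) ->
  (mxvec M0 <= T)%MS -> \rank M0 = 1%N ->
  exists M : 'I_l -> 'M[R]_(m, n),
    [/\ forall i, (mxvec (M i) <= T)%MS, forall i, \rank (M i) = 1%N &
      row_free (\matrix_i mxvec (M i))].
Proof.
move=> m2 n2 /andP[l1 l2] TI M0T /rank1_normal_form[t0 [a0 [b0 [f [g [t00 a0f b0g M0E]]]]]].
have p0T : (mxvec (a0^T *m b0) <= T)%MS.
  have -> : a0^T *m b0 = t0^-1 *: M0 by rewrite M0E scalerA mulVf// scale1r.
  by rewrite linearZ /= scalemx_sub.
(* The expected dimension of the intersection, positive in this case. *)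
pose e := (l - ((m - 1) * (n - 1) + 1))%N.
have e0 : (0 < e)%N by rewrite subn_gt0.
have dims : (m * n + e + 2 = l + m + n)%N.
  by rewrite /e; case: (m) (n) m2 n2 l1 => [|[|?]] // [|[|?]] //; lia.
have nI0 : 'I_0 -> False by case.
have Tfree : row_free T.
  exact: (@generic_row_free R l (m * n) _ T (fun=> 0) (alg_indep_sum0 nI0 TI)).
have trans (A : 'M[R]_(m, n)) : T *m (mxvec A)^T = 0 -> A *m b0^T = 0 -> a0 *m A = 0 -> A = 0.
  exact: (generic_transversal TI a0f b0g p0T).
have [d d0 [coord sol]] := local_solutions a0f b0g p0T Tfree dims trans.
pose coord0 (j : 'I_e) := match coord j with inl i => a0 0 i | inr k => b0 0 k end.
pose K := ('I_l * 'I_e)%type.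
(* For each of the [l] points to be found, [e] numbers are chosen near the free coordinates of the
   given point. *)
have [s sd sI] := alg_indep_extend (fun i : 'I_#|{: K}| => coord0 (enum_val i).2) d0 TI.
pose s' (k : K) := s (enum_rank k).
have s'd k : `|s' k - coord0 k.2| < d by have := sd (enum_rank k); rewrite enum_rankK.
pose h (q : ('I_l * 'I_(m * n)) + K) : ('I_l * 'I_(m * n)) + 'I_#|{: K}| :=
  match q with inl p => inl p | inr k => inr (enum_rank k) end.
have bh : bijective h.
  exists (fun q => match q with inl p => inl p | inr k => inr (enum_val k) end).
    by move=> [//|k] /=; rewrite enum_rankK.
  by move=> [//|k] /=; rewrite enum_valK.
have s'I : alg_indep (sum_fun (fun p : 'I_l * 'I_(m * n) => T p.1 p.2) s').
  by have := alg_indep_bij bh sI; congr alg_indep; apply/funext => -[].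
have /choice[a /choice[b H]] : forall i : 'I_l, exists (a : 'rV[R]_m) (b : 'rV[R]_n),
    [/\ a 0 f = 1, b 0 g = 1, (mxvec (a^T *m b) <= T)%MS &
    forall j, match coord j with inl i => a 0 i | inr k => b 0 k end = s' (i, j)].
  move=> i; have [j|a [b [af bg abT Hj]]] := sol (fun j => s' (i, j) - coord0 j).
    exact: s'd.
  by exists a, b; split => // j; rewrite Hj /coord0 addrC subrK.
have af i : a i 0 f = 1 by case: (H i).
have bg i : b i 0 g = 1 by case: (H i).
have qT i : (mxvec ((a i)^T *m b i) <= T)%MS by case: (H i).
have fcE : free_coords a b coord = s'.
  by apply/funext => -[i j]; rewrite /free_coords /=; case: (H i) => _ _ _ ->.
have q0 i : (a i)^T *m b i != 0.
  apply/eqP => /matrixP/(_ f g); rewrite !mxE big_ord1 mxE af bg mul1r => /eqP.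
  by rewrite oner_eq0.
(* The first free coordinate already distinguishes the points; this requires e > 0. *)
have qdist i j : i != j -> forall t, mxvec ((a i)^T *m b i) <> t *: mxvec ((a j)^T *m b j).
  move=> ij t qij; have {}qij x y : a i 0 x * b i 0 y = t * (a j 0 x * b j 0 y).
    move/rowP/(_ (mxvec_index x y)): qij.
    by rewrite mxE !mxvecE !mxE !big_ord1 !mxE.
  have t1 : t = 1 by have := qij f g; rewrite !af !bg !mul1r mulr1.
  have aE x : a i 0 x = a j 0 x by have := qij x g; rewrite t1 !bg !mulr1 mul1r.
  have bE y : b i 0 y = b j 0 y by have := qij f y; rewrite t1 !af !mul1r.
  have s'E : s' (i, Ordinal e0) = s' (j, Ordinal e0).
    rewrite -fcE /free_coords /=.
    by case: (coord _) => k; [exact: aE|exact: bE].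
  have := alg_indep_inj s'I (x1 := inr (i, Ordinal e0)) (x2 := inr (j, Ordinal e0)) s'E.
  by case=> /eqP; rewrite (negbTE ij).
exists (fun i => (a i)^T *m b i); split => // [i|].
  exact: rank_one_outer.
apply: inj_row_free => v; rewrite mulmx_sum_row => v0; apply/rowP => i.
rewrite mxE.
apply: (@rank_one_points_free R l m n e _ T a b (fun=> f) (fun=> g) af bg qT coord
  _ m2 n2 dims _ qdist (fun i => v 0 i)).
- by rewrite fcE.
- by rewrite card_ord.
- by rewrite -[RHS]v0; apply: eq_bigr => j _; rewrite rowK.
Qed.

Definition tensor_mx l m n (T : tensor R m n l) : 'M[R]_(l, m * n) :=
  \matrix_k mxvec (\matrix_(i, j) T i j k).

Lemma tensor_mxE l m n (T : tensor R m n l) k i j :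
  tensor_mx T k (mxvec_index i j) = T i j k.
Proof. by rewrite mxE mxvecE mxE. Qed.

Lemma tensor_rank_leP l m n (T : tensor R m n l) r :
  tensor_rank_le T r <-> exists (C : 'M[R]_(l, r)) (a : 'I_r -> 'rV[R]_m) (b : 'I_r -> 'rV[R]_n),
    tensor_mx T = C *m \matrix_s mxvec ((a s)^T *m b s).
Proof.
split=> [[a [b [c TE]]]|[C [a [b TE]]]].
  exists (\matrix_(k, s) c s k), (fun s => \row_i a s i), (fun s => \row_j b s j).
  apply/matrixP => k p; case/mxvec_indexP: p => i j.
  rewrite tensor_mxE TE mxE; apply: eq_bigr => s _.
  by rewrite !mxE mxvecE !mxE big_ord1 !mxE mulrC.
exists (fun s i => a s 0 i), (fun s j => b s 0 j), (fun s k => C k s) => i j k.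
rewrite -tensor_mxE TE mxE; apply: eq_bigr => s _.
by rewrite !mxE mxvecE !mxE big_ord1 !mxE mulrC.
Qed.

(** With [l] terms the coefficient matrix is square, and it is invertible because the slices are
    independent; so every term lies in the row space. Fewer than [l] terms cannot span [l]
    independent slices. *)
Lemma tensor_rank_eqP l m n (T : tensor R m n l) : row_free (tensor_mx T) ->
  tensor_rank_eq T l <-> exists M : 'I_l -> 'M[R]_(m, n),
    [/\ forall i, (mxvec (M i) <= tensor_mx T)%MS, forall i, \rank (M i) = 1%N &
      row_free (\matrix_i mxvec (M i))].
Proof.
move=> Tfree; split=> [[/tensor_rank_leP[C [a [b TE]]] _]|[M [MT M1 Mfree]]].
  pose Q := \matrix_s mxvec ((a s)^T *m b s).
  have Cunit : C \in unitmx.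
    rewrite -row_free_unit -row_leq_rank -{1}(eqP Tfree) TE.
    exact: mxrankM_maxl.
  have QE : Q = invmx C *m tensor_mx T by rewrite TE mulKmx.
  have Qfree : row_free Q.
    by rewrite -row_leq_rank -{1}(eqP Tfree) TE mxrankM_maxr.
  exists (fun s => (a s)^T *m b s); split => [i|i|//].
    by rewrite -[mxvec _](rowK (fun s => mxvec ((a s)^T *m b s))) -/Q QE row_mul submxMl.
  apply: rank_one_outer; apply/eqP => ab0; have : row i Q = 0.
    by rewrite rowK ab0 linear0.
  rewrite rowE -(mul0mx _ Q) => /(row_free_inj Qfree)/matrixP/(_ 0 i).
  by rewrite !mxE !eqxx => /eqP; rewrite oner_eq0.
pose Q := \matrix_s mxvec (M s).
have : (Q <= tensor_mx T)%MS by apply/row_subP => i; rewrite rowK.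
move=> /submxP[C QE].
have Cunit : C \in unitmx.
  rewrite -row_free_unit -row_leq_rank -{1}(eqP Mfree) -/Q QE.
  exact: mxrankM_maxl.
have TE : tensor_mx T = invmx C *m Q by rewrite QE mulKmx.
split.
  apply/tensor_rank_leP.
  have /choice[a /choice[b H]] : forall i, exists (a : 'rV[R]_m) (b : 'rV[R]_n), M i = a^T *m b.
    move=> i; have [t [a [b [f [g [_ _ _ ->]]]]]] := rank1_normal_form (M1 i).
    by exists a, (t *: b); rewrite scalemxAr.
  exists (invmx C), a, b; rewrite TE; congr (_ *m _).
  by apply/row_matrixP => i; rewrite !rowK H.
move=> r /tensor_rank_leP[C' [a [b T'E]]].
rewrite -{1}(eqP Tfree) T'E; apply: leq_trans (mxrankM_maxl _ _) _.
exact: rank_leq_col.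
Qed.

Lemma row_free_nonproportional l m n (M : 'I_l -> 'M[R]_(m, n)) :
  row_free (\matrix_i mxvec (M i)) ->
  forall i j, i != j -> forall c : R, M i <> c *: M j.
Proof.
move=> Mfree i j ij c Mij.
have : ((delta_mx 0 i : 'rV[R]_l) - c *: delta_mx 0 j) *m (\matrix_i mxvec (M i)) = 0.
  by rewrite mulmxBl -scalemxAl -!rowE !rowK Mij linearZ subrr.
rewrite -(mul0mx _ (\matrix_i mxvec (M i))) => /(row_free_inj Mfree)/matrixP/(_ 0 i).
by rewrite !mxE !eqxx (negbTE ij) mulr0 subr0 => /eqP; rewrite oner_eq0.
Qed.

Section generic.
Variables (l m n : nat) (T : tensor R m n l) (Pr : 'M[R]_(m * n)).
Hypothesis TI : alg_indep (fun p : 'I_l * 'I_(m * n) => tensor_mx T p.1 p.2).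
Hypotheses (m2 : (2 <= m)%N) (n2 : (2 <= n)%N).
Hypothesis PrT : (Pr :=: tensor_mx T)%MS.

Lemma generic_tensor_mx_free : (l <= m * n)%N -> row_free (tensor_mx T).
Proof.
have nI0 : 'I_0 -> False by case.
exact: (@generic_row_free R l (m * n) _ _ (fun=> 0) (alg_indep_sum0 nI0 TI)).
Qed.

Lemma generic_rank_eq_count : (l = (m - 1) * (n - 1) + 1)%N ->
  tensor_rank_eq T l <-> segre_count_ge Pr l.
Proof.
move=> lE; have lmn : (l <= m * n)%N.
  by rewrite lE; case: (m) (n) m2 n2 => [|[|?]] // [|[|?]] //; lia.
rewrite (tensor_rank_eqP (generic_tensor_mx_free lmn)); split.
  move=> [M [MT M1 Mfree]]; exists M; split; last exact: row_free_nonproportional.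
  by move=> i; split => //; rewrite /in_subspace PrT.
move=> [M [MPr Mdist]].
have MT i : (mxvec (M i) <= tensor_mx T)%MS by rewrite -PrT; case: (MPr i).
have M1 i : \rank (M i) = 1%N by case: (MPr i).
by exists M; split => //; exact: generic_rank_ones_free TI MT M1 Mdist.
Qed.

Lemma generic_rank_eq_meets : ((m - 1) * (n - 1) + 1 < l <= m * n)%N ->
  tensor_rank_eq T l <-> segre_meets Pr.
Proof.
move=> l12; have /andP[l1 lmn] := l12.
rewrite (tensor_rank_eqP (generic_tensor_mx_free lmn)); split.
  move=> [M [MT M1 Mfree]]; have l0 : (0 < l)%N by exact: leq_ltn_trans l1.
  by exists (M (Ordinal l0)); split => //; rewrite /in_subspace PrT.
move=> [M0 [M0Pr M01]]; apply: (generic_meet_span m2 n2 l12 TI _ M01).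
by rewrite -PrT.
Qed.

End generic.
End generic_tensor_rank.

Local Open Scope classical_set_scope.

(** * Gaussian families *)

Section families_of_reals.
Variables (R : realType) (I : finType).

Definition rect (B : I -> set R) : set (I -> R) := [set x | forall i, B i (x i)].

Definition rects : set (set (I -> R)) :=
  [set A | exists2 B : I -> set R, (forall i, measurable (B i)) & A = rect B].

(** Families of reals with the sigma-algebra generated by rectangles, the sets on which the
    hypotheses about laws are stated. *)
Definition fam : Type := g_sigma_algebraType rects.

HB.instance Definition _ := Measurable.on fam.

Lemma measurable_rect B : (forall i, measurable (B i)) -> measurable (rect B : set fam).
Proof. by move=> mB; apply: sub_sigma_algebra; exists B. Qed.

Lemma rects_setI : setI_closed rects.
Proof.
move=> _ _ [B mB ->] [C mC ->]; exists (fun i => B i `&` C i).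
  by move=> i; exact: measurableI.
apply/seteqP; split => x /=; first by move=> [xB xC] i; split; [exact: xB|exact: xC].
by move=> BC; split => i; case: (BC i).
Qed.

Lemma rectT : rect (fun=> setT) = setT.
Proof. by apply/seteqP; split. Qed.

Lemma measurable_coord (i : I) : measurable_fun setT (fun x : fam => x i).
Proof.
move=> _ B mB; rewrite setTI.
have -> : (fun x : fam => x i) @^-1` B = rect (fun j => if j == i then B else setT).
  apply/seteqP; split => x /=; last by move=> /(_ i); rewrite eqxx.
  by move=> Bx j; case: eqP => [->|].
by apply: measurable_rect => j; case: eqP.
Qed.

Lemma measurable_fam d (T : measurableType d) (X : T -> fam) :
  (forall i, measurable_fun setT (fun w => X w i)) -> measurable_fun setT X.
Proof.
move=> mX; apply: (@measurability _ _ _ _ setT X rects) => // _ [_ [B mB ->] <-].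
rewrite setTI (_ : X @^-1` rect B = \bigcap_(i in [set: I]) ((fun w => X w i) @^-1` B i)).
  apply: fin_bigcap_measurable => // i _.
  by rewrite -[_ @^-1` _]setTI; apply: mX.
by apply/seteqP; split => w /= H i; [move=> _|]; exact: H.
Qed.

Lemma fam_measure_unique (m1 m2 : {measure set fam -> \bar R}) :
  (m1 setT < +oo)%E ->
  (forall B, (forall i, measurable (B i)) -> m1 (rect B) = m2 (rect B)) ->
  forall A, measurable A -> m1 A = m2 A.
Proof.
move=> m1oo m12 A mA.
have HG : forall n : nat, rects ((fun=> setT) n).
  by move=> _; exists (fun=> setT); rewrite ?rectT.
refine (@measure_unique _ R fam rects (fun=> setT) erefl rects_setI HG _ m1 m2 _ _ A mA) => //.
- exact: bigcup_const.
- by move=> _ [B mB ->]; exact: m12.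
Qed.

Section same_law.
Context d (T : measurableType d) (P : probability T R).
Variables X Y : T -> fam.
Hypotheses (mX : forall i, measurable_fun setT (fun w => X w i))
  (mY : forall i, measurable_fun setT (fun w => Y w i)).
Hypothesis XY : forall B, (forall i, measurable (B i)) ->
  P (X @^-1` rect B) = P (Y @^-1` rect B).

Lemma same_law A : measurable A -> P (X @^-1` A) = P (Y @^-1` A).
Proof.
move=> mA.
pose FX : {mfun T >-> fam} := HB.pack X (isMeasurableFun.Build _ _ _ _ _ (measurable_fam mX)).
pose FY : {mfun T >-> fam} := HB.pack Y (isMeasurableFun.Build _ _ _ _ _ (measurable_fam mY)).
apply: (@fam_measure_unique (pushforward P FX) (pushforward P FY)) => //.
by rewrite [X in (X < _)%E](_ : _ = P setT)// probability_setT ltry.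
Qed.

End same_law.
End families_of_reals.

Section preimage_measures.
Variable R : realType.

(** A pi-system argument for the law of [f] restricted to an event [E], which later carries the
    conditions on the coordinates that [f] does not involve. *)
Lemma preimage_measure_unique d d' (T : measurableType d) (T' : measurableType d')
    (G : set (set T')) (P : probability T R) (f : T -> T') (E : set T)
    (nu : {measure set T' -> \bar R}) :
  measurable = <<s G >> -> setI_closed G -> G setT ->
  measurable_fun setT f -> measurable E ->
  (forall A, G A -> P (f @^-1` A `&` E) = nu A) ->
  forall A, measurable A -> P (f @^-1` A `&` E) = nu A.
Proof.
move=> mG GI GT mf mE Gnu A mA.
pose F : {mfun T >-> T'} := HB.pack f (isMeasurableFun.Build _ _ _ _ _ mf).
refine (@measure_unique _ R T' G (fun=> setT) mG GI (fun=> GT) _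
  (pushforward (mrestr P mE) F) nu _ _ A mA) => //.
- exact: bigcup_const.
- move=> _; rewrite [X in (X < _)%E](_ : _ = P (setT `&` E))// setTI.
  by rewrite (le_lt_trans (probability_le1 P mE)) ?ltry.
Unshelve. exact: mf. Qed.

Lemma prod_preimage_unique d d1 d2 (T : measurableType d) (T1 : measurableType d1)
    (T2 : measurableType d2) (P : probability T R) (f : T -> T1) (g : T -> T2)
    (E : set T) (nu : {measure set (T1 * T2) -> \bar R}) :
  measurable_fun setT f -> measurable_fun setT g -> measurable E ->
  (forall A B, measurable A -> measurable B ->
    P (f @^-1` A `&` g @^-1` B `&` E) = nu (A `*` B)) ->
  forall Z, measurable Z -> P ((fun w => (f w, g w)) @^-1` Z `&` E) = nu Z.
Proof.
move=> mf mg mE fgE.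
apply: (@preimage_measure_unique _ _ _ _ [set A `*` B | A in measurable & B in measurable]) => //.
- by rewrite measurable_prod_measurableType.
- move=> _ _ [A mA [B mB <-]] [A' mA' [B' mB' <-]]; rewrite -setXI.
  by exists (A `&` A'); [exact: measurableI|exists (B `&` B') => //; exact: measurableI].
- by exists setT => //; exists setT => //; rewrite setXTT.
- exact: measurable_fun_pair.
- move=> _ [A mA [B mB <-]]; rewrite -fgE//; congr (P (_ `&` E)).
Qed.

End preimage_measures.

Section iid_normal_families.
Context (R : realType) d (T : measurableType d) (P : probability T R).

Definition iid_normal (I : finType) (X : T -> fam R I) : Prop :=
  (forall i, measurable_fun setT (fun w => X w i)) /\
  (forall B : I -> set R, (forall i, measurable (B i)) ->
    P (X @^-1` rect B) = (\prod_i normal_prob 0 1 (B i))%E).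

Lemma iid_normal_bij (I J : finType) (h : J -> I) (X : T -> fam R I) :
  bijective h -> iid_normal X -> iid_normal (fun w => X w \o h : fam R J).
Proof.
move=> [g hK gK] [mX PX]; split=> [i|B mB]; first exact: mX.
have := PX (B \o g) (fun i => mB (g i)).
rewrite (reindex h) /=; last by exists g => ? _.
under eq_bigr do rewrite hK.
move=> <-; congr (P _); apply/seteqP; split => w /= H i.
  by have := H (g i); rewrite /= gK.
by have := H (h i); rewrite /= hK.
Qed.

Lemma iid_normal_same_law (I : finType) (X Y : T -> fam R I) A :
  iid_normal X -> iid_normal Y -> measurable A -> P (X @^-1` A) = P (Y @^-1` A).
Proof.
move=> [mX PX] [mY PY]; apply: same_law => // B mB.
by rewrite PX// PY.
Qed.

Lemma measurable_alg_indep (I : finType) : measurable (@alg_indep R I : set (fam R I)).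
Proof.
rewrite -[alg_indep (I:=I)]setCK; apply: measurableC.
rewrite (_ : ~` _ = \bigcup_(Dc in [set: {D & {ffun {ffun I -> 'I_D.+1} -> rat}}])
  if projT2 Dc == 0 then set0 else
    (fun x : fam R I => \sum_a ratr (projT2 Dc a) * monomial x (fun i => a i)) @^-1` [set 0]).
  apply: countable_bigcupT_measurable; first exact: countableP.
  move=> [D c] /=; case: ifP => // _.
  rewrite -[_ @^-1` _]setTI.
  suff : measurable_fun setT (fun x : fam R I => \sum_a ratr (c a) * monomial x (fun i => a i)).
    by apply=> //; exact: measurable_set1.
  apply: measurable_sum => a; apply: measurable_funM => //.
  apply: measurable_prod => i _; apply: measurable_funX.
  exact: measurable_coord.
apply/seteqP; split => x /=.
  move=> /existsNP[D /existsNP[c /not_implyP[cE c0]]].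
  by exists (existT _ D c) => //=; case: eqP.
move=> [[D c] _] /=; case: eqP => // c0 cx xI; apply: c0; exact: xI cx.
Qed.

Lemma normal_prob_countable (A : set R) : countable A -> normal_prob 0 1 A = 0%E.
Proof.
move=> cA; have /null_content_dominatesP := normal_prob_dominates (0 : R) 1.
by apply; [exact: countable_measurable|exact: countable_lebesgue_measure0].
Qed.

End iid_normal_families.

(** * Almost sure algebraic independence *)

Section iid_normal_alg_indep.
Context (R : realType) d (T : measurableType d) (P : probability T R).

Let iid_normal_option (I : finType) (X : T -> fam R (option I)) :
  iid_normal P X ->
  iid_normal P (fun w => X w \o Some : fam R I) /\
  forall (A : set (fam R I)) (B : set R), measurable A -> measurable B ->
    P ((fun w => X w \o Some : fam R I) @^-1` A `&` (fun w => X w None) @^-1` B) =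
    (P ((fun w => X w \o Some : fam R I) @^-1` A) * normal_prob 0 1 B)%E.
Proof.
move=> [mX PX].
have PXB (C : I -> set R) (B : set R) : (forall i, measurable (C i)) -> measurable B ->
    P ((fun w => X w \o Some : fam R I) @^-1` rect C `&` (fun w => X w None) @^-1` B) =
    (\prod_i normal_prob 0 1 (C i) * normal_prob 0 1 B)%E.
  move=> mC mB.
  have := PX (fun o => if o is Some i then C i else B)
    (fun o => match o with Some i => mC i | None => mB end).
  rewrite (bigD1 None)//= muleC (reindex_omap Some id) => [|[]//].
  under eq_bigl do rewrite /= eqxx.
  move=> <-; congr (P _); apply/seteqP; split => w /=.
    by move=> [CX BX] [i|]; [exact: CX|exact: BX].
  by move=> H; split; [move=> i; exact: (H (Some i))|exact: (H None)].
have nT : normal_prob 0 1 [set: R] = 1%E by exact: probability_setT.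
have iidY : iid_normal P (fun w => X w \o Some : fam R I).
  split=> [i|C mC]; first exact: mX.
  by have := PXB C setT mC measurableT; rewrite preimage_setT setIT nT mule1.
split=> // A B mA mB.
have mY : measurable_fun setT (fun w => X w \o Some : fam R I).
  by apply: measurable_fam; case: iidY.
pose Y : {mfun T >-> fam R I} := HB.pack (fun w => X w \o Some : fam R I)
  (isMeasurableFun.Build _ _ _ _ _ mY).
have fB : normal_prob (0 : R) 1 B \is a fin_num.
  rewrite ge0_fin_numE//; apply: le_lt_trans (ltry 1).
  exact: (probability_le1 (normal_prob (0 : R) 1)).
have r0 : 0 <= fine (normal_prob (0 : R) 1 B) by rewrite fine_ge0.
have mscB S : mscale (NngNum r0) (distribution P Y) S =
    (normal_prob 0 1 B * distribution P Y S)%E.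
  by rewrite /mscale -[in RHS](fineK fB).
rewrite (@preimage_measure_unique R _ _ T (fam R I) (@rects R I) P _ _
  (mscale (NngNum r0) (distribution P Y))) //.
- by rewrite [LHS]mscB muleC.
- exact: rects_setI.
- by exists (fun=> setT); rewrite ?rectT.
- by rewrite -[_ @^-1` _]setTI; exact: mX.
- move=> _ [C mC ->]; rewrite PXB// [RHS]mscB muleC; congr (_ * _)%E.
  by case: iidY => _ /(_ C mC) <-.
Qed.

(** [Z] collects the pairs where dependence first appears with the last entry. Its section over an
    independent [y] is countable, so Fubini makes it null. *)
Let step (I : finType) (X : T -> fam R (option I)) : iid_normal P X ->
  P ((fun w => X w \o Some : fam R I) @^-1` ~` @alg_indep R I) = 0%E ->
  P (X @^-1` ~` @alg_indep R (option I)) = 0%E.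
Proof.
move=> iidX Y0; have [iidY indep] := iid_normal_option iidX.
have mY : measurable_fun setT (fun w => X w \o Some : fam R I).
  by apply: measurable_fam; case: iidY.
pose Y : {mfun T >-> fam R I} := HB.pack (fun w => X w \o Some : fam R I)
  (isMeasurableFun.Build _ _ _ _ _ mY).
have mt : measurable_fun setT (fun w => X w None) by case: iidX.
pose Z : set (fam R I * R) := [set yt | alg_indep yt.1 /\ ~ alg_indep (oext yt.1 yt.2)].
have mZ : measurable Z.
  rewrite (_ : Z = fst @^-1` @alg_indep R I `&`
    (fun yt => oext yt.1 yt.2 : fam R (option I)) @^-1` ~` @alg_indep R (option I))//.
  apply: measurableI; rewrite -[_ @^-1` _]setTI.
    by apply: measurable_fst => //; exact: measurable_alg_indep.
  have : measurable_fun setT (fun yt : fam R I * R => oext yt.1 yt.2 : fam R (option I)).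
    apply: measurable_fam => -[i|] /=; last exact: measurable_snd.
    by apply: (measurableT_comp (measurable_coord i)); exact: measurable_fst.
  by apply=> //; apply: measurableC; exact: measurable_alg_indep.
have PZ : P ((fun w => (Y w, X w None)) @^-1` Z) = 0%E.
  rewrite -[_ @^-1` _]setIT.
  rewrite (@prod_preimage_unique R _ _ _ T _ _ P _ _ setT
    (distribution P Y \x normal_prob 0 1)%E)//.
  - transitivity (\int[distribution P Y]_y normal_prob (0 : R) 1 (xsection Z y))%E => //.
    rewrite integral0_eq// => y _.
    apply: normal_prob_countable.
    have [yI|yI] := pselect (alg_indep y); last first.
      rewrite (_ : xsection _ _ = set0); first exact: countable0.
      by apply/seteqP; split => // t; rewrite /xsection/= inE => -[].
    apply: (sub_countable _ (countable_not_alg_indep yI)).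
    apply: subset_card_le => t; rewrite /xsection/= inE => -[].
    by [].
  - move=> A B mA mB; rewrite setIT indep//; apply: esym.
    exact: product_measure1E.
have mN (J : finType) (X' : T -> fam R J) : iid_normal P X' ->
    measurable (X' @^-1` ~` @alg_indep R J).
  move=> [mX' _]; rewrite -[_ @^-1` _]setTI; apply: measurable_fam => //.
  by apply: measurableC; exact: measurable_alg_indep.
have mZ' : measurable ((fun w => (Y w, X w None)) @^-1` Z).
  rewrite -[_ @^-1` _]setTI; suff : measurable_fun setT (fun w => (Y w, X w None)) by apply.
  exact: measurable_fun_pair.
apply/eqP; rewrite eq_le measure_ge0 andbT.
apply: (@le_trans _ _ (P (((fun w => X w \o Some : fam R I) @^-1` ~` @alg_indep R I) `|`
    ((fun w => (Y w, X w None)) @^-1` Z)))).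
  apply: le_measure; rewrite ?inE; [exact: mN|by apply: measurableU => //; exact: mN|].
  move=> w /= Xw; have [Yw|] := pselect (alg_indep (X w \o Some)); [right|by left].
  split => //=; apply: contra_not Xw; congr alg_indep.
  by apply/funext => -[].
apply: le_trans (measureU2 _ _ _) _ => //; first exact: mN.
by rewrite [X in (X + _)%E]Y0 [X in (_ + X)%E]PZ adde0.
Qed.

Lemma iid_normal_alg_indep (I : finType) (X : T -> fam R I) : iid_normal P X ->
  P (X @^-1` ~` @alg_indep R I) = 0%E.
Proof.
have ord q : forall (Y : T -> fam R 'I_q), iid_normal P Y ->
    P (Y @^-1` ~` @alg_indep R 'I_q) = 0%E.
  elim: q => [|q IH] Y iidY.
    rewrite (_ : _ @^-1` _ = set0) ?measure0//; apply/seteqP; split => // w /= H.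
    exfalso; apply: H => D c c0; apply/ffunP => a; rewrite ffunE.
    move: c0; rewrite (bigD1 a)//= big1 ?addr0 => [|b].
      by rewrite /monomial big_ord0 mulr1 => /eqP; rewrite fmorph_eq0 => /eqP.
    by move=> /negP[]; apply/eqP/ffunP => -[].
  pose h (o : option 'I_q) : 'I_q.+1 := if o is Some i then lift ord0 i else ord0.
  pose h' (i : 'I_q.+1) : option 'I_q := unlift ord0 i.
  have hK : cancel h h' by move=> [i|]; rewrite /h' /h ?liftK ?unlift_none.
  have h'K : cancel h' h by move=> i; rewrite /h' /h; case: unliftP => [k ->|->].
  have bh : bijective h by exists h'.
  have iidh := iid_normal_bij bh iidY.
  have := step iidh (IH _ (proj1 (iid_normal_option iidh))).
  congr (P _ = _); apply/seteqP; split => w /=; apply: contra_not => wI.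
    exact: alg_indep_bij bh wI.
  have bh' : bijective h' by exists h.
  have := alg_indep_bij bh' wI; congr alg_indep; apply/funext => i /=.
  by rewrite h'K.
move=> iidX; have := ord _ _ (iid_normal_bij (enum_val_bij I) iidX).
congr (P _ = _); apply/seteqP; split => w /=; apply: contra_not => wI.
  exact: alg_indep_bij (enum_val_bij I) wI.
have := alg_indep_bij (enum_rank_bij I) wI; congr alg_indep; apply/funext => i /=.
by rewrite enum_rankK.
Qed.

End iid_normal_alg_indep.

(** * Rotation invariance *)

Section normal_rotation.
Variable R : realType.
Local Notation mu := (@lebesgue_measure R).

Lemma lebesgue_measure_translation (c : R) (A : set R) : measurable A ->
  pushforward mu (fun x : measurableTypeR R => x + c : measurableTypeR R) A = mu A.
Proof.
move=> mA.
have mc : measurable_fun setT (fun x : measurableTypeR R => x + c : measurableTypeR R).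
  exact: measurable_funD.
pose F : {mfun measurableTypeR R >-> measurableTypeR R} :=
  HB.pack (fun x : measurableTypeR R => x + c : measurableTypeR R)
    (isMeasurableFun.Build _ _ _ _ _ mc).
apply/esym/(@lebesgue_measure_unique R (pushforward mu F)) => // _ [[a b] _ <-].
rewrite [RHS](_ : _ = mu `]a - c, b - c]%classic); last first.
  rewrite /= /pushforward; congr (mu _).
  by apply/seteqP; split => x /=; rewrite !in_itv /= ltrBlDr lerBrDr.
rewrite !lebesgue_measure_itv/= !lte_fin ltrD2r; case: ifP => // _.
by rewrite -!EFinD; congr (_%:E); ring.
Qed.

Lemma ge0_integral_translation (h : R -> \bar R) (c : R) :
  measurable_fun setT h -> (forall x, 0 <= h x)%E ->
  (\int[mu]_x h (x + c)%R = \int[mu]_x h x)%E.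
Proof.
move=> mh h0.
have mc : measurable_fun setT (fun x : measurableTypeR R => x + c : measurableTypeR R).
  exact: measurable_funD.
have <- := @ge0_integral_pushforward _ _ _ _ R _ mc mu setT h measurableT mh (fun y _ => h0 y).
by apply: eq_measure_integral => //= A mA _; exact: lebesgue_measure_translation.
Qed.

(** A shear translates each fibre. *)
Lemma ge0_integral_shear2 (g : measurableTypeR R * measurableTypeR R -> \bar R) (t : R) :
  measurable_fun setT g -> (forall z, 0 <= g z)%E ->
  (\int[mu \x mu]_z g (z.1, z.2 + t * z.1)%R = \int[mu \x mu]_z g z)%E.
Proof.
move=> mg g0.
have mS : measurable_fun setT (fun z : R * R => (z.1, z.2 + t * z.1)).
  apply: measurable_fun_pair; first exact: measurable_fst.
  by apply: measurable_funD => //; apply: measurable_funM.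
rewrite (fubini_tonelli1 g)// fubini_tonelli1; last 2 first.
- exact: measurableT_comp.
- by [].
apply: eq_integral => x _; rewrite /fubini_F /=.
rewrite (ge0_integral_translation (h := fun y => g (x, y)))//.
by apply: measurableT_comp => //; exact: measurable_fun_pair.
Qed.

Lemma ge0_integral_shear1 (g : measurableTypeR R * measurableTypeR R -> \bar R) (t : R) :
  measurable_fun setT g -> (forall z, 0 <= g z)%E ->
  (\int[mu \x mu]_z g (z.1 + t * z.2, z.2)%R = \int[mu \x mu]_z g z)%E.
Proof.
move=> mg g0.
have mS : measurable_fun setT (fun z : R * R => (z.1 + t * z.2, z.2)).
  apply: measurable_fun_pair; last exact: measurable_snd.
  by apply: measurable_funD => //; apply: measurable_funM.
rewrite (fubini_tonelli2 g)// fubini_tonelli2; last 2 first.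
- exact: measurableT_comp.
- by [].
apply: eq_integral => y _; rewrite /fubini_G /=.
rewrite (ge0_integral_translation (h := fun x => g (x, y)))//.
by apply: measurableT_comp => //; exact: measurable_fun_pair.
Qed.

Definition rotation (c s : R) (z : R * R) : R * R :=
  (c * z.1 + s * z.2, - s * z.1 + c * z.2).

Lemma measurable_rotation c s : measurable_fun setT (rotation c s).
Proof.
by apply: measurable_fun_pair; apply: measurable_funD => //; apply: measurable_funM.
Qed.

(* A rotation is a product of three shears, except for the rotation of angle pi. *)
Lemma ge0_integral_rotation (g : measurableTypeR R * measurableTypeR R -> \bar R) (c s : R) :
  c ^+ 2 + s ^+ 2 = 1 -> c != -1 -> measurable_fun setT g -> (forall z, 0 <= g z)%E ->
  (\int[mu \x mu]_z g (rotation c s z) = \int[mu \x mu]_z g z)%E.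
Proof.
(* For the rotation of angle theta, [t] is tan(theta / 2), which is why the angle pi is excluded. *)
move=> cs c1 mg g0; pose t := s / (1 + c).
have c10 : 1 + c != 0 by rewrite addrC addr_eq0.
pose S1 (z : R * R) := (z.1 + t * z.2, z.2).
pose S2 (z : R * R) := (z.1, z.2 + - s * z.1).
have E z : rotation c s z = S1 (S2 (S1 z)).
  have ts : t * s = 1 - c.
    apply: (mulIf c10); rewrite /t mulrAC divfK//.
    have : s ^+ 2 = 1 - c ^+ 2 by rewrite -cs; ring.
    by rewrite !expr2 => ->; ring.
  rewrite /rotation /S1 /S2 /=; congr (_, _).
    transitivity (z.1 - (t * s) * z.1 + (t + t * (1 - t * s)) * z.2); last by ring.
    have -> : t + t * (1 - t * s) = s.
      by rewrite ts /t; field.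
    by rewrite ts; ring.
  transitivity (- s * z.1 + (1 - t * s) * z.2); last by ring.
  by rewrite ts; ring.
have mS1 : measurable_fun setT S1.
  apply: measurable_fun_pair; last exact: measurable_snd.
  by apply: measurable_funD => //; apply: measurable_funM.
have mS2 : measurable_fun setT S2.
  apply: measurable_fun_pair; first exact: measurable_fst.
  by apply: measurable_funD => //; apply: measurable_funM.
under eq_integral do rewrite E.
rewrite (ge0_integral_shear1 (g := fun z => g (S1 (S2 z)))); last 2 first.
- by apply: measurableT_comp => //; exact: measurableT_comp.
- by [].
rewrite (ge0_integral_shear2 (g := fun z => g (S1 z)))//; last exact: measurableT_comp.
exact: ge0_integral_shear1.
Qed.

Let k (z : R * R) : R := normal_pdf 0 1 z.1 * normal_pdf 0 1 z.2.

Let k0 z : 0 <= k z.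
Proof. by rewrite /k mulr_ge0// normal_pdf_ge0. Qed.

Let mk : measurable_fun setT k.
Proof.
by apply: measurable_funM; apply: measurableT_comp => //; exact: measurable_normal_pdf.
Qed.

Let k_rotation c s z : c ^+ 2 + s ^+ 2 = 1 -> k (rotation c s z) = k z.
Proof.
move=> cs; rewrite /k !normal_pdfE ?oner_eq0// /normal_fun.
rewrite mulrACA [RHS]mulrACA -!expRD; congr (_ * expR _).
rewrite /rotation /= !subr0 -!mulrDl -!opprD; congr (- _ / _).
transitivity ((c ^+ 2 + s ^+ 2) * (z.1 ^+ 2 + z.2 ^+ 2)); last by rewrite cs mul1r.
by ring.
Qed.

(** The measure with the joint normal density. [rho_prod] identifies it with the product law, so
    that the rotation invariance of Lebesgue measure and that of the density can be combined. *)
Definition rho (A : set (measurableTypeR R * measurableTypeR R)) : \bar R :=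
  (\int[mu \x mu]_(z in A) (normal_pdf 0 1 z.1 * normal_pdf 0 1 z.2)%:E)%E.

Let rho0 : rho set0 = 0%E. Proof. by rewrite /rho integral_set0. Qed.

Let rho_ge0 A : (0 <= rho A)%E.
Proof. by apply: integral_ge0 => z _; rewrite lee_fin; exact: k0. Qed.

Let rho_sigma_additive : semi_sigma_additive rho.
Proof.
move=> /= A mA tA mUA; rewrite /rho ge0_integral_bigcup//=; last 2 first.
  by apply/measurable_EFinP/measurable_funTS; exact: mk.
  by move=> z _; rewrite lee_fin; exact: k0.
apply: is_cvg_ereal_nneg_natsum_cond => n _ _.
by apply: integral_ge0 => z _; rewrite lee_fin; exact: k0.
Qed.

HB.instance Definition _ := isMeasure.Build _ _ _ rho rho0 rho_ge0 rho_sigma_additive.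

Let rhoE A : measurable A -> rho A = (\int[mu \x mu]_z (k z * \1_A z)%:E)%E.
Proof.
move=> mA; rewrite /rho integral_mkcond; apply: eq_integral => z _.
rewrite patchE indicE; case: ifP => _; first by rewrite mulr1.
by rewrite mulr0.
Qed.

Let normal_probE (B : set R) :
  normal_prob 0 1 B = (\int[mu]_x (normal_pdf 0 1 x * \1_B x)%:E)%E.
Proof.
rewrite /normal_prob integral_mkcond; apply: eq_integral => x _.
rewrite patchE indicE; case: ifP => _; first by rewrite mulr1.
by rewrite mulr0.
Qed.

Let measurable_pdf_indic (B : set R) : measurable B ->
  measurable_fun [set: measurableTypeR R]
    (fun x => (normal_pdf 0 1 x * \1_B x)%:E).
Proof.
move=> mB; apply/measurable_EFinP; apply: measurable_funM.
  exact: measurable_normal_pdf.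
exact: measurable_indic.
Qed.

Let rho_prod A : measurable A -> rho A = (normal_prob 0 1 \x normal_prob 0 1)%E A.
Proof.
move=> mA; apply/esym.
refine (@product_measure_unique _ _ _ _ R (normal_prob 0 1) (normal_prob 0 1) rho _ A mA).
move=> B C mB mC.
have mBC : measurable (B `*` C) by exact: measurableX.
rewrite [LHS]rhoE// fubini_tonelli1//; last 2 first.
- apply/measurable_EFinP; apply: measurable_funM; first exact: mk.
  exact: measurable_indic.
- by move=> z; rewrite lee_fin mulr_ge0.
rewrite /fubini_F /=.
rewrite !normal_probE -ge0_integralZr//; last 3 first.
- exact: measurable_pdf_indic.
- by move=> x _; rewrite lee_fin mulr_ge0// normal_pdf_ge0.
- by apply: integral_ge0 => x _; rewrite lee_fin mulr_ge0// normal_pdf_ge0.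
apply: eq_integral => x _; rewrite -ge0_integralZl//; last 3 first.
- exact: measurable_pdf_indic.
- by move=> y _; rewrite lee_fin mulr_ge0// normal_pdf_ge0.
- by rewrite lee_fin mulr_ge0// normal_pdf_ge0.
apply: eq_integral => y _; rewrite -EFinM /k /= mulrACA; congr (_ * _)%:E.
rewrite !indicE in_setX /=; case: (y \in C); case: (x \in B) => /=;
  by rewrite ?mulr0 ?mulr1.
Qed.

Lemma normal_prob_rotation c s (A : set (R * R)) : c ^+ 2 + s ^+ 2 = 1 -> c != -1 ->
  measurable A ->
  (normal_prob 0 1 \x normal_prob 0 1)%E (rotation c s @^-1` A) =
  (normal_prob 0 1 \x normal_prob 0 1)%E A.
Proof.
move=> cs c1 mA.
have mRA : measurable (rotation c s @^-1` A).
  by rewrite -[_ @^-1` _]setTI; exact: measurable_rotation.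
rewrite -!rho_prod// !rhoE//.
have mf : measurable_fun [set: measurableTypeR R * measurableTypeR R]
    (fun z => (k z * \1_A z)%:E).
  apply/measurable_EFinP; apply: measurable_funM; first exact: mk.
  exact: measurable_indic.
apply: etrans (ge0_integral_rotation cs c1 mf _); last first.
  by move=> z; rewrite lee_fin mulr_ge0.
by apply: eq_integral => z _; rewrite k_rotation// !indicE.
Qed.

End normal_rotation.

Section iid_normal_rotation.
Context (R : realType) d (T : measurableType d) (P : probability T R).

Definition rotate2 (I : finType) (i j : I) (c s : R) (x : fam R I) : fam R I :=
  fun k => if k == i then c * x i + s * x j
           else if k == j then - s * x i + c * x j else x k.

Lemma prode_pair (I : finType) (i j : I) (F : I -> \bar R) : i != j ->
  (\prod_k F k = F i * (F j * \prod_(k | (k != i) && (k != j)) F k))%E.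
Proof. by move=> ij; rewrite (bigD1 i)//= (bigD1 j)// eq_sym. Qed.

(** On the event [E] that the other coordinates satisfy their constraints, the pair of coordinates
    [i], [j] has [r0] times the plane normal law, which these rotations preserve. *)
Lemma iid_normal_rotate2 (I : finType) (i j : I) (c s : R) (X : T -> fam R I) :
  i != j -> c ^+ 2 + s ^+ 2 = 1 -> c != -1 ->
  iid_normal P X -> iid_normal P (fun w => rotate2 i j c s (X w)).
Proof.
move=> ij cs c1 [mX PX]; split.
  move=> k; rewrite /rotate2; case: eqP => _; [|case: eqP => _ //];
  by apply: measurable_funD; apply: measurable_funM.
move=> B mB.
pose E := \bigcap_(k in [set k | (k != i) && (k != j)]) ((fun w => X w k) @^-1` B k).
have mE : measurable E.
  apply: fin_bigcap_measurable => [|k _]; first exact: finite_finset.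
  by rewrite -[_ @^-1` _]setTI; exact: mX.
pose r0 : \bar R := (\prod_(k | (k != i) && (k != j)) normal_prob 0 1 (B k))%E.
have r0_fin : r0 \is a fin_num.
  apply: (big_ind (fun x : \bar R => x \is a fin_num)) => // [x y xf yf|k _].
    exact: fin_numM.
  rewrite ge0_fin_numE//; apply: le_lt_trans (ltry 1).
  exact: (probability_le1 (normal_prob (0 : R) 1) (mB k)).
have r0_ge0 : 0 <= fine r0.
  by apply/fine_ge0/prode_ge0 => k _; exact: measure_ge0.
pose nu := mscale (NngNum r0_ge0) (normal_prob 0 1 \x normal_prob 0 1)%E.
have nuE A : nu A = (r0 * (normal_prob 0 1 \x normal_prob 0 1)%E A)%E.
  by rewrite /nu /mscale -[in RHS](fineK r0_fin).
have key Z : measurable Z -> P ((fun w => (X w i, X w j)) @^-1` Z `&` E) = nu Z.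
  apply: (@prod_preimage_unique R _ _ _ T (measurableTypeR R) (measurableTypeR R) P
    (fun w => X w i) (fun w => X w j) E nu (mX i) (mX j) mE) => A C mA mC.
  rewrite [RHS]nuE [X in (_ * X)%E]product_measure1E//.
  pose B' k := if k == i then A else if k == j then C else B k.
  have mB' k : measurable (B' k).
    by rewrite /B'; case: eqP => _; [exact: mA|case: eqP => _; [exact: mC|exact: mB]].
  have B'i : B' i = A by rewrite /B' eqxx.
  have B'j : B' j = C by rewrite /B' eq_sym (negbTE ij) eqxx.
  have E1 := PX B' mB'.
  rewrite (prode_pair _ ij) B'i B'j in E1.
  rewrite (eq_bigr (fun k => normal_prob 0 1 (B k))) in E1; last first.
    by move=> k /andP[ki kj]; rewrite /B' (negbTE ki) (negbTE kj).
  rewrite muleC -muleA; rewrite -[RHS]E1; congr (P _); apply/seteqP; split => w /=.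
    move=> [[Ai Cj] Ew] k; rewrite /B'; case: eqP => [->//|/eqP ki].
    by case: eqP => [->//|/eqP kj]; apply: Ew; rewrite /= ki kj.
  move=> H; split; first split.
  - by have := H i; rewrite B'i.
  - by have := H j; rewrite B'j.
  - by move=> k /= /andP[ki kj]; have := H k; rewrite /B' (negbTE ki) (negbTE kj).
have mBij : measurable (B i `*` B j) by exact: measurableX.
have mRB : measurable (rotation c s @^-1` (B i `*` B j)).
  by rewrite -[_ @^-1` _]setTI; exact: measurable_rotation.
transitivity (P ((fun w => (X w i, X w j)) @^-1` (rotation c s @^-1` (B i `*` B j)) `&` E)).
  congr (P _); apply/seteqP; split => w /=.
    move=> H; split.
      split; first by have := H i; rewrite /rotate2 eqxx.
      by have := H j; rewrite /rotate2 eq_sym (negbTE ij) eqxx.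
    by move=> k /= /andP[ki kj]; have := H k; rewrite /rotate2 (negbTE ki) (negbTE kj).
  move=> [[H1 H2] H3] k; rewrite /rotate2; case: eqP => [->//|/eqP ki].
  by case: eqP => [->//|/eqP kj]; apply: H3; rewrite /= ki kj.
rewrite key// [LHS]nuE [X in (_ * X)%E]normal_prob_rotation//.
rewrite [X in (_ * X)%E]product_measure1E; [|exact: mB|exact: mB].
by rewrite [RHS](prode_pair _ ij) [RHS]muleA [RHS]muleC.
Qed.

Variables (N : nat).

Definition givens (i j : 'I_N) (c s : R) : 'M[R]_N :=
  \matrix_(a, b) if b == i then c * (a == i)%:R + s * (a == j)%:R
                 else if b == j then - s * (a == i)%:R + c * (a == j)%:R
                 else (a == b)%:R.

Lemma mulmx_givens l (A : 'M[R]_(l, N)) i j c s a b :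
  (A *m givens i j c s) a b =
    if b == i then c * A a i + s * A a j
    else if b == j then - s * A a i + c * A a j else A a b.
Proof.
have sumD (k : 'I_N) (x : R) : \sum_j A a j * (x * (j == k)%:R) = x * A a k.
  rewrite (bigD1 k)//= eqxx mulr1 big1 ?addr0 => [|k' /negbTE->]; first exact: mulrC.
  by rewrite !mulr0.
rewrite mxE.
transitivity (\sum_k A a k * (if b == i then c * (k == i)%:R + s * (k == j)%:R
                 else if b == j then - s * (k == i)%:R + c * (k == j)%:R
                 else (k == b)%:R)).
  by apply: eq_bigr => k _; rewrite mxE.
case: ifP => _.
  by under eq_bigr do rewrite mulrDr; rewrite big_split /= !sumD.
case: ifP => _.
  by under eq_bigr do rewrite mulrDr; rewrite big_split /= !sumD.
by under eq_bigr do rewrite -[_%:R]mul1r; rewrite sumD mul1r.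
Qed.

(** These products stand in for the orthogonal group: the Gaussian law is invariant under each
    factor, and they suffice to diagonalize projections. The condition [c != -1] comes from the
    three shears. *)
Inductive givens_prod : 'M[R]_N -> Prop :=
| givens_prod1 : givens_prod 1%:M
| givens_prodS Q i j c s : i != j -> c ^+ 2 + s ^+ 2 = 1 -> c != -1 ->
    givens_prod Q -> givens_prod (Q *m givens i j c s).

Lemma givens_prodM Q1 Q2 : givens_prod Q1 -> givens_prod Q2 -> givens_prod (Q1 *m Q2).
Proof.
move=> g1; elim=> [|Q i j c s ij cs c1 _ IH]; first by rewrite mulmx1.
by rewrite mulmxA; exact: givens_prodS.
Qed.

Lemma givens_orthogonal i j c s : i != j -> c ^+ 2 + s ^+ 2 = 1 ->
  orthogonal_mx (givens i j c s).
Proof.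
move=> ij cs; have ji : (j == i) = false by rewrite eq_sym (negbTE ij).
have trE : (givens i j c s)^T = givens i j c (- s).
  apply/matrixP => x y; rewrite !mxE opprK.
  have [xE|xi] := eqVneq x i; [subst x|have [xE|xj] := eqVneq x j; [subst x|]];
  (have [yE|yi] := eqVneq y i; [subst y|have [yE|yj] := eqVneq y j; [subst y|]]);
    rewrite ?eqxx ?(negbTE ij) ?ji //=; try ring.
  - by rewrite eq_sym (negbTE xi) !mulr0 addr0.
  - by rewrite eq_sym (negbTE xj) !mulr0 addr0.
  - by rewrite eq_sym.
rewrite /orthogonal_mx trE; apply/matrixP => a b; rewrite mulmx_givens !mxE !eqxx ji.
have [->|bi] := eqVneq b i.
  transitivity ((c ^+ 2 + s ^+ 2) * (a == i)%:R); last by rewrite cs mul1r.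
  by ring.
have [->|bj] := eqVneq b j.
  transitivity ((c ^+ 2 + s ^+ 2) * (a == j)%:R); last by rewrite cs mul1r.
  by ring.
by [].
Qed.

Definition fam_mx l (x : fam R ('I_l * 'I_N)%type) : 'M[R]_(l, N) := \matrix_(a, b) x (a, b).

Lemma iid_normal_mul l (X : T -> fam R ('I_l * 'I_N)%type) Q :
  givens_prod Q -> iid_normal P X ->
  iid_normal P (fun w => (fun p => (fam_mx (X w) *m Q) p.1 p.2) : fam R ('I_l * 'I_N)%type).
Proof.
move=> gQ; elim: gQ X => [|{}Q i j c s ij cs c1 _ IH] X iidX.
  congr (iid_normal P _): iidX; apply/funext => w; apply/funext => -[a b].
  by rewrite mulmx1 mxE.
have {}iidX := IH _ iidX.
pose Y w : fam R ('I_l * 'I_N)%type := fun p => (fam_mx (X w) *m Q) p.1 p.2.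
(* The matrix rotates every row at once, whereas [rotate2] acts on one row; [r] lists the rows
   already rotated. *)
have rows (r : seq 'I_l) : uniq r -> iid_normal P (fun w =>
    (fun p => if p.1 \in r then (fam_mx (Y w) *m givens i j c s) p.1 p.2 else Y w p)
    : fam R ('I_l * 'I_N)%type).
  elim: r => [_|k r IHr /= /andP[kr ur]] //.
  have kij : (k, i) != (k, j) by rewrite xpair_eqE eqxx.
  have := iid_normal_rotate2 kij cs c1 (IHr ur).
  congr (iid_normal P _); apply/funext => w; apply/funext => -[a b].
  rewrite /rotate2 !xpair_eqE /= inE (negbTE kr).
  have [->|ak] := eqVneq a k; last by [].
  by rewrite /= mulmx_givens !mxE (negbTE kr).
have := rows (enum 'I_l) (enum_uniq _); congr (iid_normal P _).
apply/funext => w; apply/funext => -[a b] /=; rewrite mem_enum inE mulmxA.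
by congr (_ _ _); congr (_ *m _); apply/matrixP => x y; rewrite mxE.
Qed.

End iid_normal_rotation.

(** * Conjugating projections to a diagonal form *)

Section projection_normal_form.
Variables (R : realType) (N : nat).

Lemma givens_prod_orthogonal (Q : 'M[R]_N) : givens_prod Q -> orthogonal_mx Q.
Proof.
elim=> [|{}Q i j c s ij cs _ _ QQ]; first by rewrite /orthogonal_mx trmx1 mulmx1.
have GG := givens_orthogonal ij cs; rewrite /orthogonal_mx trmx_mul mulmxA.
by rewrite -(mulmxA Q) GG mulmx1.
Qed.

Lemma givens_kill (u : 'rV[R]_N) (i j : 'I_N) : i != j ->
  exists c s, [/\ c ^+ 2 + s ^+ 2 = 1, c != -1 & (u *m givens i j c s) 0 j = 0].
Proof.
move=> ij; have [uj0|uj0] := eqVneq (u 0 j) 0.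
  exists 1, 0; split; first by rewrite expr1n expr0n addr0.
    by rewrite -subr_eq0 opprK; apply/eqP; lra.
  by rewrite mulmx_givens eq_sym (negbTE ij) eqxx uj0 oppr0 mul0r mulr0 addr0.
pose r2 := u 0 i ^+ 2 + u 0 j ^+ 2; pose r := Num.sqrt r2.
have uj2 : 0 < u 0 j ^+ 2 by rewrite exprn_even_gt0.
have r20 : 0 < r2 by rewrite /r2 ltr_wpDl// sqr_ge0.
have r0 : 0 < r by rewrite sqrtr_gt0.
have rr : r ^+ 2 = r2 by rewrite sqr_sqrtr// ltW.
exists (u 0 i / r), (u 0 j / r); split.
- by rewrite !expr_div_n -mulrDl rr divff// gt_eqF.
(* The square of [c] is less than 1 because [u 0 j] is nonzero. *)
- apply/eqP => /(congr1 (fun x => x ^+ 2)); rewrite expr_div_n sqrrN expr1n rr.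
  move=> /(congr1 (fun x => x * r2)); rewrite divfK ?gt_eqF// mul1r /r2.
  by move: uj2; lra.
- rewrite mulmx_givens eq_sym (negbTE ij) eqxx; field.
  by rewrite gt_eqF.
Qed.

(** The last clause protects the coordinates already dealt with: vectors vanishing at [i] and on
    [js] are fixed. *)
Lemma givens_reduce (u : 'rV[R]_N) (i : 'I_N) (js : seq 'I_N) : i \notin js -> uniq js ->
  exists Q, [/\ givens_prod Q, forall j, j \in js -> (u *m Q) 0 j = 0,
    forall j, j != i -> j \notin js -> (u *m Q) 0 j = u 0 j &
    forall v : 'rV[R]_N, v 0 i = 0 -> (forall j, j \in js -> v 0 j = 0) -> v *m Q = v].
Proof.
elim: js => [_ _|j js IH].
  exists 1%:M; split => //; first exact: givens_prod1.
    by move=> j _ _; rewrite mulmx1.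
  by move=> v _ _; rewrite mulmx1.
rewrite inE negb_or => /andP[ij ijs] /= /andP[jjs ujs].
have [Q [gQ Q0 Qid Qv]] := IH ijs ujs.
have [c [s [cs c1 G0]]] := givens_kill (u *m Q) ij.
have ji : (j == i) = false by rewrite eq_sym (negbTE ij).
exists (Q *m givens i j c s); split.
- exact: givens_prodS.
- move=> k; rewrite inE mulmxA => /orP[/eqP->//|kjs].
  rewrite mulmx_givens; have [ki|ki] := eqVneq k i; first by rewrite ki (negbTE ijs) in kjs.
  have [kj|_] := eqVneq k j; first by rewrite kj (negbTE jjs) in kjs.
  exact: Q0.
- move=> k ki; rewrite inE negb_or => /andP[kj kjs].
  by rewrite mulmxA mulmx_givens (negbTE ki) (negbTE kj) Qid.
- move=> v vi vjs; rewrite mulmxA Qv//; last first.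
    by move=> k kjs; apply: vjs; rewrite inE kjs orbT.
  apply/rowP => k; rewrite mulmx_givens.
  have vj : v 0 j = 0 by apply: vjs; rewrite inE eqxx.
  have [->|ki] := eqVneq k i; first by rewrite vi vj !mulr0 addr0.
  by have [->|kj] := eqVneq k j; rewrite // vi vj !mulr0 addr0.
Qed.

(** This is transitivity on the Grassmannian. The induction keeps the first [i] rows equal to unit
    vectors and rotates a further fixed vector of [z] onto the next axis. *)
Lemma projection_diagonalize (y : 'M[R]_N) : y^T = y -> y *m y = y ->
  exists2 Q, givens_prod Q & Q^T *m y *m Q = pid_mx (\rank y).
Proof.
suff H k (z : 'M[R]_N) i : (i + k = N)%N -> z^T = z -> z *m z = z ->
    (forall t : 'I_N, (t < i)%N -> row t z = delta_mx 0 t) ->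
    exists Q e, [/\ givens_prod Q, (e <= N)%N & Q^T *m z *m Q = pid_mx e].
  move=> yT yy; have [//|Q [e [gQ eN E]]] := H N y 0%N (add0n _) yT yy.
  exists Q => //; rewrite E; congr pid_mx.
  have Qu : Q \in unitmx.
    by have /mulmx1_unit[] := givens_prod_orthogonal gQ.
  have := congr1 (@mxrank _ _ _) E; rewrite rank_pid_mx// => <-.
  rewrite mxrankMfree ?row_free_unit//.
  by rewrite -mxrank_tr trmx_mul trmxK mxrankMfree ?row_free_unit// mxrank_tr.
elim: k z i => [|k IH] z i ik zT zz zrow.
  exists 1%:M, N; split => //; first exact: givens_prod1.
  rewrite trmx1 mul1mx mulmx1 pid_mx_1; apply/row_matrixP => t.
  by rewrite zrow -?rowE ?row1//; move: (ltn_ord t) ik; lia.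
have [zpid|zpid] := eqVneq z (pid_mx i).
  exists 1%:M, i; split; [exact: givens_prod1|by lia|].
  by rewrite trmx1 mul1mx mulmx1.
have iN : (i < N)%N by lia.
pose oi := Ordinal iN.
(* Such a row has index at least [i] and is nonzero; by symmetry of [z] it vanishes at the first [i]
   places, and by idempotence it is fixed by [z]. *)
have [r rz] : exists r, row r z != row r (pid_mx i).
  apply/existsP; apply: contraT => /existsPn H; move/eqP: zpid; case.
  by apply/row_matrixP => r; apply/eqP/negPn/H.
have rowpid (t : 'I_N) : (t < i)%N -> row t (pid_mx i) = delta_mx 0 t :> 'rV[R]_N.
  move=> ti; apply/rowP => b; rewrite !mxE ti andbT eq_sym.
  by congr (_%:R); apply/idP/idP.
have ri : (i <= r)%N.
  by rewrite leqNgt; apply: contra rz => ri; rewrite zrow// rowpid.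
have u0 : row r z != 0.
  apply: contra rz => /eqP->; apply/eqP/rowP => b; rewrite !mxE.
  by rewrite [(r < i)%N]ltnNge ri andbF.
pose u := row r z.
have ulow (t : 'I_N) : (t < i)%N -> u 0 t = 0.
  move=> ti; rewrite mxE -zT mxE; have /rowP/(_ r) := zrow t ti.
  rewrite !mxE eqxx /= => ->; case: eqP => // rt.
  by move: ri; rewrite rt leqNgt ti.
have uz : u *m z = u by rewrite /u -row_mul zz.
pose js := [seq j : 'I_N <- enum 'I_N | (i < j)%N].
have oijs : oi \notin js by rewrite mem_filter ltnn.
have [Q [gQ Q0 Qid Qv]] := givens_reduce u oijs (filter_uniq _ (enum_uniq _)).
have QQ := givens_prod_orthogonal gQ.
have uQ : u *m Q = ((u *m Q) 0 oi) *: delta_mx 0 oi.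
  apply/rowP => t; rewrite [RHS]mxE [delta_mx _ _ _ _]mxE eqxx /=.
  have [->|toi] := eqVneq t oi; first by rewrite mulr1.
  rewrite mulr0; have [ti|ti|ti] := ltngtP t i.
  - by rewrite Qid// ?ulow// mem_filter negb_and -leqNgt ltnW.
  - by apply: Q0; rewrite mem_filter ti mem_enum.
  - by move: toi; rewrite -val_eqE /= ti eqxx.
set al := (u *m Q) 0 oi in uQ.
have al0 : al != 0.
  apply: contraNneq u0 => al0; move: uQ; rewrite al0 scale0r => uQ0.
  by rewrite -/u -[u]mulmx1 -QQ mulmxA uQ0 mul0mx.
pose z' := Q^T *m z *m Q.
have eQ (t : 'I_N) : (t < i)%N -> delta_mx 0 t *m Q = delta_mx 0 t :> 'rV[R]_N.
  move=> ti; apply: Qv => [|j]; rewrite !mxE eqxx /=.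
    by case: eqP => // /(congr1 val) /= toi; move: ti; rewrite -toi ltnn.
  rewrite mem_filter => /andP[ij _]; case: eqP => // jt.
  by move: ij; rewrite jt ltnNge ltnW.
have [] := IH z' i.+1.
- by lia.
- by rewrite /z' !trmx_mul trmxK zT mulmxA.
- by rewrite /z' !mulmxA -(mulmxA _ Q) QQ mulmx1 -[_ *m z *m z]mulmxA zz.
- move=> t; rewrite ltnS leq_eqVlt => /orP[/eqP ti|ti].
    have -> : t = oi by apply: val_inj.
    apply: (scalerI al0); rewrite rowE scalemxAl -uQ /z' !mulmxA.
    by rewrite -(mulmxA u) QQ mulmx1 uz uQ.
  have eQT : delta_mx 0 t *m Q^T = delta_mx 0 t :> 'rV[R]_N.
    by rewrite -{1}(eQ t ti) -mulmxA QQ mulmx1.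
  by rewrite rowE /z' !mulmxA eQT -rowE zrow// eQ.
move=> Q' [e [gQ' eN E]]; exists (Q *m Q'), e; split => //.
  exact: givens_prodM.
by rewrite trmx_mul -E /z' !mulmxA.
Qed.

End projection_normal_form.

Lemma continuous_sumr (R : realType) (X : topologicalType) (I : finType) (F : I -> X -> R) :
  (forall i, continuous (F i)) -> continuous (fun x => \sum_i F i x).
Proof. by move=> cF; apply: continuous_big => //; exact: add_continuous. Qed.

(** The F-sigma sets. Existential conditions over a finite-dimensional parameter space lead to such
    sets rather than to closed ones. *)
Definition sigma_closed (T : topologicalType) : set (set T) :=
  [set S | exists2 F : nat -> set T, (forall k, closed (F k)) & S = \bigcup_k F k].

(** * Homogeneous laws on matrices *)

Section random_matrices.
Context (R : realType) d (T : measurableType d) (P : probability T R).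

Section measurable_preimages.
Variables (p q : nat) (f : T -> 'M[R]_(p, q)).
Hypothesis mf : forall i j, measurable_fun setT (fun w => f w i j).

Let measurable_ball_preimage (x : 'M[R]_(p, q)) e : 0 < e -> measurable (f @^-1` ball x e).
Proof.
move=> e0.
have -> : f @^-1` ball x e = \bigcap_(ij in [set: 'I_p * 'I_q])
    ((fun w => f w ij.1 ij.2) @^-1` `]x ij.1 ij.2 - e, x ij.1 ij.2 + e[%classic).
  apply/seteqP; split => w /=.
    move=> [_ H] [i j] _ /=; have := H i j.
    by rewrite /ball /= ltr_distlC in_itv.
  move=> H; split=> // i j; have := H (i, j) I.
  by rewrite /= in_itv /= /ball /= ltr_distlC.
apply: fin_bigcap_measurable => [|ij _]; first exact: finite_finset.
by rewrite -[_ @^-1` _]setTI; apply: mf.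
Qed.

(** An open set is a countable union of balls with rational centre and radius 1/(k + 1). *)
Lemma measurable_open_preimage (O : set 'M[R]_(p, q)) : open O -> measurable (f @^-1` O).
Proof.
move=> oO.
pose F (qe : 'M[rat]_(p, q) * nat) : set 'M[R]_(p, q) :=
  if `[< ball (map_mx ratr qe.1 : 'M[R]_(p, q)) (qe.2.+1%:R^-1) `<=` O >]
  then ball (map_mx ratr qe.1 : 'M[R]_(p, q)) (qe.2.+1%:R^-1) else set0.
have -> : O = \bigcup_(qe in [set: 'M[rat]_(p, q) * nat]) F qe.
  apply/seteqP; split => x; last first.
    by move=> [qe _]; rewrite /F; case: asboolP => // + ?; exact.
  move=> Ox; have /nbhs_ballP[e /= e0 xeO] : nbhs x O by exact: open_nbhs_nbhs.
  have [k ke] : exists k : nat, k.+1%:R^-1 < e / 2.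
    have e20 : 0 < e / 2 by rewrite divr_gt0.
    exists (Num.truncn (e / 2)^-1); rewrite invf_plt ?posrE//.
    exact: truncnS_gt.
  have k0 : 0 < (k.+1%:R^-1 : R) by rewrite invr_gt0.
  have /choice[r rE] : forall ij : 'I_p * 'I_q, exists r : rat,
      `|ratr r - x ij.1 ij.2| < k.+1%:R^-1.
    move=> ij; have /rat_in_itvoo[r] :
      x ij.1 ij.2 - k.+1%:R^-1 < x ij.1 ij.2 + k.+1%:R^-1.
      by rewrite ltrBlDr -addrA ltrDl addr_gt0.
    by rewrite in_itv /= => rE; exists r; rewrite ltr_distl.
  pose Q : 'M[rat]_(p, q) := \matrix_(i, j) r (i, j).
  have Qx : ball (map_mx ratr Q : 'M[R]_(p, q)) k.+1%:R^-1 x.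
    by split=> // i j; rewrite !mxE; exact: (rE (i, j)).
  exists (Q, k) => //; rewrite /F; case: asboolP => // H; exfalso; apply: H => y Qy.
  apply: xeO; rewrite (splitr e).
  apply: (@ball_triangle _ _ (map_mx ratr Q : 'M[R]_(p, q))).
    by apply: ball_sym; exact: le_ball (ltW ke) _ Qx.
  exact: le_ball (ltW ke) _ Qy.
rewrite preimage_bigcup; apply: countable_bigcupT_measurable; first exact: countableP.
move=> [Q k]; rewrite /F; case: ifP => _; last by rewrite preimage_set0.
by apply: measurable_ball_preimage; rewrite invr_gt0.
Qed.

Lemma measurable_closed_preimage (C : set 'M[R]_(p, q)) : closed C -> measurable (f @^-1` C).
Proof.
move=> /closed_openC oC; rewrite -[f @^-1` C]setCK preimage_setC.
by apply: measurableC; exact: measurable_open_preimage.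
Qed.

End measurable_preimages.

Variable N : nat.

(** Squared Frobenius distance, invariant under orthogonal conjugation. Being a square, it satisfies
    the triangle inequality up to the factor 2. *)
Definition dist2 (x y : 'M[R]_N) : R := \sum_a \sum_b (x a b - y a b) ^+ 2.

Lemma dist2C x y : dist2 x y = dist2 y x.
Proof. by apply: eq_bigr => a _; apply: eq_bigr => b _; rewrite -sqrrN opprB. Qed.

Lemma dist2_triangle (x y z : 'M[R]_N) : dist2 x z <= 2 * (dist2 x y + dist2 y z).
Proof.
rewrite -big_split mulr_sumr; apply: ler_sum => a _.
rewrite -big_split mulr_sumr; apply: ler_sum => b _ /=.
rewrite -subr_ge0.
have -> : 2 * ((x a b - y a b) ^+ 2 + (y a b - z a b) ^+ 2) - (x a b - z a b) ^+ 2 =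
  (x a b - y a b - (y a b - z a b)) ^+ 2 by ring.
exact: sqr_ge0.
Qed.

Lemma dist2_entry (x y : 'M[R]_N) a b : (x a b - y a b) ^+ 2 <= dist2 x y.
Proof.
rewrite /dist2 (bigD1 a)//= (bigD1 b)//= -addrA lerDl addr_ge0//.
  by apply: sumr_ge0 => j _; rewrite sqr_ge0.
by apply: sumr_ge0 => i _; apply: sumr_ge0 => j _; rewrite sqr_ge0.
Qed.

Lemma dist2_orthogonal Q x y : orthogonal_mx Q ->
  dist2 (Q^T *m x *m Q) (Q^T *m y *m Q) = dist2 x y.
Proof.
move=> QQ.
have trE (u v : 'M[R]_N) : dist2 u v = \tr ((u - v) *m (u - v)^T).
  apply: eq_bigr => a _; rewrite mxE; apply: eq_bigr => b _.
  by rewrite !mxE expr2.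
rewrite !trE -mulmxBl -mulmxBr; move: (x - y) => u.
rewrite !trmx_mul trmxK !mulmxA -(mulmxA _ Q) QQ mulmx1.
by rewrite mxtrace_mulC !mulmxA QQ mul1mx.
Qed.

Section uniqueness.
Variable G : set 'M[R]_N.

Definition ball_homogeneous (L : T -> 'M[R]_N) : Prop :=
  [/\ forall w, G (L w), forall a b, measurable_fun setT (fun w => L w a b) &
    forall e y y', G y -> G y' ->
      P [set w | dist2 (L w) y < e] = P [set w | dist2 (L w) y' < e]].

Lemma measurable_dist2 d' (T' : measurableType d') (f g : T' -> 'M[R]_N) (e : R) :
  (forall a b, measurable_fun setT (fun w => f w a b)) ->
  (forall a b, measurable_fun setT (fun w => g w a b)) ->
  measurable [set w | dist2 (f w) (g w) < e].
Proof.
move=> mf mg.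
have mD : measurable_fun setT (fun w => dist2 (f w) (g w)).
  apply: measurable_sum => a; apply: measurable_sum => b.
  by apply: measurable_funX; exact: measurable_funB.
have := measurable_fun_ltr mD (@measurable_cst _ _ _ _ setT e).
move=> /(_ measurableT [set true] I); rewrite setTI.
by congr measurable; apply/seteqP; split => w /=.
Qed.

Let measurable_dist2_cst (f : T -> 'M[R]_N) y (e : R) :
  (forall a b, measurable_fun setT (fun w => f w a b)) ->
  measurable [set w | dist2 (f w) y < e].
Proof. by move=> mf; apply: (@measurable_dist2 _ _ f (fun=> y)). Qed.

(** By homogeneity one null ball makes all balls of its radius centred in [G] null, and smaller
    balls around rational matrices form a countable cover. *)
Let ball_pos L e y : ball_homogeneous L -> 0 < e -> G y ->
  P [set w | dist2 (L w) y < e] != 0%E.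
Proof.
move=> [GL mL homL] e0 Gy; apply/eqP => P0.
pose F (q : 'M[rat]_N) : set T := [set w | dist2 (L w) (map_mx ratr q) < e / 4].
have mF q : measurable (F q) by exact: measurable_dist2_cst.
have PF q : P (F q) = 0%E.
  have [[w0 Fw0]|noF] := pselect (exists w, F q w); last first.
    by rewrite (_ : F q = set0) ?measure0//; apply/seteqP; split => // w Fw; apply: noF; exists w.
  (* A rational centre need not lie in [G], so the ball is moved to the point [L w0] of [G]: 2 (e/4
     + e/4) = e. *)
  apply/eqP; rewrite eq_le measure_ge0 andbT -P0 (homL e y (L w0))//.
  apply: le_measure; rewrite ?inE//; first exact: measurable_dist2_cst.
  move=> w Fw; rewrite /=; have := dist2_triangle (L w) (map_mx ratr q) (L w0).
  move: Fw Fw0; rewrite /F /= [dist2 (L w0) _]dist2C; lra.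
have cov : \bigcup_(q in [set: 'M[rat]_N]) F q = setT.
  apply/seteqP; split => // w _.
  (* The minimum with 1 makes the square of [e1] at most [e1]; [N.+1] keeps the denominator positive
     and the sum of N^2 terms strictly below e/4. *)
  pose e1 : R := Num.min 1 (e / (4 * (N.+1 * N.+1)%:R)).
  have e10 : 0 < e1 by rewrite /e1 lt_min ltr01 divr_gt0// mulr_gt0// ltr0n.
  have e1e : e1 ^+ 2 <= e / (4 * (N.+1 * N.+1)%:R).
    apply: (@le_trans _ _ e1); last by rewrite /e1 ge_min lexx orbT.
    by rewrite expr2 ler_piMr ?(ltW e10)// /e1 ge_min lexx.
  have /choice[r rE] : forall ij : 'I_N * 'I_N, exists r : rat,
      `|ratr r - L w ij.1 ij.2| < e1.
    move=> ij; have /rat_in_itvoo[r] :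
      L w ij.1 ij.2 - e1 < L w ij.1 ij.2 + e1 by lra.
    by rewrite in_itv /= => rE; exists r; rewrite ltr_distl.
  exists (\matrix_(i, j) r (i, j)) => //; rewrite /F /=.
  apply: (@le_lt_trans _ _ (\sum_(a < N) \sum_(b < N) e / (4 * (N.+1 * N.+1)%:R))).
    apply: ler_sum => a _; apply: ler_sum => b _.
    apply: le_trans e1e; rewrite !mxE -sqrrN opprB -real_normK ?num_real//.
    by rewrite ler_sqr ?nnegrE ?(ltW e10)//; apply: ltW; exact: (rE (a, b)).
  rewrite !sumr_const !card_ord -mulrnA -[_ *+ _]mulr_natr -mulrA.
  rewrite ltr_pM2l//.
  have NN : (N * N)%:R < (N.+1 * N.+1)%:R :> R by rewrite ltr_nat; nia.
  have N0 : 0 < (N.+1 * N.+1)%:R :> R by rewrite ltr0n.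
  by rewrite invfM -mulrA gtr_pMr ?invr_gt0// mulrC ltr_pdivrMr// mul1r.
have cov' : \bigcup_n (oapp F set0 (unpickle n)) = setT.
  apply/seteqP; split => // w _; have [q _ Fq] : (\bigcup_q F q) w by rewrite cov.
  by exists (pickle q) => //; rewrite pickleK.
have : P.-negligible [set: T].
  rewrite -cov'; apply: negligible_bigcup => k; case: unpickle => [q|] /=.
    by exists (F q); split.
  exact: negligible_set0.
move=> /(negligibleP _ measurableT) PT0.
have /eqP := @probability_setT _ _ _ P.
by rewrite [X in X == _](_ : _ = 0%E)// eq_sym onee_eq0.
Qed.

(** [E] is the set of pairs that are [e]-close. By homogeneity its sections are balls of constant
    mass, so the part over [A] has mass k2 P(A) and the part over [B], on the other side, k1 P(B).
    Taking the whole space on both sides gives k1 = k2. *)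
Let dist2_kernel L1 L2 (e : R) (A B : set T) : ball_homogeneous L1 -> ball_homogeneous L2 ->
  0 < e -> measurable A -> measurable B ->
  (forall w w', A w -> dist2 (L1 w) (L2 w') < e -> B w') -> (P A <= P B)%E.
Proof.
move=> hL1 hL2 e0 mA mB AB; have [G1 m1 c1] := hL1; have [G2 m2 c2] := hL2.
have [w0 _] : [set: T] !=set0.
  apply/set0P/eqP => T0; have := @probability_setT _ _ _ P.
  by rewrite T0 measure0 => /esym/eqP; rewrite onee_eq0.
pose E : set (T * T) := [set z | dist2 (L1 z.1) (L2 z.2) < e].
have mE : measurable E.
  apply: (@measurable_dist2 _ _ (fun z => L1 z.1) (fun z => L2 z.2)) => a b.
    by apply: (measurableT_comp (m1 a b)); exact: measurable_fst.
  by apply: (measurableT_comp (m2 a b)); exact: measurable_snd.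
pose k1 := P [set w | dist2 (L1 w) (L2 w0) < e].
pose k2 := P [set w | dist2 (L2 w) (L1 w0) < e].
have E1 C : measurable C -> (P \x P)%E (E `&` C `*` setT) = (k2 * P C)%E.
  move=> mC; rewrite -(integral_cst P mC).
  rewrite integral_mkcond /= /product_measure1; apply: eq_integral => w _.
  rewrite patchE; case: ifPn => [/set_mem Cw|/negP Cw].
    rewrite /k2 (c2 e (L1 w0) (L1 w))//; congr (P _); apply/seteqP.
    by split=> w'; rewrite /xsection /= inE dist2C; [case|move=> ?; split].
  transitivity (P set0); last by rewrite measure0.
  congr (P _); apply/seteqP; split=> // w'.
  by rewrite /xsection /= inE => -[_ [Cw' _]]; apply: Cw; exact: mem_set.
have E2 C : measurable C -> (P \x P)%E (E `&` setT `*` C) = (k1 * P C)%E.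
  move=> mC; rewrite -(integral_cst P mC).
  rewrite (@product_measure_unique _ _ _ _ _ P P (P \x^ P)%E); last 2 first.
  - by move=> A1 A2 mA1 mA2; exact: product_measure2E.
  - by apply: measurableI => //; exact: measurableX.
  rewrite integral_mkcond /= /product_measure2; apply: eq_integral => w _.
  rewrite patchE; case: ifPn => [/set_mem Cw|/negP Cw].
    rewrite /k1 (c1 e (L2 w0) (L2 w))//; congr (P _); apply/seteqP.
    by split=> w'; rewrite /ysection /= inE; [case|move=> ?; split].
  transitivity (P set0); last by rewrite measure0.
  congr (P _); apply/seteqP; split=> // w'.
  by rewrite /ysection /= inE => -[_ [_ Cw']]; apply: Cw; exact: mem_set.
have k12 : k2 = k1.
  by have := E1 _ measurableT; rewrite E2// probability_setT !mule1.
have k10 : (0 < k1)%E by rewrite lt0e measure_ge0 andbT; apply: ball_pos.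
have k1f : k1 \is a fin_num.
  by apply: fin_num_measure; apply: measurable_dist2_cst.
rewrite -(@lee_pmul2l _ k1)// -{1}k12 -E1// -E2//.
apply: le_measure; rewrite ?inE.
- by apply: measurableI => //; apply: measurableX.
- by apply: measurableI => //; apply: measurableX.
- by move=> [w w'] /= [Eww [Aw _]]; split => //; split => //=; exact: AB Eww.
Qed.

Let thick (K : set 'M[R]_N) (e : R) : set 'M[R]_N := [set z | exists2 y, K y & dist2 y z < e].

Let open_thick K e : open (thick K e).
Proof.
rewrite (_ : thick K e = \bigcup_(y in K) (dist2 y @^-1` [set x | x < e])).
  apply: bigcup_open => y _; apply: open_comp; last exact: open_lt.
  move=> z _; apply: continuous_sumr => a x; apply: continuous_sumr => b {}x.
  have cb : {for x, continuous (fun z : 'M[R]_N => y a b - z a b)}.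
    by apply: continuousB; [exact: cst_continuous|exact: coord_continuous].
  apply: (@continuous_comp _ _ _ (fun z : 'M[R]_N => y a b - z a b) (fun u : R => u ^+ 2) x cb).
  exact: exprn_continuous.
apply/seteqP; split => z /=; first by move=> [y Ky yz]; exists y.
by move=> [y Ky yz]; exists y.
Qed.

(** A closed set is the intersection of its thickenings, so continuity from above applies. *)
Let closed_le L1 L2 (K : set 'M[R]_N) : ball_homogeneous L1 -> ball_homogeneous L2 ->
  closed K -> (P (L1 @^-1` K) <= P (L2 @^-1` K))%E.
Proof.
move=> hL1 hL2 cK; have [_ m1 _] := hL1; have [_ m2 _] := hL2.
pose D (k : nat) := L2 @^-1` thick K k.+1%:R^-1.
have mD k : measurable (D k) by apply: measurable_open_preimage => //; exact: open_thick.
have DK : L2 @^-1` K = \bigcap_k D k.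
  rewrite -preimage_bigcap; congr (_ @^-1` _); apply/seteqP; split => z Kz.
    move=> k _; exists z => //; rewrite /dist2 big1 ?invr_gt0// => a _.
    by rewrite big1// => b _; rewrite subrr expr0n.
  apply: contrapT => nKz.
  have /nbhs_ballP[e /= e0 zeK] : nbhs z (~` K).
    by apply: open_nbhs_nbhs; split => //; exact: closed_openC.
  have e20 : 0 < e ^+ 2 by rewrite exprn_gt0.
  have [y Ky yz] := Kz (Num.truncn (e ^+ 2)^-1) I.
  apply: (zeK y) Ky; split=> // a b; rewrite /ball /= distrC.
  rewrite -ltr_sqr ?nnegrE ?(ltW e0)// real_normK ?num_real//.
  apply: (le_lt_trans (dist2_entry y z a b)); apply: lt_trans yz _.
  by rewrite invf_plt ?posrE//; exact: truncnS_gt.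
have ndD : nonincreasing_seq D.
  apply/nonincreasing_seqP => k; apply/subsetPset => w [y Ky yz]; exists y => //.
  by apply: lt_le_trans yz _; rewrite lef_pV2 ?posrE// ler_nat.
have mK1 := measurable_closed_preimage m1 cK.
rewrite DK; have cvgD : P (D k) @[k --> \oo] --> P (\bigcap_k D k).
  apply: nonincreasing_cvg_mu => //; last exact: bigcapT_measurable.
  by rewrite (le_lt_trans (probability_le1 P (mD 0%N))) ?ltry.
rewrite -(cvg_lim _ cvgD)//; apply: lime_ge; first by apply/cvg_ex; eexists; exact: cvgD.
apply: nearW => k; apply: (@dist2_kernel _ _ k.+1%:R^-1 _ _ hL1 hL2 _ mK1 (mD k)).
  by rewrite invr_gt0 ltr0n.
by move=> w w' Kw ww'; exists (L1 w).
Qed.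

(* The smoothed kernel [1 (|x - y|^2 < e)] on pairs has constant marginals for both laws, which
   compares the mass of a closed set under one law with that of its [e]-neighbourhood under the
   other. *)
Lemma ball_homogeneous_unique L1 L2 S : ball_homogeneous L1 -> ball_homogeneous L2 ->
  sigma_closed S -> P (L1 @^-1` S) = P (L2 @^-1` S).
Proof.
move=> hL1 hL2 [F cF ->]; have [_ m1 _] := hL1; have [_ m2 _] := hL2.
rewrite -bigcup_bigsetU_bigcup.
have cF' k : closed (\big[setU/set0]_(i < k.+1) F i) by exact: closed_bigsetU.
have cvgF (L : T -> 'M[R]_N) : (forall a b, measurable_fun setT (fun w => L w a b)) ->
    P (L @^-1` (\big[setU/set0]_(i < k.+1) F i)) @[k --> \oo] -->
    P (L @^-1` (\bigcup_k \big[setU/set0]_(i < k.+1) F i)).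
  move=> mL; rewrite preimage_bigcup.
  apply: (@nondecreasing_cvg_mu _ _ _ P (fun k => L @^-1` (\big[setU/set0]_(i < k.+1) F i))).
  - by move=> k; exact: measurable_closed_preimage.
  - by apply: bigcupT_measurable => k; exact: measurable_closed_preimage.
  - apply/nondecreasing_seqP => k; apply/subsetPset; apply: preimage_subset.
    by rewrite [X in _ `<=` X]big_ord_recr /=; exact: subsetUl.
apply: cvg_unique (cvgF _ m1) _ => //.
rewrite (_ : (fun k => _) = fun k => P (L2 @^-1` (\big[setU/set0]_(i < k.+1) F i))).
  exact: cvgF.
by apply/funext => k; apply/eqP; rewrite eq_le !closed_le.
Qed.

End uniqueness.
End random_matrices.

(** * Existential conditions as countable unions of closed sets *)

Section sigma_closed_sets.
Variable R : realType.

Section image.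
Variables (d p q : nat) (g : 'rV[R]_d -> 'M[R]_(p, q)) (h1 h2 : 'rV[R]_d -> R).
Hypotheses (cg : forall i j, continuous (fun z => g z i j)).
Hypotheses (ch1 : continuous h1) (ch2 : continuous h2).

Lemma continuous_mx : continuous g.
Proof.
move=> z U /nbhs_ballP[e /= e0 eU]; have FF : Filter (nbhs z) by exact: nbhs_filter.
have H : \forall t \near nbhs z, forall ij : 'I_p * 'I_q, ball (g z ij.1 ij.2) e (g t ij.1 ij.2).
  by apply: filter_forall => ij; have /cvg_ballP := cg (i := ij.1) (j := ij.2) (x := z); apply.
by apply: filterS H => t H; apply: eU; split=> // i j; exact: (H (i, j)).
Qed.

(** The parameter set is exhausted by the compact pieces where |z i| <= k, h1 z = 0 and |h2 z| >=
    1/(k + 1); their images are compact. *)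
Lemma sigma_closed_image : sigma_closed [set y | exists z, [/\ h1 z = 0, h2 z != 0 & y = g z]].
Proof.
pose K (k : nat) := [set z : 'rV[R]_d | forall i, `[- k%:R, k%:R]%classic (z 0 i)].
pose C (k : nat) := (h1 @^-1` [set 0]) `&` ((fun z => `|h2 z|) @^-1` [set x | k.+1%:R^-1 <= x]).
exists (fun k => g @` (K k `&` C k)) => [k|].
  apply: compact_closed; first exact: norm_hausdorff.
  apply: continuous_compact; first by apply: continuous_subspaceT; exact: continuous_mx.
  apply: compact_closedI; first by apply: (@rV_compact R d (fun=> `[- k%:R, k%:R]%classic)) => i;
    exact: segment_compact.
  apply: closedI; apply: closed_comp; [|exact: closed_eq| |exact: closed_ge].
    by move=> z _; exact: ch1.
  move=> z _; apply: (@continuous_comp _ _ _ h2 Num.norm); first exact: ch2.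
  exact: norm_continuous.
apply/seteqP; split => y.
  move=> [z [h1z h2z yE]]; have h20 : 0 < `|h2 z| by rewrite normr_gt0.
  pose k := (\sum_i (Num.truncn (`|z 0 i|)%R).+1 + Num.truncn (`|h2 z|^-1)%R)%N.
  exists k => //; exists z => //; split.
    move=> i; rewrite /= in_itv /= -ler_norml; apply/ltW.
    apply: (@lt_le_trans _ _ (Num.truncn `|z 0 i|).+1%:R); first exact: truncnS_gt.
    by rewrite ler_nat /k (bigD1 i)//= -addnA leq_addr.
  split=> //=; rewrite invf_ple ?posrE//; apply/ltW.
  apply: (@lt_le_trans _ _ (Num.truncn `|h2 z|^-1).+1%:R); first exact: truncnS_gt.
  by rewrite ler_nat ltnS leq_addl.
move=> [k _ [z [_ [h1z h2z]] <-]]; exists z; split => //.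
by rewrite -normr_gt0; apply: lt_le_trans h2z; rewrite invr_gt0.
Qed.

End image.

Let continuous_prodr (X : topologicalType) (I : finType) (Q : pred I) (F : I -> X -> R) :
  (forall i, continuous (F i)) -> continuous (fun x => \prod_(i | Q i) F i x).
Proof. by move=> cF; apply: continuous_big => //; exact: mul_continuous. Qed.

Let continuous_mulr (X : topologicalType) (f g : X -> R) :
  continuous f -> continuous g -> continuous (fun x => f x * g x).
Proof. by move=> cf cg x; apply: continuousM; [exact: cf|exact: cg]. Qed.

Let continuous_subr (X : topologicalType) (f g : X -> R) :
  continuous f -> continuous g -> continuous (fun x => f x - g x).
Proof. by move=> cf cg x; apply: continuousB; [exact: cf|exact: cg]. Qed.

(** A polynomial image of the parameter space; this is what makes the rank event measurable. *)
Lemma sigma_closed_tensor_rank_le l m n r :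
  sigma_closed [set A : 'M[R]_(l, m * n) |
    exists2 T : tensor R m n l, tensor_rank_le T r & A = tensor_mx T].
Proof.
pose J : finType := (('I_r * 'I_m) + ('I_r * 'I_n) + ('I_r * 'I_l))%type.
pose x (z : 'rV[R]_#|J|) (j : J) := z 0 (enum_rank j).
pose a z s i := x z (inl (inl (s, i))); pose b z s j := x z (inl (inr (s, j))).
pose c z s k := x z (inr (s, k)).
pose G z : tensor R m n l := fun i j k => \sum_(s < r) a z s i * b z s j * c z s k.
have cx j : continuous (x ^~ j) by exact: coord_continuous.
rewrite [X in sigma_closed X](_ : _ =
    [set y | exists z, [/\ (0 : R) = 0, (1 : R) != 0 & y = tensor_mx (G z)]]).
  apply: sigma_closed_image => [k t|t|t]; try exact: cst_continuous.
  case/mxvec_indexP: t => i j; under eq_fun do rewrite tensor_mxE.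
  by apply: continuous_sumr => s; do 2?apply: continuous_mulr; exact: cx.
apply/seteqP; split => A.
  move=> [T [a' [b' [c' TE]]] ->].
  pose y (j : J) := match j with inl (inl (s, i)) => a' s i | inl (inr (s, i)) => b' s i
                               | inr (s, i) => c' s i end.
  exists (\row_i y (enum_val i)); split; rewrite ?oner_eq0//.
  apply/matrixP => k t; case/mxvec_indexP: t => i j; rewrite !tensor_mxE TE.
  by apply: eq_bigr => s _; rewrite /a /b /c /x !mxE !enum_rankK.
by move=> [z [_ _ ->]]; exists (G z) => //; exists (a z), (b z), (c z).
Qed.

Let sum_sqr_eq0 (I : finType) (F : I -> R) : \sum_i F i ^+ 2 = 0 <-> forall i, F i = 0.
Proof.
split=> [H i|H]; last by rewrite big1// => i _; rewrite H expr0n.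
have /psumr_eq0P/(_ H i isT)/eqP : forall i, true -> 0 <= F i ^+ 2 by move=> *; exact: sqr_ge0.
by rewrite sqrf_eq0 => /eqP.
Qed.

Let sum_sqr_neq0 N (v : 'rV[R]_N) : \sum_p v 0 p ^+ 2 != 0 <-> v != 0.
Proof.
split; apply: contra_neq; first by move=> ->; apply/sum_sqr_eq0 => p; rewrite mxE.
by move=> /sum_sqr_eq0 H; apply/rowP => p; rewrite H mxE.
Qed.

Let minors_neq0 N (v w : 'rV[R]_N) : w != 0 ->
  \sum_p \sum_q (v 0 p * w 0 q - v 0 q * w 0 p) ^+ 2 != 0 <-> forall c, v <> c *: w.
Proof.
move=> w0; rewrite pair_big /=; split.
  apply: contra_neqP => /existsNP[c /contrapT ->].
  by apply/sum_sqr_eq0 => -[p q] /=; rewrite !mxE; ring.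
move=> vw; apply/eqP => /(sum_sqr_eq0 (fun pq => v 0 pq.1 * w 0 pq.2 - v 0 pq.2 * w 0 pq.1)) H.
have [p wp] : exists p, w 0 p != 0.
  by apply: contrapT => /forallNP W; move/eqP: w0; apply; apply/rowP => p; rewrite mxE;
   apply/eqP/negPn/negP/W.
apply: (vw (v 0 p / w 0 p)); apply/rowP => q; rewrite mxE.
have /eqP := H (p, q); rewrite /= subr_eq0 => /eqP E.
by rewrite mulrAC E mulfK.
Qed.

(** Membership in the row space is written as a polynomial equation in [Pr] and the [M i]; for
    projections the two agree. *)
Definition segre_points m n k : set 'M[R]_(m * n) :=
  [set Pr | exists M : 'I_k -> 'M[R]_(m, n),
    (forall i, mxvec (M i) *m Pr = mxvec (M i) /\ \rank (M i) = 1%N) /\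
    (forall i j, i != j -> forall c : R, M i <> c *: M j)].

Lemma sigma_closed_segre_points m n k : sigma_closed (@segre_points m n k).
Proof.
pose J : finType := (('I_k * 'I_m) + ('I_k * 'I_n) + ('I_(m * n) * 'I_(m * n)))%type.
pose x (z : 'rV[R]_#|J|) (j : J) := z 0 (enum_rank j).
pose a z s := \row_i x z (inl (inl (s, i))); pose b z s := \row_j x z (inl (inr (s, j))).
pose Pr z := \matrix_(s, t) x z (inr (s, t)).
pose u z s p := mxvec ((a z s)^T *m b z s) 0 p.
(* [h1] is the sum of squares of the membership equations; [h2] is nonzero exactly when no point
   vanishes and, by the 2 x 2 minors, no two are proportional. *)
pose h1 z := \sum_s \sum_p (\sum_t u z s t * Pr z t p - u z s p) ^+ 2.
pose h2 z := (\prod_s \sum_p (u z s p) ^+ 2) *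
  \prod_(st : 'I_k * 'I_k | st.1 != st.2)
    \sum_p \sum_q (u z st.1 p * u z st.2 q - u z st.1 q * u z st.2 p) ^+ 2.
have cx j : continuous (x ^~ j) by exact: coord_continuous.
have cu s p : continuous (fun z => u z s p).
  case/mxvec_indexP: p => i j; under eq_fun do rewrite /u mxvecE mxE big_ord1 !mxE.
  by apply: continuous_mulr; exact: cx.
have cPr s t : continuous (fun z => Pr z s t).
  by under eq_fun do rewrite mxE; exact: cx.
rewrite [X in sigma_closed X](_ : _ = [set y | exists z, [/\ h1 z = 0, h2 z != 0 & y = Pr z]]).
  apply: sigma_closed_image => [//||].
    apply: continuous_sumr => s; apply: continuous_sumr => p.
    have cd : continuous (fun z => \sum_t u z s t * Pr z t p - u z s p).
      by apply: continuous_subr => //; apply: continuous_sumr => t; exact: continuous_mulr.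
    exact: continuous_mulr.
  apply: continuous_mulr.
    by apply: continuous_prodr => s; apply: continuous_sumr => p; exact: continuous_mulr.
  apply: continuous_prodr => st; apply: continuous_sumr => p; apply: continuous_sumr => q.
  have cd : continuous (fun z => u z st.1 p * u z st.2 q - u z st.1 q * u z st.2 p).
    by apply: continuous_subr; exact: continuous_mulr.
  exact: continuous_mulr.
have h1P z : h1 z = 0 <-> forall s, mxvec ((a z s)^T *m b z s) *m Pr z = mxvec ((a z s)^T *m b z s).
  rewrite /h1 pair_big /=; split=> [H s|H].
    apply/rowP => p; rewrite mxE; apply/eqP; rewrite -subr_eq0; apply/eqP.
    have /sum_sqr_eq0 := H; exact: (fun H => H (s, p)).
  apply/sum_sqr_eq0 => -[s p] /=; have /rowP/(_ p) := H s.
  by rewrite mxE /u => ->; rewrite subrr.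
have h2P z : h2 z != 0 <-> (forall s, \rank ((a z s)^T *m b z s) = 1%N) /\
  (forall i j, i != j -> forall c : R, (a z i)^T *m b z i <> c *: ((a z j)^T *m b z j)).
  have rk s : \rank ((a z s)^T *m b z s) = 1%N <-> mxvec ((a z s)^T *m b z s) != 0.
    rewrite mxvec_eq0; split; last exact: rank_one_outer.
    by move=> r1; rewrite -mxrank_eq0 r1.
  have prop s t (c : R) : (a z s)^T *m b z s = c *: ((a z t)^T *m b z t) <->
      mxvec ((a z s)^T *m b z s) = c *: mxvec ((a z t)^T *m b z t).
    by rewrite -[c *: mxvec _]linearZ; split => [->//|/(can_inj mxvecK)].
  rewrite /h2 mulf_eq0 negb_or; split.
    move=> /andP[/prodf_neq0 H1 /prodf_neq0 H2].
    have N0 s : mxvec ((a z s)^T *m b z s) != 0 by apply/sum_sqr_neq0; exact: (H1 s).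
    split=> [s|i j ij c]; first by apply/rk.
    by rewrite prop; apply: (minors_neq0 _ (N0 j)).1; exact: (H2 (i, j)).
  move=> [H1 H2]; apply/andP; split; apply/prodf_neq0 => s.
    by move=> _; apply/sum_sqr_neq0; apply/rk.
  by move=> st; apply/(minors_neq0 _ ((rk _).1 (H1 _))) => c /prop; exact: H2.
apply/seteqP; split => A.
  move=> [M [MA Mdist]].
  have /choice[a' /choice[b' abE]] : forall s, exists a' b', M s = (a' : 'rV_m)^T *m (b' : 'rV_n).
    move=> s; have [t [a' [b' [_ [_ [_ _ _ ->]]]]]] := rank1_normal_form (MA s).2.
    by exists (t *: a'), b'; rewrite [(_ *: _)^T]linearZ /= scalemxAl.
  pose y (j : J) := match j with inl (inl (s, i)) => a' s 0 i | inl (inr (s, i)) => b' s 0 i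
                               | inr (s, i) => A s i end.
  exists (\row_i y (enum_val i)); set z := \row_i _.
  have az s : a z s = a' s by apply/rowP => i; rewrite mxE /x mxE enum_rankK.
  have bz s : b z s = b' s by apply/rowP => i; rewrite mxE /x mxE enum_rankK.
  have AE : A = Pr z by apply/matrixP => s t; rewrite mxE /x mxE enum_rankK.
  split=> //.
    by apply/h1P => s; rewrite az bz -abE -AE; case: (MA s).
  apply/h2P; split => [s|i j ij c].
    by rewrite az bz -abE; case: (MA s).
  by rewrite !az !bz -!abE; exact: Mdist.
move=> [z [/h1P z1 /h2P[z2 z3] ->]].
by exists (fun s => (a z s)^T *m b z s).
Qed.

End sigma_closed_sets.

(** * The law of the row space of a Gaussian tensor *)

Section row_projection.
Variables (R : realType) (l N : nat).

(* Written with the adjugate because [invmx] is defined by cases. *)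
Definition row_proj (A : 'M[R]_(l, N)) : 'M[R]_N :=
  A^T *m ((\det (A *m A^T))^-1 *: \adj (A *m A^T)) *m A.

Lemma row_projM A (Q : 'M[R]_N) : orthogonal_mx Q ->
  row_proj (A *m Q) = Q^T *m row_proj A *m Q.
Proof.
move=> QQ; rewrite /row_proj trmx_mul !mulmxA -(mulmxA A Q) QQ mulmx1.
by rewrite -!mulmxA.
Qed.

Lemma row_projE A : row_free A -> row_proj A = A^T *m invmx (A *m A^T) *m A.
Proof. by move=> Afree; rewrite /row_proj /invmx gram_unitmx. Qed.

Lemma row_proj_eqmx A : row_free A -> (row_proj A :=: A)%MS.
Proof.
move=> Afree; apply/eqmxP/andP; rewrite row_projE// submxMl; split=> //.
have Gunit := gram_unitmx Afree.
apply/submxP; exists A; rewrite !mulmxA mulmxV// mul1mx.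
by [].
Qed.

Lemma row_proj_grass_point A : row_free A -> grass_point l (row_proj A).
Proof.
move=> Afree; split; last split.
- by rewrite row_projE// !trmx_mul trmxK trmx_inv trmx_mul trmxK mulmxA.
- have Gunit := gram_unitmx Afree; rewrite row_projE// !mulmxA.
  by rewrite -(mulmxA _ A) -(mulmxA _ _ (A *m A^T)) mulVmx// mulmx1.
- by rewrite (row_proj_eqmx Afree); apply/eqP.
Qed.

End row_projection.

(** * Measurability of the row projection *)

Section measurable_matrix_functions.
Context (R : realType) d (T : measurableType d).

Definition measurable_mx p q (f : T -> 'M[R]_(p, q)) : Prop :=
  forall i j, measurable_fun setT (fun w => f w i j).

Lemma measurable_mx_cst p q (A : 'M[R]_(p, q)) : measurable_mx (fun=> A).
Proof. by move=> i j; exact: measurable_cst. Qed.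

Lemma measurable_mulmx p q r (f : T -> 'M[R]_(p, q)) (g : T -> 'M[R]_(q, r)) :
  measurable_mx f -> measurable_mx g -> measurable_mx (fun w => f w *m g w).
Proof.
move=> mf mg i j; under eq_fun do rewrite mxE.
by apply: measurable_sum => k; exact: measurable_funM.
Qed.

Lemma measurable_trmx p q (f : T -> 'M[R]_(p, q)) :
  measurable_mx f -> measurable_mx (fun w => (f w)^T).
Proof. by move=> mf i j; under eq_fun do rewrite mxE; exact: mf. Qed.

Lemma measurable_det p (f : T -> 'M[R]_p) :
  measurable_mx f -> measurable_fun setT (fun w => \det (f w)).
Proof.
move=> mf; apply: measurable_sum => s; apply: measurable_funM => //.
by apply: measurable_prod => i _; exact: mf.
Qed.

Lemma measurable_adjugate p (f : T -> 'M[R]_p) :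
  measurable_mx f -> measurable_mx (fun w => \adj (f w)).
Proof.
move=> mf i j; under eq_fun do rewrite mxE.
apply: measurable_funM => //; apply: measurable_det => a b.
by under eq_fun do rewrite !mxE; exact: mf.
Qed.

Lemma measurable_invr (f : T -> R) :
  measurable_fun setT f -> measurable_fun setT (fun w => (f w)^-1).
Proof.
(* [powR] with exponent -1 is measurable and inverts the nonnegative square of [f w]; at zero both
   sides vanish. *)
move=> mf; have invE w : (f w)^-1 = f w * (f w ^+ 2) `^ (-1).
  rewrite powR_inv1 ?sqr_ge0//; have [->|f0] := eqVneq (f w) 0.
    by rewrite invr0 mul0r.
  by rewrite expr2 invfM mulrA mulfV// mul1r.
under eq_fun do rewrite invE.
apply: measurable_funM => //; apply: (measurableT_comp (@measurable_powR R (-1))).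
exact: measurable_funX.
Qed.

Lemma measurable_row_proj l N (f : T -> 'M[R]_(l, N)) :
  measurable_mx f -> measurable_mx (fun w => row_proj (f w)).
Proof.
move=> mf; have mG : measurable_mx (fun w => f w *m (f w)^T).
  by apply: measurable_mulmx => //; exact: measurable_trmx.
apply: measurable_mulmx => //; apply: measurable_mulmx; first exact: measurable_trmx.
move=> i j; under eq_fun do rewrite mxE.
apply: measurable_funM; last exact: measurable_adjugate.
by apply: measurable_invr; exact: measurable_det.
Qed.

End measurable_matrix_functions.

(** * Invariant laws on the Grassmannian *)

Section laws_on_the_grassmannian.
Context (R : realType) d (T : measurableType d) (P : probability T R).

Lemma probability_eq_off_null (A B E : set T) :
  measurable A -> measurable B -> measurable E -> P (~` E) = 0%E ->
  (forall w, E w -> A w <-> B w) -> P A = P B.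
Proof.
suff le C D : measurable C -> measurable D -> measurable E -> P (~` E) = 0%E ->
    (forall w, E w -> C w -> D w) -> (P C <= P D)%E.
  move=> mA mB mE PE AB; apply/eqP; rewrite eq_le !le//.
    by move=> w /AB[].
  by move=> w /AB[].
move=> mC mD mE PE CD; have mE' := measurableC mE.
apply: (@le_trans _ _ (P (D `|` ~` E))).
  apply: le_measure; rewrite ?inE//; first exact: measurableU.
  by move=> w Cw; have [Ew|] := pselect (E w); [left; exact: CD|right].
by apply: (le_trans (measureU2 _ mD mE')); rewrite [X in (_ + X)%E](_ : _ = 0%E)// adde0.
Qed.

Variables (l N : nat).

Lemma measurable_fam_mx : measurable_mx (@fam_mx R N l).
Proof.
move=> i j; have cij := @measurable_coord R ('I_l * 'I_N)%type (i, j).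
by rewrite (_ : (fun x => _) = fun x : fam R ('I_l * 'I_N)%type => x (i, j))//;
  apply/funext => x; rewrite mxE.
Qed.

Lemma grass_point_pid : (l <= N)%N -> grass_point l (pid_mx l : 'M[R]_N).
Proof. by move=> lN; rewrite /grass_point tr_pid_mx pid_mx_id// rank_pid_mx. Qed.

(** Some [Q] conjugates [y] to [pid_mx l], and conjugation preserves both [dist2] and the masses of
    balls. *)
Lemma invariant_ball_homogeneous (L : T -> 'M[R]_N) :
  (forall w, grass_point l (L w)) -> measurable_mx L ->
  (forall Q : 'M[R]_N, givens_prod Q -> forall e y,
    P [set w | dist2 (L w) y < e] = P [set w | dist2 (Q^T *m L w *m Q) y < e]) ->
  ball_homogeneous P (grass_point l) L.
Proof.
move=> GL mL invL; suff H e y : grass_point l y ->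
    P [set w | dist2 (L w) y < e] = P [set w | dist2 (L w) (pid_mx l) < e].
  by split=> // e y y' /H -> /H ->.
move=> [yT [yy ry]]; have [Q gQ QyQ] := projection_diagonalize yT yy.
rewrite [RHS](invL Q)// -ry -QyQ; congr (P _); apply/seteqP; split => w /=;
  by rewrite dist2_orthogonal//; exact: givens_prod_orthogonal.
Qed.

Lemma measurable_dist2_ball e (y : 'M[R]_N) (f : T -> 'M[R]_N) :
  measurable_mx f -> measurable [set w | dist2 (f w) y < e].
Proof. by move=> mf; apply: (@measurable_dist2 _ _ _ _ f (fun=> y)). Qed.

End laws_on_the_grassmannian.

Section two_homogeneous_laws.
Context (R : realType) d (T : measurableType d) (P : probability T R).
Variables (l N : nat).

Lemma uniform_grass_ball_homogeneous (L : T -> 'M[R]_N) :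
  uniform_grass P l L -> ball_homogeneous P (grass_point l) L.
Proof.
move=> [GL [mL invL]]; apply: invariant_ball_homogeneous => // Q gQ e y.
have QQ := givens_prod_orthogonal gQ.
pose X w : fam R ('I_N * 'I_N)%type := fun p => L w p.1 p.2.
pose Y w : fam R ('I_N * 'I_N)%type := fun p => (Q^T *m L w *m Q) p.1 p.2.
have mB : measurable [set x : fam R ('I_N * 'I_N)%type | dist2 (fam_mx x) y < e].
  by apply: measurable_dist2_ball; exact: measurable_fam_mx.
have XE w : fam_mx (X w) = L w by apply/matrixP => i j; rewrite mxE.
have YE w : fam_mx (Y w) = Q^T *m L w *m Q by apply/matrixP => i j; rewrite mxE.
transitivity (P (X @^-1` [set x | dist2 (fam_mx x) y < e])).
  by congr (P _); apply/seteqP; split => w /=; rewrite XE.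
transitivity (P (Y @^-1` [set x | dist2 (fam_mx x) y < e])); last first.
  by congr (P _); apply/seteqP; split => w /=; rewrite YE.
apply: same_law mB.
- by move=> p; exact: mL.
- move=> p; apply: measurable_mulmx; last exact: measurable_mx_cst.
  by apply: measurable_mulmx => //; exact: measurable_mx_cst.
- move=> B mB'; have := invL Q QQ (fun a b => B (a, b)) (fun a b => mB' (a, b)).
  rewrite (_ : \bigcap_x _ = X @^-1` rect B); last first.
    by apply/seteqP; split => w /= H; [move=> [i j]; exact: (H (i, j))|
      move=> [i j] _; exact: (H (i, j))].
  move=> ->; congr (P _).
  by apply/seteqP; split => w /= H; [move=> [i j]; exact: (H (i, j))|
      move=> [i j] _; exact: (H (i, j))].
Qed.

(** Multiplying the Gaussian matrix by [Q] keeps its law and conjugates [row_proj] by [Q]. [L] is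
    tied to [row_proj] on [E] only, since at dependent rows the latter need not be a point of the
    Grassmannian. *)
Lemma iid_normal_ball_homogeneous (X : T -> fam R ('I_l * 'I_N)%type) (E : set T)
    (L : T -> 'M[R]_N) :
  iid_normal P X -> measurable E -> P (~` E) = 0%E ->
  (forall w, grass_point l (L w)) -> measurable_mx L ->
  (forall w, E w -> L w = row_proj (fam_mx (X w))) ->
  ball_homogeneous P (grass_point l) L.
Proof.
move=> iX mE PE GL mL LE; have [mX _] := iX; apply: invariant_ball_homogeneous => // Q gQ e y.
have QQ := givens_prod_orthogonal gQ.
have mXm : measurable_mx (fun w => fam_mx (X w)).
  by move=> i j; under eq_fun do rewrite mxE; exact: mX.
have mp := measurable_row_proj mXm.
have mQ (f : T -> 'M[R]_N) : measurable_mx f -> measurable_mx (fun w => Q^T *m f w *m Q).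
  move=> mf; apply: measurable_mulmx; last exact: measurable_mx_cst.
  by apply: measurable_mulmx => //; exact: measurable_mx_cst.
transitivity (P [set w | dist2 (row_proj (fam_mx (X w))) y < e]).
  apply: (probability_eq_off_null _ _ mE PE); try exact: measurable_dist2_ball.
  by move=> w /LE /= ->.
transitivity (P [set w | dist2 (Q^T *m row_proj (fam_mx (X w)) *m Q) y < e]); last first.
  apply: (probability_eq_off_null _ _ mE PE); try by apply: measurable_dist2_ball; exact: mQ.
  by move=> w /LE /= ->.
have mB : measurable [set x : fam R ('I_l * 'I_N)%type | dist2 (row_proj (fam_mx x)) y < e].
  by apply: measurable_dist2_ball; apply: measurable_row_proj; exact: measurable_fam_mx.
have /= XQ := iid_normal_same_law iX (iid_normal_mul gQ iX) mB.
rewrite [LHS]XQ; congr (P _); apply/seteqP.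
have XQE w : fam_mx (fun p => (fam_mx (X w) *m Q) p.1 p.2) = fam_mx (X w) *m Q.
  by apply/matrixP => i j; rewrite mxE.
by split => w /=; rewrite XQE row_projM.
Qed.

End two_homogeneous_laws.

(** * Comparing the rank event with the Segre event *)

Section segre_count.
Context (R : realType) d (T : measurableType d) (P : probability T R).
Variables (m n l : nat).

Lemma segre_count_geP (Pr : 'M[R]_(m * n)) k : grass_point l Pr ->
  segre_count_ge Pr k <-> @segre_points R m n k Pr.
Proof.
move=> [_ [PrPr _]]; have inP (M : 'M[R]_(m, n)) : in_subspace Pr M <-> mxvec M *m Pr = mxvec M.
  split=> [/submxP[D ->]|MPr]; first by rewrite -mulmxA PrPr.
  by rewrite /in_subspace -MPr submxMl.
by split=> -[M [MPr Mdist]]; exists M; split => // i; have [/inP] := MPr i.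
Qed.

Lemma segre_meetsP (Pr : 'M[R]_(m * n)) : segre_meets Pr <-> segre_count_ge Pr 1.
Proof.
split=> [[M MPr]|[M [MPr _]]]; last by exists (M ord0).
by exists (fun=> M); split => // i j; rewrite !ord1 eqxx.
Qed.

Lemma tensor_mx_inj : injective (@tensor_mx R l m n).
Proof.
move=> t t' tt'; apply/funext => i; apply/funext => j; apply/funext => k.
by rewrite -!tensor_mxE tt'.
Qed.

Lemma measurable_sigma_closed p q (f : T -> 'M[R]_(p, q)) S :
  measurable_mx f -> sigma_closed S -> measurable (f @^-1` S).
Proof.
move=> mf [F cF ->]; rewrite preimage_bigcup; apply: bigcupT_measurable => k.
exact: measurable_closed_preimage.
Qed.

Lemma measurable_tensor_rank_eq (X : T -> tensor R m n l) r :
  measurable_mx (fun w => tensor_mx (X w)) -> measurable [set w | tensor_rank_eq (X w) r].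
Proof.
move=> mX; have mle s : measurable [set w | tensor_rank_le (X w) s].
  rewrite (_ : [set w | _] = (fun w => tensor_mx (X w)) @^-1`
    [set A : 'M[R]_(l, m * n) | exists2 t : tensor R m n l, tensor_rank_le t s & A = tensor_mx t]).
    by apply: measurable_sigma_closed => //; exact: sigma_closed_tensor_rank_le.
  by apply/seteqP; split => w /=; [exists (X w)|move=> [t tr /tensor_mx_inj ->]].
rewrite (_ : [set w | _] = [set w | tensor_rank_le (X w) r] `\`
    \bigcup_(s in `I_r) [set w | tensor_rank_le (X w) s]).
  by apply: measurableD => //; apply: bigcup_measurable.
apply/seteqP; split => w /=.
  by move=> [wr H]; split => // -[s /= sr /H]; rewrite leqNgt sr.
move=> [wr H]; split => // s ws; rewrite leqNgt; apply/negP => sr.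
by apply: H; exists s.
Qed.

Lemma gaussian_iid_normal (X : T -> tensor R m n l) : gaussian_tensor P X ->
  iid_normal P (fun w => (fun p => tensor_mx (X w) p.1 p.2) : fam R ('I_l * 'I_(m * n))%type).
Proof.
move=> [mX [lawX indX]]; split.
  move=> [k p] /=; case/mxvec_indexP: p => i j.
  by under eq_fun do rewrite tensor_mxE; exact: mX.
move=> B mB; pose h (x : 'I_m * 'I_n * 'I_l) := (x.2, mxvec_index x.1.1 x.1.2).
have bh : bijective h.
  have [g gK1 gK2] := curry_mxvec_bij m n.
  exists (fun p => (g p.2, p.1)) => [[[i j] k]|[k p]]; rewrite /h /=.
    by have := gK1 (i, j) isT => /= ->.
  by have := gK2 p isT; case: (g p) => i j /= ->.
have := indX (fun i j k => B (k, mxvec_index i j)) (fun i j k => mB _).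
rewrite (reindex h) /=; last by apply: onW_bij.
under [in X in _ = X -> _]eq_bigr do rewrite lawX//.
move=> <-; congr (P _); apply/seteqP; split => w /= H.
  by move=> [[i j] k] _ /=; have := H (k, mxvec_index i j); rewrite /= tensor_mxE.
move=> [k p] /=; case/mxvec_indexP: p => i j.
by have := H (i, j, k) I; rewrite /= tensor_mxE.
Qed.

(* Off the null event where the entries of [X] are algebraically dependent, the rank condition is
   a condition on the row space of [X], and the law of that row space is the uniform one. *)
Lemma gaussian_rank_law (X : T -> tensor R m n l) (L : T -> 'M[R]_(m * n)) k :
  gaussian_tensor P X -> uniform_grass P l L -> (l <= m * n)%N ->
  (forall (t : tensor R m n l) Pr,
    alg_indep (fun p : 'I_l * 'I_(m * n) => tensor_mx t p.1 p.2) ->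
    (Pr :=: tensor_mx t)%MS -> tensor_rank_eq t l <-> segre_count_ge Pr k) ->
  P [set w | tensor_rank_eq (X w) l] = P [set w | segre_count_ge (L w) k].
Proof.
move=> gX uL lmn rankE; have [GL [mL _]] := uL.
have iX := gaussian_iid_normal gX.
set Y := (fun w => _) in iX; have [mY _] := iX.
pose E := Y @^-1` @alg_indep R ('I_l * 'I_(m * n))%type.
have mE : measurable E.
  by rewrite -[E]setTI; apply: measurable_fam => //; exact: measurable_alg_indep.
have PE : P (~` E) = 0%E by exact: iid_normal_alg_indep iX.
have YE w : fam_mx (Y w) = tensor_mx (X w) by apply/matrixP => i j; rewrite mxE.
have Efree w : E w -> row_free (tensor_mx (X w)) by move=> Ew; exact: generic_tensor_mx_free.
have mX : measurable_mx (fun w => tensor_mx (X w)) by move=> i j; exact: (mY (i, j)).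
(* [ball_homogeneous] asks for a point of the Grassmannian everywhere, so [K] takes the default
   value [pid_mx l] off [E]. *)
pose K w : 'M[R]_(m * n) := if `[< E w >] then row_proj (tensor_mx (X w)) else pid_mx l.
have GK w : grass_point l (K w).
  rewrite /K; case: asboolP => Ew; last exact: grass_point_pid.
  by apply: row_proj_grass_point; exact: Efree.
have mK : measurable_mx K.
  move=> i j; rewrite (_ : (fun w => _) = fun w =>
      \1_E w * row_proj (tensor_mx (X w)) i j + \1_(~` E) w * (pid_mx l : 'M[R]_(m * n)) i j).
    have mp := measurable_row_proj mX.
    apply: measurable_funD; apply: measurable_funM => //; apply: measurable_indic => //.
    exact: measurableC.
  apply/funext => w; rewrite /K !indicE; case: asboolP => Ew.
    by rewrite mem_set// memNset ?mul1r ?mul0r ?addr0//=; exact.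
  by rewrite memNset// mem_set// mul1r mul0r add0r.
have KE w : E w -> K w = row_proj (fam_mx (Y w)) by rewrite /K YE; case: asboolP.
have hK := iid_normal_ball_homogeneous iX mE PE GK mK KE.
have hL := uniform_grass_ball_homogeneous uL.
have cS := @sigma_closed_segre_points R m n k.
transitivity (P (K @^-1` @segre_points R m n k)).
  apply: (probability_eq_off_null _ _ mE PE).
  - exact: measurable_tensor_rank_eq.
  - exact: measurable_sigma_closed.
  move=> w Ew; rewrite /= (iff_sym (segre_count_geP k (GK w))).
  by apply: rankE => //; rewrite /K; case: asboolP => // _; apply: row_proj_eqmx; exact: Efree.
rewrite (ball_homogeneous_unique hK hL cS); congr (P _).
by apply/seteqP; split => w /=; rewrite (segre_count_geP k (GL w)).
Qed.

End segre_count.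

Theorem theorem1p2 (R : realType) (d : measure_display) (Omega : measurableType d)
  (P : probability Omega R) (m n l : nat)
  (T : Omega -> tensor R m n l) (L : Omega -> 'M[R]_(m * n)) :
  (2 <= m)%N -> (m <= n)%N -> (n <= l)%N ->
  gaussian_tensor P T -> uniform_grass P l L ->
  (l = (m - 1) * (n - 1) + 1 ->
     P [set w | tensor_rank_eq (T w) l] = P [set w | segre_count_ge (L w) l])%N /\
  ((m - 1) * (n - 1) + 1 < l <= m * n ->
     P [set w | tensor_rank_eq (T w) l] = P [set w | segre_meets (L w)])%N.
Proof.
move=> m2 mn nl gT uL; have n2 := leq_trans m2 mn; split=> lE.
  apply: (gaussian_rank_law gT uL) => [|t Pr tI PrE]; last exact: generic_rank_eq_count.
  by rewrite lE; case: (m) (n) m2 n2 => [|[|?]] // [|[|?]] //; lia.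
(* A nonempty intersection is a count of at least 1, so both cases use the same comparison of
   laws. *)
rewrite [RHS](_ : _ = P [set w | segre_count_ge (L w) 1]); last first.
  by congr (P _); apply/seteqP; split => w /=; rewrite segre_meetsP.
apply: (gaussian_rank_law gT uL) => [|t Pr tI PrE]; first by case/andP: lE.
exact: iff_trans (generic_rank_eq_meets tI m2 n2 PrE lE) (segre_meetsP Pr).
Qed.
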